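(* Let $y_0\in H^1(0,1)$ with $y_0(0)=0$ and let $y_1\in L^2(0,1)$. Given any $T\in2\mathbb{N}^*$ (a positive even integer), one can choose $\lambda\in[0,1)$ such that $$z_\lambda=\frac{2}{T}-1,$$ and for this $\lambda$ the optimal control $u_1^T$ of $\mathbf{(OCP)}_1^T$ and the optimal control $u_\lambda^\infty$ of $\mathbf{(OCP)}_\lambda^\infty$ (defined in the context, with initial data $(y_0,y_1)$) satisfy $$u_1^T(t)=u_\lambda^\infty(t)\quad\text{for all } t\in(0,2),$$ and $$\left\|u_1^T(\cdot)-u_\lambda^\infty(\cdot)\right\|_{L^2(2k,2k+2)}\le\left|1-|z_\lambda|^k\right|\frac{2}{T}\left(\|y_0'\|_{L^2(0,1)}+\|y_1\|_{L^2(0,1)}\right)$$ for every $k\in\{0,1,\ldots,(T-2)/2\}$.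
   Context: $\mathbb{N}^*=\{1,2,\dots\}$. Identities between $L^2$ functions are understood almost everywhere; $0^0=1$. For $\lambda\in[0,1)$, $z_\lambda=\dfrac{-\lambda}{2-\lambda+2\sqrt{1-\lambda}}\in(-1,0]$. The controlled system is the one-dimensional wave equation with homogeneous Dirichlet condition at $x=0$ and Neumann control at $x=1$: $$\partial_{tt}y(t,x)=\partial_{xx}y(t,x)\ \ (x\in(0,1)),\qquad y(t,0)=0,\qquad \partial_x y(t,1)=u(t).$$ Given $y_0\in H^1(0,1)$ with $y_0(0)=0$, $y_1\in L^2(0,1)$ and a square-integrable control $u$ on the time interval $(0,T)$, there is a unique (finite-energy) solution $y$, continuous in time with values in $H^1(0,1)$ and $C^1$ in time with values in $L^2(0,1)$, such that $y(0,\cdot)=y_0$ and $\partial_t y(0,\cdot)=y_1$. For $\lambda\in[0,1]$ and $T\in[2,+\infty)$, $\mathbf{(OCP)}_\lambda^T$ is the problem of finding $u\in L^2(0,T)$ minimizing $$J_\lambda^T(u)=\int_0^T\left((1-\lambda)\left(\partial_x y(t,0)\right)^2+\lambda u(t)^2\right)dt$$ among all $u\in L^2(0,T)$ such that the solution $y$ with initial data $(y_0,y_1)$ satisfies $y(T,\cdot)=0$ and $\partial_t y(T,\cdot)=0$. For $T=+\infty$ and $\lambda<1$, $\mathbf{(OCP)}_\lambda^\infty$ is the problem of minimizing $J_\lambda^\infty(u)$ (same integral over $(0,+\infty)$) over $u\in L^2(0,+\infty)$, without any terminal constraint. Each of these problems has a unique optimal control, denoted by $u_\lambda^T$ (respectively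 $u_\lambda^\infty$). *)

(* Defs.v *)
From HB Require Import structures.
From mathcomp Require Import all_boot all_order all_algebra.
From mathcomp Require Import all_classical all_reals all_analysis.
Import Order.TTheory GRing.Theory Num.Theory.
Import numFieldNormedType.Exports.

Set Implicit Arguments.
Unset Strict Implicit.
Unset Printing Implicit Defensive.

Local Open Scope classical_set_scope.
Local Open Scope ring_scope.

(* Functions on a set D are represented by total functions, only the values on
   D being relevant; f \_ D extends f by 0 outside of D. *)
Definition L2 {R : realType} (D : set R) (f : R -> R) : Prop :=
  (f \_ D) \in Lfun (@lebesgue_measure R) 2%:E.

Definition L2norm {R : realType} (D : set R) (f : R -> R) : \bar R :=
  'N[@lebesgue_measure R]_(2%:E)[EFin \o (f \_ D)]%E.

Definition ae_eq_on {R : realType} (D : set R) (f g : R -> R) : Prop :=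
  {ae @lebesgue_measure R, forall x, D x -> f x = g x}.

(* f is the continuous representative on [0, 1] of an element of H^1(0, 1),
   with weak derivative df; pointwise values such as f 0 are therefore
   meaningful. *)
Definition H1_with_derivative {R : realType} (f df : R -> R) : Prop :=
  L2 `]0, 1[ df /\
  forall x : R, 0 <= x <= 1 ->
    f x = f 0 + \int[@lebesgue_measure R]_(s in `]0, x[) df s.

(* y t x is the state at time t and position x; yx t and yt t are the
   derivatives of y in x (weak derivative) and in t (derivative with values in
   L^2(0, 1)). *)
Record finite_energy_solution {R : realType} (T : R) (y0 y1 u : R -> R)
    (y yx yt : R -> R -> R) : Prop := FiniteEnergySolution {
  fes_H1 : forall t : R, 0 <= t <= T -> H1_with_derivative (y t) (yx t) ;
  fes_L2 : forall t : R, 0 <= t <= T -> L2 `]0, 1[ (yt t) ;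
  (* y \in C([0, T]; H^1(0, 1)) *)
  fes_continuous : forall t : R, 0 <= t <= T ->
    L2norm `]0, 1[ (y s \- y t) @[s --> within `[0, T] (nbhs t)] --> 0%E ;
  fes_continuous_x : forall t : R, 0 <= t <= T ->
    L2norm `]0, 1[ (yx s \- yx t) @[s --> within `[0, T] (nbhs t)] --> 0%E ;
  (* y \in C^1([0, T]; L^2(0, 1)) *)
  fes_derivative_t : forall t : R, 0 <= t <= T ->
    L2norm `]0, 1[ (fun x => (y s x - y t x) / (s - t) - yt t x)
      @[s --> within `[0, T] t^'] --> 0%E ;
  fes_continuous_t : forall t : R, 0 <= t <= T ->
    L2norm `]0, 1[ (yt s \- yt t) @[s --> within `[0, T] (nbhs t)] --> 0%E ;
  fes_dirichlet : forall t : R, 0 <= t <= T -> y t 0 = 0 ;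
  fes_initial_state : forall x : R, 0 <= x <= 1 -> y 0 x = y0 x ;
  fes_initial_speed : ae_eq_on `]0, 1[ (yt 0) y1 ;
  (* Variational form, integrated in time, of y_tt = y_xx with the Neumann
     condition y_x(t, 1) = u(t): multiply by phi \in H^1(0, 1), phi(0) = 0,
     and integrate by parts in x. *)
  fes_wave : forall phi dphi, H1_with_derivative phi dphi -> phi 0 = 0 ->
    forall t : R, 0 <= t <= T ->
      \int[@lebesgue_measure R]_(x in `]0, 1[) (yt t x * phi x) =
      \int[@lebesgue_measure R]_(x in `]0, 1[) (y1 x * phi x) +
      \int[@lebesgue_measure R]_(s in `]0, t[)
        (u s * phi 1 -
         \int[@lebesgue_measure R]_(x in `]0, 1[) (yx s x * dphi x)) }.

(* g = y_x(., 0) in L^2(0, T).  For a finite-energy solution y_x(t, .) is only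
   an L^2 function of x for fixed t, so the boundary derivative is taken in the
   sense of L^2 functions of time (hidden regularity). *)
Definition boundary_derivative0 {R : realType} (T : R) (y : R -> R -> R)
    (g : R -> R) : Prop :=
  L2 `]0, T[ g /\
  L2norm `]0, T[ (fun t => (y t e - y t 0) / e - g t) @[e --> 0^'+] --> 0%E.

Definition admissible {R : realType} (T : R) (y0 y1 u g : R -> R) : Prop :=
  L2 `]0, T[ u /\
  exists y yx yt : R -> R -> R,
    [/\ finite_energy_solution T y0 y1 u y yx yt,
        boundary_derivative0 T y g,
        forall x : R, 0 <= x <= 1 -> y T x = 0
      & ae_eq_on `]0, 1[ (yt T) (cst 0)].

Definition admissible_infinite {R : realType} (y0 y1 u g : R -> R) : Prop :=
  L2 `]0, +oo[ u /\
  exists y yx yt : R -> R -> R, forall T : R, 0 < T ->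
    finite_energy_solution T y0 y1 u y yx yt /\ boundary_derivative0 T y g.

(* The value may be +oo when D is unbounded. *)
Definition cost {R : realType} (lambda : R) (D : set R) (u g : R -> R)
    : \bar R :=
  (\int[@lebesgue_measure R]_(t in D)
     ((1 - lambda) * g t ^+ 2 + lambda * u t ^+ 2)%:E)%E.

Definition optimal_control {R : realType} (lambda T : R) (y0 y1 u : R -> R)
    : Prop :=
  exists g, admissible T y0 y1 u g /\
    forall v h, admissible T y0 y1 v h ->
      (cost lambda `]0%R, T[ u g <= cost lambda `]0%R, T[ v h)%E.

Definition optimal_control_infinite {R : realType} (lambda : R)
    (y0 y1 u : R -> R) : Prop :=
  exists g, admissible_infinite y0 y1 u g /\
    forall v h, admissible_infinite y0 y1 v h ->
      (cost lambda `]0%R, +oo[ u g <= cost lambda `]0%R, +oo[ v h)%E.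

Definition zlam {R : realType} (lambda : R) : R :=
  - lambda / (2 - lambda + 2 * Num.sqrt (1 - lambda)).

(* Main.v *)
Require Import Defs.
From mathcomp Require Import all_boot all_order all_algebra.
From mathcomp Require Import all_classical all_reals all_analysis.
From mathcomp Require Import measurable_realfun ring lra.
Import Order.TTheory GRing.Theory Num.Theory.
Import numFieldNormedType.Exports.
Set Implicit Arguments.
Unset Strict Implicit.
Unset Printing Implicit Defensive.
Local Open Scope classical_set_scope.
Local Open Scope ring_scope.

(** The solutions of y_tt = y_xx with y(t, 0) = 0 are y(t, x) = F(t + x) - F(t - x).
    With f = F', the control is u(t) = f(t + 1) + f(t - 1), the boundary
    derivative is y_x(t, 0) = 2 f(t), and the initial data amount to prescribing
    f on ]-1, 1[; call this profile a ([init]).  Cut f into the blocks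
    phi_k(s) = f(2 k + s), s in [-1, 1[, and put
    u_k(s) = u(2 k + 1 + s) = phi_(k+1)(s) + phi_k(s).  Both optimal control
    problems become quadratic problems in discrete time k, with s as a mere
    label.

    Horizon T = 2 n and lambda = 1 ([finite_optimal]).  The constraint phi_n = 0
    says that the alternating sum of u_0, ..., u_(n-1) is a.  The cheapest such
    sequence has equal alternating terms: u_k = (-1)^k a / n.

    Infinite horizon ([infinite_optimal]).  Put z = z_lambda, that is
    lambda = - 4 z / (1 - z)^2.  Completing squares shows that, up to a constant
    factor, the cost of N blocks is
    - z (1 + z) (|a|^2 - |phi_N|^2) plus the sum of |phi_(k+1) - z phi_k|^2
    ([block_cost], [total_cost]).  The choice phi_k = z^k a has the finite cost
    - z (1 + z) |a|^2; comparing with it first makes the norms of the optimal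
    phi_k square summable, then forces all the deviations phi_(k+1) - z phi_k to
    vanish.  Hence u_k = (1 + z) z^k a.

    When z = 2 / T - 1, 1 + z = 1 / n.  The two controls agree for k = 0, and
    differ by (1 - |z|^k) (2 / T) a up to sign on the k-th window; finally
    |a|^2 = (|y0'|^2 + |y1|^2) / 2 ([sqn_init]).

    The reduction to blocks rests on the theory of the wave equation.  For any
    locally square integrable f, d'Alembert's formula defines a finite-energy
    solution ([wave_solution], [wave_boundary]), because translations are
    continuous in L^2 and difference quotients of a primitive converge in L^2
    ([translation_L2], [difference_quotient_L2]).  Conversely every finite-energy
    solution arises in this way, by uniqueness ([fes_unique]): Green's identity
    pairs a solution having zero data and zero control with a d'Alembert wave
    that vanishes at a given time, where its velocity is the solution itself
    ([green_identity], [free_solution_at]).  This identifies the boundary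
    derivative and the final profile of an arbitrary admissible pair
    ([solution_profile]). *)

(** * Square integrable functions on a measurable set *)

Section SquareIntegrable.
Context {R : realType}.
Local Notation mu := (@lebesgue_measure R).
Implicit Types (D : set (measurableTypeR R)) (f g h : R -> R).

(** [measurable_itv] for the Borel structure that carries the Lebesgue measure;
    unification does not find that structure from an interval alone. *)
Lemma mitv (i : interval R) : measurable ([set` i] : set (measurableTypeR R)).
Proof. exact: measurable_itv. Qed.

Lemma aeS (P Q : R -> Prop) : (forall x, P x -> Q x) ->
  {ae mu, forall x, P x} -> {ae mu, forall x, Q x}.
Proof. by move=> PQ; apply: (@filterS _ _ (ae_filter_ringOfSetsType mu)). Qed.

Lemma aeS2 (P Q S : R -> Prop) : (forall x, P x -> Q x -> S x) ->
  {ae mu, forall x, P x} -> {ae mu, forall x, Q x} -> {ae mu, forall x, S x}.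
Proof.
by move=> PQ; apply: (@filterS2 _ _ (ae_filter_ringOfSetsType mu)).
Qed.

Lemma le_Rint D f g : measurable D -> mu.-integrable D (EFin \o f) ->
  mu.-integrable D (EFin \o g) -> (forall x, D x -> f x <= g x) ->
  \int[mu]_(x in D) f x <= \int[mu]_(x in D) g x.
Proof. exact: le_Rintegral. Qed.

Lemma integrable_add D f g : measurable D -> mu.-integrable D (EFin \o f) ->
  mu.-integrable D (EFin \o g) ->
  mu.-integrable D (EFin \o (fun x => f x + g x)).
Proof. by move=> mD fi gi; apply: eq_integrable (integrableD mD fi gi). Qed.

Lemma integrable_sub D f g : measurable D -> mu.-integrable D (EFin \o f) ->
  mu.-integrable D (EFin \o g) ->
  mu.-integrable D (EFin \o (fun x => f x - g x)).
Proof. by move=> mD fi gi; apply: eq_integrable (integrableB mD fi gi). Qed.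

Lemma integrable_abs D f : mu.-integrable D (EFin \o f) ->
  mu.-integrable D (EFin \o (fun x => `|f x|)).
Proof. by move=> fi; exact: (integrable_norm fi). Qed.

Lemma integrable_scale D (k : R) f : measurable D ->
  mu.-integrable D (EFin \o f) ->
  mu.-integrable D (EFin \o (fun x => k * f x)).
Proof. by move=> mD fi; apply: eq_integrable (integrableZl mD k fi). Qed.

Definition ip D f g : R := \int[mu]_(x in D) (f x * g x).

Definition sqn D f : R := \int[mu]_(x in D) (f x ^+ 2).

Lemma sqnE D f : sqn D f = ip D f f.
Proof. by []. Qed.

Lemma L2P D f : measurable D -> L2 D f <->
  measurable_fun D f /\ mu.-integrable D (EFin \o (fun x => f x ^+ 2)).
Proof.
move=> mD; split.
- rewrite /L2 => Lf; have /integrableP[_ _] := Lfun2_integrable_sqr Lf.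
  move: (Lf); rewrite inE => /andP[]; rewrite !inE/= => mf _.
  split; first exact/(measurable_restrictT _ mD).
  apply/(integrable_mkcond _ mD).
  move: (Lfun2_integrable_sqr Lf); apply: eq_integrable => //= x _.
  by rewrite /patch/=; case: ifP => // _; rewrite expr0n.
- move=> [mf /(integrable_mkcond _ mD) intf].
  rewrite /L2 inE; apply/andP; split; rewrite inE/=.
    exact/(measurable_restrictT _ mD).
  rewrite /finite_norm unlock poweR_lty//.
  case/integrableP : intf => _; apply: le_lt_trans.
  rewrite le_eqVlt; apply/orP; left; apply/eqP.
  apply: eq_integral => x _ /=; rewrite /patch/=; case: ifP => //= _.
    by rewrite powR_mulrn// real_normK// ?num_real// ger0_norm// sqr_ge0.
  by rewrite normr0 powR0//.
Qed.

Lemma L2_meas D f : measurable D -> L2 D f -> measurable_fun D f.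
Proof. by move=> mD /(L2P _ mD)[]. Qed.

Lemma L2_sqr D f : measurable D -> L2 D f ->
  mu.-integrable D (EFin \o (fun x => f x ^+ 2)).
Proof. by move=> mD /(L2P _ mD)[]. Qed.

Lemma L2_mul D f g : measurable D -> L2 D f -> L2 D g ->
  mu.-integrable D (EFin \o (fun x => f x * g x)).
Proof.
move=> mD Lf Lg; have mf := L2_meas mD Lf; have mg := L2_meas mD Lg.
have i2 := integrableD mD (L2_sqr mD Lf) (L2_sqr mD Lg).
apply: le_integrable i2 => //.
  by apply/measurable_EFinP; exact: measurable_funM.
move=> x _ /=; rewrite lee_fin [leRHS]ger0_norm ?addr_ge0 ?sqr_ge0//.
rewrite ler_norml; have := sqr_ge0 (f x + g x); have := sqr_ge0 (f x - g x).
by rewrite sqrrB sqrrD => ? ?; apply/andP; split; have := sqr_ge0 (f x);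
  have := sqr_ge0 (g x); lra.
Qed.

Lemma L2_lin D (a b : R) f g : measurable D -> L2 D f -> L2 D g ->
  L2 D (fun x => a * f x + b * g x).
Proof.
move=> mD Lf Lg; apply/(L2P _ mD); split.
  by apply: measurable_funD; apply: measurable_funM => //; exact: L2_meas.
have i1 := integrableZl mD (a ^+ 2) (L2_sqr mD Lf).
have i2 := integrableZl mD (b ^+ 2) (L2_sqr mD Lg).
have i3 := integrableZl mD (2 * a * b) (L2_mul mD Lf Lg).
have := integrableD mD (integrableD mD i1 i2) i3.
apply: eq_integrable => // x _ /=; rewrite -!EFinM -!EFinD.
by congr EFin; ring.
Qed.

Lemma eq_L2 D f g : (forall x, D x -> f x = g x) -> L2 D f -> L2 D g.
Proof.
move=> fg; rewrite /L2 (_ : g \_ D = f \_ D)//.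
by apply/funext => x; rewrite /patch; case: ifP => // /set_mem /fg.
Qed.

Lemma L2_0 D : measurable D -> L2 D (fun=> 0).
Proof.
move=> mD; apply/(L2P _ mD); split; first exact: measurable_cst.
by apply: eq_integrable (integrable0 _ _) => // x _ /=; rewrite expr0n.
Qed.

Lemma L2_scale D (a : R) f : measurable D -> L2 D f -> L2 D (fun x => a * f x).
Proof.
move=> mD Lf; have := L2_lin a 0 mD Lf (L2_0 mD).
by apply: eq_L2 => x _; ring.
Qed.

Lemma L2_add D f g : measurable D -> L2 D f -> L2 D g ->
  L2 D (fun x => f x + g x).
Proof.
by move=> mD Lf Lg; have := L2_lin 1 1 mD Lf Lg; apply: eq_L2 => x _; ring.
Qed.

Lemma L2_sub D f g : measurable D -> L2 D f -> L2 D g ->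
  L2 D (fun x => f x - g x).
Proof.
by move=> mD Lf Lg; have := L2_lin 1 (-1) mD Lf Lg; apply: eq_L2 => x _; ring.
Qed.

Lemma L2_subset (D E : set (measurableTypeR R)) f :
  measurable D -> measurable E -> D `<=` E ->
  L2 E f -> L2 D f.
Proof.
move=> mD mE DE /(L2P _ mE)[mf intf]; apply/(L2P _ mD); split.
  exact: measurable_funS mf.
exact: integrableS intf.
Qed.

Lemma L2_setU D E f : measurable D -> measurable E ->
  L2 D f -> L2 E f -> L2 (D `|` E) f.
Proof.
move=> mD mE /(L2P _ mD)[mf1 if1] /(L2P _ mE)[mf2 if2].
apply/(L2P _ (measurableU _ _ mD mE)); split.
  exact/measurable_funU.
have mf : measurable_fun (D `|` E) (EFin \o (fun x => f x ^+ 2)).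
  by apply/measurable_EFinP/measurable_funX/measurable_funU.
apply/integrableP; split => //.
have DUE : D `|` E = D `|` (E `\` D).
  apply/seteqP; split=> [x [Dx|Ex]|x [Dx|[Ex _]]]; [by left| |by left|by right].
  by have [Dx|nDx] := pselect (D x); [left|right].
rewrite DUE ge0_integral_setU//; first last.
- by apply/disj_setPS => x [Dx [_]].
- by rewrite -DUE; exact: measurableT_comp.
- exact: measurableD.
apply: lte_add_pinfty; first by case/integrableP : if1.
have : mu.-integrable (E `\` D) (EFin \o (fun x => f x ^+ 2)).
  by apply: integrableS if2 => //; exact: measurableD.
by case/integrableP.
Qed.

Lemma L2_patch D f : measurable D -> L2 D f <-> L2 setT (f \_ D).
Proof.
by move=> mD; rewrite /L2 (_ : (f \_ D) \_ setT = f \_ D)// patch_setT.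
Qed.

Lemma L2_integrable D f : measurable D -> (mu D < +oo)%E -> L2 D f ->
  mu.-integrable D (EFin \o f).
Proof.
move=> mD Doo Lf; have mf := L2_meas mD Lf.
have L1 : L2 D (cst 1).
  apply/(L2P _ mD); split; first exact: measurable_cst.
  apply/integrableP; split; first exact/measurable_EFinP/measurable_funX.
  under eq_integral do rewrite /= expr1n normr1.
  by rewrite integral_cst// mul1e.
by apply: eq_integrable (L2_mul mD Lf L1) => // x _ /=; rewrite mulr1.
Qed.

Lemma ip_linl D (a b : R) f g h : measurable D ->
  L2 D f -> L2 D g -> L2 D h ->
  ip D (fun x => a * f x + b * g x) h = a * ip D f h + b * ip D g h.
Proof.
move=> mD Lf Lg Lh; rewrite /ip -!RintegralZl//; try exact: L2_mul.
rewrite -RintegralD//.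
- by apply: eq_Rintegral => x _; ring.
- by apply: eq_integrable (L2_mul mD (L2_scale a mD Lf) Lh) => // x _ /=;
    rewrite mulrA.
- by apply: eq_integrable (L2_mul mD (L2_scale b mD Lg) Lh) => // x _ /=;
    rewrite mulrA.
Qed.

Lemma ipC D f g : ip D f g = ip D g f.
Proof. by apply: eq_Rintegral => x _; rewrite mulrC. Qed.

Lemma eq_ip D f g f' g' : (forall x, D x -> f x = f' x) ->
  (forall x, D x -> g x = g' x) -> ip D f g = ip D f' g'.
Proof.
by move=> ff gg; apply: eq_Rintegral => x /set_mem Dx; rewrite ff// gg.
Qed.

Lemma eq_sqn D f g : (forall x, D x -> f x = g x) -> sqn D f = sqn D g.
Proof. by move=> fg; apply: eq_ip. Qed.

Lemma ipBl D f g h : measurable D -> L2 D f -> L2 D g -> L2 D h ->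
  ip D (fun x => f x - g x) h = ip D f h - ip D g h.
Proof.
move=> mD Lf Lg Lh; rewrite -[ip D f h]mul1r -mulN1r -ip_linl//.
by apply: eq_ip => // x _; rewrite mul1r mulN1r.
Qed.

Lemma ipBr D f g h : measurable D -> L2 D f -> L2 D g -> L2 D h ->
  ip D h (fun x => f x - g x) = ip D h f - ip D h g.
Proof. by move=> *; rewrite ipC ipBl// ipC (ipC _ g). Qed.

Lemma ipDl D f g h : measurable D -> L2 D f -> L2 D g -> L2 D h ->
  ip D (fun x => f x + g x) h = ip D f h + ip D g h.
Proof.
move=> mD Lf Lg Lh; rewrite -[ip D f h]mul1r -[ip D g h]mul1r -ip_linl//.
by apply: eq_ip => // x _; rewrite !mul1r.
Qed.

Lemma ipZl D (a : R) f h : measurable D -> L2 D f -> L2 D h ->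
  ip D (fun x => a * f x) h = a * ip D f h.
Proof.
move=> mD Lf Lh; rewrite -[RHS]addr0 -[X in _ + X](mul0r (ip D f h)) -ip_linl//.
by apply: eq_ip => // x _; ring.
Qed.

Lemma ipZr D (a : R) f h : measurable D -> L2 D f -> L2 D h ->
  ip D h (fun x => a * f x) = a * ip D h f.
Proof. by move=> *; rewrite ipC ipZl// ipC. Qed.

Lemma sqn_lin D (a b : R) f g : measurable D -> L2 D f -> L2 D g ->
  sqn D (fun x => a * f x + b * g x) =
  a ^+ 2 * sqn D f + 2 * a * b * ip D f g + b ^+ 2 * sqn D g.
Proof.
move=> mD Lf Lg; have L := L2_lin a b mD Lf Lg.
rewrite !sqnE ip_linl// ![ip D _ (fun _ => _ + _)]ipC !ip_linl//.
by rewrite [ip D g f]ipC; ring.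
Qed.

Lemma sqnZ D (a : R) f : measurable D -> L2 D f ->
  sqn D (fun x => a * f x) = a ^+ 2 * sqn D f.
Proof.
by move=> mD Lf; rewrite !sqnE ipZl ?ipZr//; [ring|exact: L2_scale].
Qed.

Lemma sqn_ge0 D f : 0 <= sqn D f.
Proof. by apply: Rintegral_ge0 => x _; exact: sqr_ge0. Qed.

Lemma sqn_add_le D f g : measurable D -> L2 D f -> L2 D g ->
  sqn D (fun x => f x + g x) <= 2 * sqn D f + 2 * sqn D g.
Proof.
move=> mD Lf Lg; have := sqn_ge0 D (fun x => 1 * f x + (-1) * g x).
rewrite (_ : sqn D (fun x => f x + g x) = sqn D (fun x => 1 * f x + 1 * g x)).
  by rewrite !sqn_lin//; lra.
by apply: eq_sqn => x _; rewrite !mul1r.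
Qed.

Lemma sqn_sub_le D f g : measurable D -> L2 D f -> L2 D g ->
  sqn D (fun x => f x - g x) <= 2 * sqn D f + 2 * sqn D g.
Proof.
move=> mD Lf Lg; have := sqn_ge0 D (fun x => 1 * f x + 1 * g x).
rewrite (_ : sqn D (fun x => f x - g x) = sqn D (fun x => 1 * f x + (-1) * g x)).
  by rewrite !sqn_lin//; lra.
by apply: eq_sqn => x _; rewrite mul1r mulN1r.
Qed.

Lemma ip_CS D f g : measurable D -> L2 D f -> L2 D g ->
  `|ip D f g| <= Num.sqrt (sqn D f) * Num.sqrt (sqn D g).
Proof.
move=> mD Lf Lg; rewrite -sqrtrM ?sqn_ge0// -sqrtr_sqr ler_wsqrtr//.
have g0 := sqn_ge0 D g; have f0 := sqn_ge0 D f.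
have H t : 0 <= sqn D f + 2 * t * ip D f g + t ^+ 2 * sqn D g.
  by have := sqn_ge0 D (fun x => 1 * f x + t * g x); rewrite sqn_lin//; lra.
(* The t minimizing |f + t g|^2; when |g| = 0, a t that would make the
   affine function of t equal to - 1. *)
have [g00|gN0] := eqVneq (sqn D g) 0.
  have [->|iN0] := eqVneq (ip D f g) 0; first by rewrite expr0n mulr_ge0.
  have := H (- (sqn D f + 1) / (2 * ip D f g)); rewrite g00 mulr0 addr0.
  by rewrite (_ : 2 * _ * _ = - (sqn D f + 1)); [lra|field].
have := H (- ip D f g / sqn D g).
rewrite (_ : _ + _ + _ = (sqn D f * sqn D g - ip D f g ^+ 2) / sqn D g).
  by rewrite pmulr_lge0 ?invr_gt0 ?lt_neqAle 1?eq_sym ?gN0// subr_ge0.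
by field.
Qed.

Lemma L2normE D f : measurable D -> L2 D f ->
  L2norm D f = (Num.sqrt (sqn D f))%:E.
Proof.
move=> mD Lf; rewrite /L2norm unlock.
have [_ /integrableP[_]] := (L2P f mD).1 Lf.
have -> : (\int[mu]_x (`|(EFin \o f \_ D) x| `^ 2))%E =
          (\int[mu]_(x in D) (f x ^+ 2)%:E)%E.
  rewrite [RHS]integral_mkcond; apply: eq_integral => x _ /=.
  rewrite /patch/=; case: ifP => //= _.
    by rewrite powR_mulrn// real_normK// num_real.
  by rewrite normr0 powR0.
under eq_integral do rewrite /= ger0_norm ?sqr_ge0//.
move=> fin; rewrite poweR12_sqrt; last first.
  by apply: integral_ge0 => x _; rewrite lee_fin sqr_ge0.
rewrite /sqn /Rintegral -{1}[X in sqrte X]fineK// ge0_fin_numE//.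
by apply: integral_ge0 => x _; rewrite lee_fin sqr_ge0.
Qed.

Lemma sqn_eq0_ae D f : measurable D -> L2 D f -> sqn D f = 0 ->
  ae_eq_on D f (cst 0).
Proof.
move=> mD Lf; have mf := L2_meas mD Lf.
have i2 := L2_sqr mD Lf.
rewrite /sqn /Rintegral => /eqP; rewrite fine_eq0; last first.
  exact: integrable_fin_num i2.
move/eqP => s0.
have : (\int[mu]_(x in D) `|(f x ^+ 2)%:E| = 0)%E.
  by rewrite -[RHS]s0; apply: eq_integral => x _; rewrite gee0_abs ?lee_fin ?sqr_ge0.
move/(ae_eq_integral_abs mu mD (measurable_int _ i2)).1.
apply: aeS => x /= H Dx; have /= := H Dx.
by move=> [] /eqP; rewrite sqrf_eq0 => /eqP.
Qed.

Lemma sqn_ae0 D f : measurable D -> L2 D f -> ae_eq_on D f (cst 0) ->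
  sqn D f = 0.
Proof.
move=> mD Lf f0; rewrite /sqn /Rintegral.
rewrite (ae_eq_integral (cst 0%E))// ?integral0//.
- exact: (measurable_int _ (L2_sqr mD Lf)).
- by apply: aeS f0 => x H Dx /=; rewrite H// expr0n.
Qed.

Lemma sqn_ae D f g : measurable D -> L2 D f -> L2 D g -> ae_eq_on D f g ->
  sqn D f = sqn D g.
Proof.
move=> mD Lf Lg fg; rewrite /sqn /Rintegral; congr fine.
apply: ae_eq_integral => //.
- exact: (measurable_int _ (L2_sqr mD Lf)).
- exact: (measurable_int _ (L2_sqr mD Lg)).
- by apply: aeS fg => x H Dx /=; rewrite H.
Qed.

(** Convergence in L^2 in terms of real numbers. *)
Lemma sqn_cvg0 (T : Type) (F : set_system T) (FF : Filter F) D (a : T -> R -> R) :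
  measurable D -> (\forall s \near F, L2 D (a s)) ->
  L2norm D (a s) @[s --> F] --> 0%E <-> sqn D (a s) @[s --> F] --> 0.
Proof.
move=> mD La; split => H.
- have /fine_cvgP[_ H1] := H.
  have H2 := cvgM H1 H1; rewrite mulr0 in H2.
  apply: (cvg_trans _ (H2 FF)); apply: near_eq_cvg.
  near=> s; rewrite /= L2normE//; last by near: s.
  by rewrite /= -expr2 sqr_sqrtr// sqn_ge0.
- have H1 : Num.sqrt (sqn D (a s)) @[s --> F] --> (0 : R).
    rewrite -[X in _ --> X]sqrtr0.
    by apply: (continuous_cvg _ _ H); exact: sqrt_continuous.
  have H2 : (Num.sqrt (sqn D (a s)))%:E @[s --> F] --> (0%R : R)%:E.
    by apply/fine_cvgP; split => //; apply: nearW.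
  apply: (cvg_trans _ H2); apply: near_eq_cvg.
  by near=> s; rewrite /= L2normE//; near: s.
Unshelve. all: by end_near. Qed.

End SquareIntegrable.

(** * Invariance of the integral under translations and reflections *)

Section Isometries.
Context {R : realType}.
Local Notation mu := (@lebesgue_measure R).
Implicit Types (D : set (measurableTypeR R)) (f g : R -> R).

Section MeasurePreserving.
Variable phi : measurableTypeR R -> measurableTypeR R.
Hypothesis mphi : measurable_fun setT phi.
Hypothesis muphi : forall A, measurable A -> mu (phi @^-1` A) = mu A.

Lemma measurable_preimage_preserving D : measurable D ->
  measurable (phi @^-1` D).
Proof. by move=> mD; rewrite -[X in measurable X]setTI; exact: mphi. Qed.

Lemma ge0_integral_preserving D (f : R -> \bar R) : measurable D ->
  measurable_fun D f -> (forall x, 0 <= f x)%E ->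
  (\int[mu]_(x in phi @^-1` D) f (phi x) = \int[mu]_(x in D) f x)%E.
Proof.
move=> mD mf f0; rewrite -(ge0_integral_pushforward mphi)//.
by apply: eq_measure_integral => //= A mA _; exact: muphi.
Qed.

Lemma measurable_comp_preserving d (U : measurableType d) D (f : R -> U) :
  measurable D -> measurable_fun D f ->
  measurable_fun (phi @^-1` D) (f \o phi).
Proof.
move=> mD mf; apply: (measurable_comp mD) => //.
- by move=> _ [x Dx <-].
- exact: measurable_funS mphi.
Qed.

Lemma Rintegral_preserving D f : measurable D -> measurable_fun D f ->
  \int[mu]_(x in phi @^-1` D) f (phi x) = \int[mu]_(x in D) f x.
Proof.
move=> mD mf; rewrite /Rintegral; congr fine; rewrite [LHS]integralE [RHS]integralE.
have mF : measurable_fun D (EFin \o f) by exact/measurable_EFinP.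
congr (_ - _)%E.
- rewrite -(@ge0_integral_preserving D (fun x => ((EFin \o f)^\+)%E x)) //.
    by apply: eq_integral => x _; rewrite !funeposE.
  exact: measurable_funepos.
- rewrite -(@ge0_integral_preserving D (fun x => ((EFin \o f)^\-)%E x))//.
    by apply: eq_integral => x _; rewrite !funenegE.
  exact: measurable_funeneg.
Qed.

Lemma L2_preserving D f : measurable D -> L2 D f ->
  L2 (phi @^-1` D) (f \o phi).
Proof.
move=> mD /(L2P _ mD)[mf /integrableP[mf2 if2]].
have mD' := measurable_preimage_preserving mD.
have mfp := measurable_comp_preserving mD mf.
apply/(L2P _ mD'); split => //.
apply/integrableP; split; first by apply/measurable_EFinP; exact: measurable_funX.
rewrite (@ge0_integral_preserving D (fun x => `|(f x ^+ 2)%:E|%E))//.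
exact: measurableT_comp.
Qed.

Lemma integrable_preserving D f : measurable D ->
  mu.-integrable D (EFin \o f) ->
  mu.-integrable (phi @^-1` D) (EFin \o (f \o phi)).
Proof.
move=> mD /integrableP[/measurable_EFinP mf if2].
have mfp := measurable_comp_preserving mD mf.
apply/integrableP; split; first exact/measurable_EFinP.
rewrite (@ge0_integral_preserving D (fun x => `|(f x)%:E|%E))//.
by apply: measurableT_comp => //; exact/measurable_EFinP.
Qed.

End MeasurePreserving.

Lemma measurable_shift (h : R) :
  measurable_fun setT (fun x : measurableTypeR R => h + x : measurableTypeR R).
Proof. exact: measurable_funD. Qed.

Lemma measurable_reflect (h : R) :
  measurable_fun setT (fun x : measurableTypeR R => h - x : measurableTypeR R).
Proof. exact: measurable_funB. Qed.

Lemma preimage_shift_itv (h a b : R) (c d : bool) :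
  (fun x => h + x) @^-1` [set` Interval (BSide c (h + a)) (BSide d (h + b))] =
  [set` Interval (BSide c a) (BSide d b)].
Proof.
apply/seteqP; split => x /=; rewrite !in_itv/=;
  by case: c; case: d => /=; rewrite ?lerD2l ?ltrD2l.
Qed.

Lemma preimage_reflect_itv (h a b : R) (c d : bool) :
  (fun x => h - x) @^-1` [set` Interval (BSide c (h - b)) (BSide d (h - a))] =
  [set` Interval (BSide (~~ d) a) (BSide (~~ c) b)].
Proof.
by apply/seteqP; split => x /=; rewrite !in_itv/=; case: c; case: d => /=;
  rewrite ?lerD2l ?ltrD2l ?lerN2 ?ltrN2 andbC.
Qed.

Lemma lebesgue_measure_shift (h : R) (A : set (measurableTypeR R)) :
  measurable A -> mu ((fun x => h + x) @^-1` A) = mu A.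
Proof.
move=> mA; have mh := measurable_shift h.
suff : mu A = pushforward mu (fun x : measurableTypeR R => h + x : measurableTypeR R) A by [].
apply: (@lebesgue_measure_unique _ (pushforward mu _)) => //= _ [[a b]] _ <-.
rewrite /pushforward /=.
have := preimage_shift_itv h (a - h) (b - h) false false; rewrite !subrKC => ->.
by rewrite !lebesgue_measure_itv/= !lte_fin ltrD2r; case: ifP => // _; congr EFin; ring.
Qed.

Lemma lebesgue_measure_reflect (h : R) (A : set (measurableTypeR R)) :
  measurable A -> mu ((fun x => h - x) @^-1` A) = mu A.
Proof.
move=> mA; have mh := measurable_reflect h.
suff : mu A = pushforward mu (fun x : measurableTypeR R => h - x : measurableTypeR R) A by [].
apply: (@lebesgue_measure_unique _ (pushforward mu _)) => //= _ [[a b]] _ <-.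
rewrite /pushforward /=.
have := preimage_reflect_itv h (h - b) (h - a) false false.
rewrite !subKr => ->.
by rewrite !lebesgue_measure_itv/= !lte_fin ltrD2l ltrN2; case: ifP => // _; congr EFin; ring.
Qed.

Lemma Rintegral_shift (h a b : R) f : measurable_fun `]h + a, h + b[ f ->
  \int[mu]_(x in `]a, b[) f (h + x) = \int[mu]_(x in `]h + a, h + b[) f x.
Proof.
move=> mf; have := Rintegral_preserving (measurable_shift h)
  (@lebesgue_measure_shift h) (mitv _) mf.
by rewrite (preimage_shift_itv h a b).
Qed.

Lemma Rintegral_reflect (h a b : R) f : measurable_fun `]h - b, h - a[ f ->
  \int[mu]_(x in `]a, b[) f (h - x) = \int[mu]_(x in `]h - b, h - a[) f x.
Proof.
move=> mf; have := Rintegral_preserving (measurable_reflect h)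
  (@lebesgue_measure_reflect h) (mitv _) mf.
by rewrite (preimage_reflect_itv h a b).
Qed.

Lemma integrable_shift (h a b : R) f :
  mu.-integrable `]h + a, h + b[ (EFin \o f) ->
  mu.-integrable `]a, b[ (EFin \o (fun x => f (h + x))).
Proof.
move=> Lf; have := integrable_preserving (measurable_shift h)
  (@lebesgue_measure_shift h) (mitv _) Lf.
by rewrite preimage_shift_itv.
Qed.

Lemma ge0_subset_Rintegral (D E : set (measurableTypeR R)) f : measurable D -> measurable E ->
  D `<=` E -> mu.-integrable E (EFin \o f) -> (forall x, 0 <= f x) ->
  \int[mu]_(x in D) f x <= \int[mu]_(x in E) f x.
Proof.
move=> mD mE DE intf f0; rewrite /Rintegral fine_le//.
- by apply: integrable_fin_num => //; exact: integrableS intf.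
- exact: integrable_fin_num.
- apply: ge0_subset_integral => //; first exact: measurable_int intf.
  by move=> x _; rewrite lee_fin.
Qed.

Lemma L2_shift (h a b : R) f : L2 `]h + a, h + b[ f ->
  L2 `]a, b[ (fun x => f (h + x)).
Proof.
move=> Lf; have := L2_preserving (measurable_shift h)
  (@lebesgue_measure_shift h) (mitv _) Lf.
by rewrite preimage_shift_itv.
Qed.

Lemma L2_reflect (h a b : R) f : L2 `]h - b, h - a[ f ->
  L2 `]a, b[ (fun x => f (h - x)).
Proof.
move=> Lf; have := L2_preserving (measurable_reflect h)
  (@lebesgue_measure_reflect h) (mitv _) Lf.
by rewrite preimage_reflect_itv.
Qed.

Lemma L2T_shift (h : R) f : L2 setT f -> L2 setT (fun x => f (h + x)).
Proof.
by move/(L2_preserving (measurable_shift h) (@lebesgue_measure_shift h)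
  measurableT).
Qed.

Lemma L2T_reflect (h : R) f : L2 setT f -> L2 setT (fun x => f (h - x)).
Proof.
by move/(L2_preserving (measurable_reflect h) (@lebesgue_measure_reflect h)
  measurableT).
Qed.

Lemma sqn_shift (h a b : R) f : L2 `]h + a, h + b[ f ->
  sqn `]a, b[ (fun x => f (h + x)) = sqn `]h + a, h + b[ f.
Proof.
move=> Lf; apply: (@Rintegral_shift h a b (fun x => f x ^+ 2)).
by apply: measurable_funX; exact: L2_meas Lf.
Qed.

Lemma sqn_reflect (h a b : R) f : L2 `]h - b, h - a[ f ->
  sqn `]a, b[ (fun x => f (h - x)) = sqn `]h - b, h - a[ f.
Proof.
move=> Lf; apply: (@Rintegral_reflect h a b (fun x => f x ^+ 2)).
by apply: measurable_funX; exact: L2_meas Lf.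
Qed.

End Isometries.

(** * Translations and difference quotients in L^2 *)

Section LocallySquareIntegrable.
Context {R : realType}.
Local Notation mu := (@lebesgue_measure R).
Implicit Types (D : set (measurableTypeR R)) (f g : R -> R).

Definition locL2 f := forall a b : R, L2 `]a, b[ f.

Lemma locL2_shift (h : R) f : locL2 f -> locL2 (fun x => f (h + x)).
Proof. by move=> Lf a b; exact: L2_shift. Qed.

Lemma locL2_reflect (h : R) f : locL2 f -> locL2 (fun x => f (h - x)).
Proof. by move=> Lf a b; exact: L2_reflect. Qed.

Lemma locL2_measurable f : locL2 f -> measurable_fun setT f.
Proof.
move=> Lf; rewrite (_ : setT = \bigcup_n `]- n%:R, n%:R[%classic :> set R).
  apply/measurable_fun_bigcup => // n; exact: L2_meas (Lf _ _).
apply/esym; rewrite -subTset => x _.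
exists (Num.bound `|x|) => //=; rewrite in_itv/=.
by rewrite -ltr_norml; exact: archi_boundP (normr_ge0 x).
Qed.

Lemma bounded_itv_lty (a b : R) (c d : bool) :
  (mu [set` Interval (BSide c a) (BSide d b)] < +oo)%E.
Proof.
rewrite lebesgue_measure_itv/=; case: ifP => // _.
by rewrite -EFinB ltry.
Qed.

Lemma locL2_integrable f (a b : R) : locL2 f ->
  mu.-integrable `]a, b[ (EFin \o f).
Proof. by move=> Lf; apply: L2_integrable => //; exact: bounded_itv_lty. Qed.

Lemma continuous_integrable_itv (g : R -> R) (a b : R) : continuous g ->
  mu.-integrable `]a, b[ (EFin \o g).
Proof.
move=> cg; apply: (@integrableS _ _ _ mu `[a, b]) => //.
  exact: subset_itv_oo_cc.
apply: continuous_compact_integrable; first exact: segment_compact.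
exact: continuous_subspaceT.
Qed.

Lemma continuous_translation_L1 (g : R -> R) (a b : R) : continuous g ->
  \int[mu]_(x in `]a, b[) `|g (h + x) - g x| @[h --> 0] --> (0 : R).
Proof.
move=> cg; have [ba|ab] := leP b a.
  rewrite set_itv_ge ?bnd_simp -?leNgt//.
  under eq_fun do rewrite Rintegral_set0.
  exact: cvg_cst.
have [M HM] : exists M, forall x, x \in `[a - 1, b + 1] -> `|g x| <= M.
  have ab1 : a - 1 <= b + 1 by lra.
  have cng : {within `[a - 1, b + 1], continuous (fun x => `|g x|)}.
    apply: continuous_subspaceT => x; apply: cvg_norm; exact: cg.
  by have [c _ Hc] := EVT_max ab1 cng; exists `|g c|.
have M0 : 0 <= M by apply: le_trans (HM a _); rewrite ?normr_ge0// in_itv/=; lra.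
have cF h : continuous (fun x => `|g (h + x) - g x|).
  move=> x; apply: cvg_norm.
  apply: cvgB; last exact: cg.
  apply: (@continuous_comp _ _ _ (fun x => h + x) g); last exact: cg.
  by apply: cvgD; [exact: cvg_cst|exact: cvg_id].
have H0 : (0 : R) \in `]-1, 1[%classic.
  by rewrite inE/= in_itv/=; lra.
have E0 : \int[mu]_(x in `]a, b[) `|g (0 + x) - g x| = 0.
  under eq_Rintegral do rewrite add0r subrr normr0.
  by rewrite Rintegral_cst// mul0r.
rewrite -[X in _ --> X]E0.
apply: (@continuity_under_integral R _ (measurableTypeR R) mu
  (fun h x => `|g (h + x) - g x|) `]a, b[ (mitv _) (-1) 1 _ _
  (cst (2 * M)) _ _ 0 H0).
- by move=> h _; exact: continuous_integrable_itv.
- apply: nearW => y _ h _; apply: cvg_norm.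
  apply: cvgB; last exact: cvg_cst.
  apply: (@continuous_comp _ _ _ (fun x => x + y) g); last exact: cg.
  by apply: cvgD; [exact: cvg_id|exact: cvg_cst].
- by apply: (@continuous_integrable_itv (cst (2 * M))) => x; exact: cvg_cst.
- move=> h /=; rewrite in_itv/= => /andP[h1 h2]; apply: nearW => y.
  rewrite /= in_itv/= => /andP[y1 y2]; rewrite normr_id (le_trans (ler_normB _ _))//.
  by rewrite mulr_natl mulr2n lerD// HM// in_itv/=; lra.
Qed.

(** Continuous functions are dense in L^1 and translation is an isometry, so it
    suffices to translate a continuous function. *)
Lemma translation_L1 (p : R -> R) (a b e : R) :
  mu.-integrable `]a - 1, b + 1[ (EFin \o p) -> 0 < e ->
  \forall h \near (0 : R), \int[mu]_(x in `]a, b[) `|p (h + x) - p x| <= e.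
Proof.
move=> ip e0; pose E : set (measurableTypeR R) := `]a - 1, b + 1[%classic.
have mE : measurable E by exact: measurable_itv.
have e3 : 0 < e / 3 by rewrite divr_gt0.
have [g [cg ig gp]] : exists g : R -> R, [/\ continuous g,
    mu.-integrable E (EFin \o g) & \int[mu]_(x in E) `|p x - g x| < e / 3].
  have [g_ [cg ig gp]] :=
    approximation_continuous_integrable mE (bounded_itv_lty _ _ _ _) ip.
  have /fine_cvgP[_ /cvgr0_norm_lt /(_ _ e3)[n _ /(_ n (leqnn _)) H]] := gp.
  by exists (g_ n); split => //; apply: le_lt_trans (ler_norm _) H.
pose d x : R := `|p x - g x|.
have id : mu.-integrable E (EFin \o d).
  exact: integrable_abs (integrable_sub mE ip ig).
have := continuous_translation_L1 a b cg.
move=> /cvgr0_norm_lt /(_ _ e3) near_g.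
have near1 : \forall h \near (0 : R), `|h| < 1 by exact: nbhs0_lt.
near=> h.
have h1 : `|h| < 1 by near: h.
have /andP[h1l h1r] : -1 < h < 1 by rewrite -ltr_norml.
have sub0 : `]a, b[ `<=` E.
  by move=> x; rewrite /E /= !in_itv/= => /andP[? ?]; lra.
have subh : `]h + a, h + b[ `<=` E.
  by move=> x; rewrite /E /= !in_itv/= => /andP[? ?]; lra.
have id0 : mu.-integrable `]a, b[ (EFin \o d) by exact: integrableS id.
have idh : mu.-integrable `]a, b[ (EFin \o (fun x => d (h + x))).
  by apply: integrable_shift; exact: integrableS id.
have igh : mu.-integrable `]a, b[ (EFin \o (fun x => `|g (h + x) - g x|)).
  apply: continuous_integrable_itv => x.
  apply: cvg_norm.
  apply: cvgB; last exact: cg.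
  apply: (@continuous_comp _ _ _ (fun x => h + x) g); last exact: cg.
  by apply: cvgD; [exact: cvg_cst|exact: cvg_id].
have iph : mu.-integrable `]a, b[ (EFin \o (fun x => `|p (h + x) - p x|)).
  have i1 : mu.-integrable `]a, b[ (EFin \o (fun x => p (h + x))).
    by apply: integrable_shift; exact: integrableS ip.
  have i2 : mu.-integrable `]a, b[ (EFin \o p) by exact: integrableS ip.
  exact: integrable_abs (integrable_sub (mitv _) i1 i2).
have i3 := integrable_add (mitv _) idh igh.
have i4 := integrable_add (mitv _) i3 id0.
rewrite (le_trans (le_Rint (mitv _) iph i4 _))//.
  move=> x _; rewrite /d.
  rewrite (_ : p (h + x) - p x = (p (h + x) - g (h + x)) + (g (h + x) - g x) - (p x - g x)).
    by rewrite (le_trans (ler_normB _ _))// lerD2r ler_normD.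
  by ring.
rewrite RintegralD// RintegralD// [leRHS](_ : e = e / 3 + e / 3 + e / 3).
  rewrite !lerD//.
  - rewrite (@Rintegral_shift _ h a b d).
      rewrite ltW// (le_lt_trans _ gp)//.
      by apply: ge0_subset_Rintegral => // x; exact: normr_ge0.
    by have /measurable_int/measurable_EFinP := id; exact: measurable_funS.
  - by rewrite ltW// (le_lt_trans (ler_norm _))//; near: h.
  - rewrite ltW// (le_lt_trans _ gp)//.
    by apply: ge0_subset_Rintegral => // x; exact: normr_ge0.
by field.
Unshelve. all: by end_near. Qed.

Lemma sqr_diff_le (x y : R) : (x - y) ^+ 2 <= 2 * `|x * `|x| - y * `|y| |.
Proof.
have H (c : R) : c <= `|c| /\ - c <= `|c|.
  by rewrite ler_norm -normrN ler_norm.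
have [x0|x0] := leP 0 x; have [y0|y0] := leP 0 y.
- rewrite (ger0_norm x0) (ger0_norm y0); have [] := H (x * x - y * y).
  by have [xy|xy] := leP x y; nra.
- rewrite (ger0_norm x0) (ltr0_norm y0); have [] := H (x * x - y * - y).
  by have := sqr_ge0 (x + y); nra.
- rewrite (ltr0_norm x0) (ger0_norm y0); have [] := H (x * - x - y * y).
  by have := sqr_ge0 (x + y); nra.
- rewrite (ltr0_norm x0) (ltr0_norm y0); have [] := H (x * - x - y * - y).
  by have [xy|xy] := leP x y; nra.
Qed.

(** The continuity of translations passes from L^1 to L^2 through f |f|, by
    [sqr_diff_le]. *)
Lemma translation_L2 (f : R -> R) (a b : R) : locL2 f ->
  sqn `]a, b[ (fun x => f (h + x) - f x) @[h --> 0] --> (0 : R).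
Proof.
move=> Lf; apply/cvgr0Pnorm_le => e e0.
have mf := locL2_measurable Lf.
pose p x := f x * `|f x|.
have mp : measurable_fun setT p.
  by apply: measurable_funM => //; exact: measurableT_comp.
have ip (c d : R) : mu.-integrable `]c, d[ (EFin \o p).
  have := L2_sqr (mitv _) (Lf c d); apply: le_integrable => //.
    by apply/measurable_EFinP; exact: measurable_funTS.
  by move=> x _ /=; rewrite /p normrM normr_id normrX expr2.
have e2 : 0 < e / 2 by rewrite divr_gt0.
apply: filterS (@translation_L1 p a b _ (ip _ _) e2) => h Hh.
rewrite ger0_norm ?sqn_ge0//.
rewrite (@le_trans _ _ (\int[mu]_(x in `]a, b[) (2 * `|p (h + x) - p x|)))//.
  have i1 : mu.-integrable `]a, b[ (EFin \o (fun x => p (h + x))).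
    exact: integrable_shift.
  have i2 := integrable_abs (integrable_sub (mitv _) i1 (ip a b)).
  apply: le_Rint => //.
  - by apply: L2_sqr => //; apply: L2_sub => //; exact: L2_shift.
  - exact: integrable_scale.
  - by move=> x _; rewrite /p sqr_diff_le.
have i1 : mu.-integrable `]a, b[ (EFin \o (fun x => p (h + x))).
  exact: integrable_shift.
have i2 := integrable_abs (integrable_sub (mitv _) i1 (ip a b)).
by rewrite RintegralZl//; lra.
Qed.

End LocallySquareIntegrable.

(** * Fubini's theorem on measurable sets *)

Section Fubini.
Context {R : realType}.
Local Notation mu := (@lebesgue_measure R).
Local Notation T := (measurableTypeR R).
Variables (A B : set T) (g : R -> R -> R).
Hypotheses (mA : measurable A) (mB : measurable B).
Hypothesis mg : measurable_fun [set: T * T] (fun z : T * T => g z.1 z.2 : R).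

Let G (z : T * T) : \bar R := (g z.1 z.2 * \1_A z.1 * \1_B z.2)%:E.

Let mG : measurable_fun setT G.
Proof.
apply/measurable_EFinP; apply: measurable_funM; last first.
  by apply: measurableT_comp => //; exact: measurable_indic.
apply: measurable_funM => //.
by apply: measurableT_comp => //; exact: measurable_indic.
Qed.

Let patchG : (fun x => \int[mu]_(r in B) (g x r)%:E)%E \_ A =
  (fun x => \int[mu]_r G (x, r))%E.
Proof.
apply/funext => x; rewrite /patch /G; case: ifPn => /= xA.
  rewrite integral_mkcond; apply: eq_integral => r _ /=.
  rewrite indicE xA mulr1 /patch indicE; case: ifPn => //=.
    by rewrite mulr1.
  by rewrite mulr0.
by rewrite integral0_eq// => r _; rewrite indicE (negbTE xA) mulr0 mul0r.
Qed.

Let patchG' : (fun r => \int[mu]_(x in A) (g x r)%:E)%E \_ B =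
  (fun r => \int[mu]_x G (x, r))%E.
Proof.
apply/funext => r; rewrite /patch /G; case: ifPn => /= rB.
  rewrite integral_mkcond; apply: eq_integral => x _ /=.
  rewrite !indicE rB mulr1 /patch; case: ifPn => //=.
    by rewrite mulr1.
  by rewrite mulr0.
by rewrite integral0_eq// => x _; rewrite !indicE (negbTE rB) mulr0.
Qed.

Lemma tonelli_set : (forall x r, 0 <= g x r) ->
  (\int[mu]_(x in A) \int[mu]_(r in B) (g x r)%:E =
   \int[mu]_(r in B) \int[mu]_(x in A) (g x r)%:E)%E.
Proof.
move=> g0; rewrite integral_mkcond patchG [RHS]integral_mkcond patchG'.
rewrite (@fubini_tonelli _ _ T T R mu mu G mG)// => z.
by rewrite lee_fin !mulr_ge0// indicE.
Qed.

(** The real-valued integral of a function that is not integrable is arbitrary,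
    so all the sections have to be integrable, and not only almost all. *)
Lemma Rfubini_set (b : R -> R) :
  (forall x, A x -> mu.-integrable B (EFin \o g x)) ->
  (forall r, B r -> mu.-integrable A (EFin \o g^~ r)) ->
  mu.-integrable A (EFin \o b) ->
  (forall x, A x -> \int[mu]_(r in B) `|g x r| <= b x) ->
  \int[mu]_(x in A) \int[mu]_(r in B) g x r =
  \int[mu]_(r in B) \int[mu]_(x in A) g x r.
Proof.
move=> gB gA ib bb.
have iG : (mu \x mu)%E.-integrable setT G.
  apply/(integrable12ltyP _ _ mG).
  case/integrableP : ib => mb; apply: le_lt_trans.
  rewrite [leRHS]integral_mkcond; apply: ge0_le_integral => //.
  - by move=> x _; apply: integral_ge0.
  - apply: (@measurable_fun_fubini_tonelli_F _ _ T T R mu (abse \o G)) => //.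
      exact: measurableT_comp.
    by move=> z /=.
  - by apply/(measurable_restrictT _ mA); exact: measurableT_comp.
  - move=> x _; rewrite /patch; case: ifPn => /= xA; last first.
      rewrite integral0_eq// => r _; rewrite /G /= !indicE (negbTE xA).
      by rewrite mulr0 mul0r normr0.
    have := bb x (set_mem xA); rewrite -lee_fin => H.
    have -> : (\int[mu]_r `|G (x, r)| = \int[mu]_(r in B) `|g x r|%:E)%E.
      rewrite [RHS]integral_mkcond; apply: eq_integral => r _.
      rewrite /G /= !indicE xA mulr1 /patch; case: ifPn => //= _.
        by rewrite mulr1.
      by rewrite mulr0 normr0.
    apply: (@le_trans _ _ (b x)%:E); last by rewrite /= lee_fin ler_norm.
    apply: le_trans H; rewrite /Rintegral fineK//.
    have := integrable_fin_num mB (integrable_abs (gB x (set_mem xA))).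
    exact.
have := Fubini iG; rewrite -patchG -patchG' => H.
rewrite /Rintegral; congr fine.
transitivity (\int[mu]_(x in A) \int[mu]_(r in B) (g x r)%:E)%E.
  apply: eq_integral => x /set_mem xA; rewrite fineK//.
  exact: integrable_fin_num (gB x xA).
transitivity (\int[mu]_(r in B) \int[mu]_(x in A) (g x r)%:E)%E.
  by rewrite integral_mkcond [RHS]integral_mkcond; exact: H.
apply: eq_integral => r /set_mem rB; rewrite fineK//.
exact: integrable_fin_num (gA r rB).
Qed.

End Fubini.

(** * Primitives and their difference quotients *)

Section Primitive.
Context {R : realType}.
Local Notation mu := (@lebesgue_measure R).
Implicit Types (f g : R -> R).

Lemma Rint_split f (a b c : R) : a <= b -> b <= c ->
  mu.-integrable `]a, c[ (EFin \o f) ->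
  \int[mu]_(x in `]a, c[) f x =
  \int[mu]_(x in `]a, b[) f x + \int[mu]_(x in `]b, c[) f x.
Proof.
move=> ab; rewrite le_eqVlt => /predU1P[<- _|bc intf].
  rewrite [X in _ = _ + X](_ : _ = 0) ?addr0//.
  by rewrite set_itv_ge ?bnd_simp ?ltxx// Rintegral_set0.
rewrite -(@Rintegral_itvB _ f (BRight a) (BLeft c) b)// ?bnd_simp//.
rewrite (@Rintegral_itv_bndo_bndc _ (BRight a) b f); first by rewrite addrC subrK.
apply: integrableS intf => //.
by apply: subset_itvl; rewrite bnd_simp ltW.
Qed.

Lemma Rint_cst (k a b : R) : a <= b ->
  \int[mu]_(x in `]a, b[) k = k * (b - a).
Proof.
move=> ab; have E : fine (mu `]a, b[) = b - a; last first.
  by rewrite -E; exact: (Rintegral_cst _ (mitv `]a, b[)).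
rewrite lebesgue_measure_itv/= lte_fin; case: ltP => // ba.
by have -> : b - a = 0 by apply/eqP; rewrite subr_eq0 eq_le ab ba.
Qed.

Lemma L2_cst (k a b : R) : L2 `]a, b[ (fun=> k).
Proof.
apply/(L2P _ (mitv _)); split; first exact: measurable_cst.
by apply: (@continuous_integrable_itv R (cst (k ^+ 2))) => x; exact: cvg_cst.
Qed.

Lemma Rint_empty f (a b : R) : b <= a -> \int[mu]_(x in `]a, b[) f x = 0.
Proof.
by move=> ba; rewrite set_itv_ge ?Rintegral_set0// bnd_simp -leNgt.
Qed.

(** The oriented integral from 0 to x: at most one of the two intervals is
    nonempty. *)
Definition prim f (x : R) : R :=
  \int[mu]_(s in `]0, x[) f s - \int[mu]_(s in `]x, 0[) f s.

Lemma primB f (a b : R) : locL2 f -> a <= b ->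
  prim f b - prim f a = \int[mu]_(x in `]a, b[) f x.
Proof.
move=> Lf ab; have intf c d := locL2_integrable c d Lf.
rewrite /prim; have [a0|/ltW a0] := leP 0 a.
  rewrite (Rint_empty _ a0) (@Rint_empty _ b 0) ?(le_trans a0 ab)//.
  by rewrite (Rint_split a0 ab)//; ring.
rewrite (Rint_empty _ a0); have [b0|/ltW b0] := leP 0 b.
  by rewrite (Rint_empty _ b0) (Rint_split a0 b0)//; ring.
by rewrite (Rint_empty _ b0) (Rint_split ab b0)//; ring.
Qed.

Lemma prim_reflect f (x : R) : locL2 f ->
  prim (fun s => f (0 - s)) x = - prim f (- x).
Proof.
move=> Lf; have mf := locL2_measurable Lf.
rewrite /prim !Rintegral_reflect; try exact: measurable_funTS.
by rewrite !subr0 !sub0r opprB.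
Qed.

Lemma prim_lipschitz_sqr f (a b c d : R) : locL2 f -> c <= a -> a <= b -> b <= d ->
  (prim f b - prim f a) ^+ 2 <= (b - a) * sqn `]c, d[ f.
Proof.
move=> Lf ca ab bd; rewrite primB//.
have L1 : L2 `]a, b[ (cst 1 : R -> R) by exact: L2_cst.
have := ip_CS (mitv _) (Lf a b) L1.
have -> : ip `]a, b[ f (cst 1) = \int[mu]_(x in `]a, b[) f x.
  by apply: eq_Rintegral => x _; rewrite mulr1.
have -> : sqn `]a, b[ (cst 1 : R -> R) = b - a.
  rewrite /sqn; under eq_Rintegral do rewrite expr1n.
  by rewrite Rint_cst// mul1r.
rewrite -(ler_pXn2r (n := 2)) ?nnegrE ?mulr_ge0 ?sqrtr_ge0//.
rewrite exprMn !sqr_sqrtr ?sqn_ge0 ?subr_ge0// real_normK ?num_real//.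
move=> /le_trans; apply; rewrite mulrC ler_wpM2l ?subr_ge0//.
apply: ge0_subset_Rintegral => //.
- by apply: subset_itvW => //; exact: lexx.
- by apply: L2_sqr.
- by move=> x; exact: sqr_ge0.
Qed.

Lemma prim_continuous f : locL2 f -> continuous (prim f).
Proof.
move=> Lf x; apply/cvgrPdist_lt => e e0.
set S := sqn `]x - 1, x + 1[ f; have S0 : 0 <= S by exact: sqn_ge0.
have d0 : 0 < Num.min 1 (e ^+ 2 / (S + 1)).
  by rewrite lt_min ltr01/= divr_gt0// ?exprn_gt0//; lra.
have near_x : \forall y \near x, `|x - y| < Num.min 1 (e ^+ 2 / (S + 1)).
  by apply/nbhs_normP; exists (Num.min 1 (e ^+ 2 / (S + 1))).
near=> y.
have : `|x - y| < Num.min 1 (e ^+ 2 / (S + 1)) by near: y.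
rewrite lt_min ltr_pdivlMr; last lra.
move=> /andP[xy1 xy2].
rewrite -(ltr_pXn2r (n := 2)) ?nnegrE ?normr_ge0 ?(ltW e0)// real_normK ?num_real//.
apply: le_lt_trans xy2.
rewrite ltr_norml in xy1; move/andP : xy1 => [y1 y2].
have [yx|/ltW xy] := leP y x.
  apply: (le_trans (@prim_lipschitz_sqr f y x (x - 1) (x + 1) Lf _ _ _)); try lra.
  by rewrite ger0_norm ?subr_ge0// ler_wpM2l ?subr_ge0// -/S; lra.
rewrite -sqrrN opprB.
apply: (le_trans (@prim_lipschitz_sqr f x y (x - 1) (x + 1) Lf _ _ _)); try lra.
by rewrite distrC ger0_norm ?subr_ge0// ler_wpM2l ?subr_ge0// -/S; lra.
Unshelve. all: by end_near. Qed.

Lemma prim_locL2 f : locL2 f -> locL2 (prim f).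
Proof.
move=> Lf a b; have cp := prim_continuous Lf.
apply/L2P => //; split.
  by apply: measurable_funTS; exact: continuous_measurable_fun.
apply: continuous_integrable_itv => x; apply: (cvgM (cp x) (cp x)).
Qed.

(** By Jensen's inequality and Tonelli's theorem, the squared distance from f
    to its means over [x, x + h] is at most the mean over r in [0, h] of the
    squared distances from f to its translates by r. *)
Lemma difference_quotient_L2_right f (a b : R) : locL2 f ->
  sqn `]a, b[ (fun x => h^-1 * (prim f (x + h) - prim f x) - f x)
    @[h --> 0^'+] --> (0 : R).
Proof.
move=> Lf; apply/cvgr0Pnorm_le => e e0.
have /cvgr0Pnorm_le /(_ _ e0) := @translation_L2 R f a b Lf.
move=> /nbhs_normP[d /= d0 Hd].
near=> h.
have h0 : 0 < h by near: h; exact: nbhs_right_gt.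
have hd : h < d by near: h; exact: nbhs_right_lt.
have Hh r : 0 < r -> r < h -> sqn `]a, b[ (fun x => f (r + x) - f x) <= e.
  move=> r0 rh; rewrite -(ger0_norm (sqn_ge0 _ _)); apply: Hd => /=.
  by rewrite sub0r normrN ger0_norm ?ltW// (lt_trans rh hd).
rewrite ger0_norm ?sqn_ge0//.
have mf := locL2_measurable Lf.
pose q x := h^-1 * (prim f (x + h) - prim f x) - f x.
pose g x r := h^-1 * (f (r + x) - f x) ^+ 2.
have g0 x r : 0 <= g x r by rewrite mulr_ge0 ?sqr_ge0 ?invr_ge0// ltW.
have L2x r : L2 `]a, b[ (fun x => f (r + x) - f x).
  by apply: L2_sub => //; exact: locL2_shift.
have L2r x : L2 `]0, h[ (fun r => f (x + r) - f x).
  by apply: L2_sub; [exact: mitv|exact: locL2_shift|exact: L2_cst].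
have Lq : L2 `]a, b[ q.
  apply: L2_sub => //; apply: L2_scale => //; apply: L2_sub => //; last first.
    exact: prim_locL2.
  have := locL2_shift h (prim_locL2 Lf) a b.
  by apply: eq_L2 => x _; rewrite addrC.
(* Jensen's inequality, from Cauchy-Schwarz against the constant 1 *)
have qg x : q x ^+ 2 <= \int[mu]_(r in `]0, h[) g x r.
  have L1 : L2 `]0, h[ (cst 1 : R -> R) by exact: L2_cst.
  have s1 : sqn `]0, h[ (cst 1 : R -> R) = h.
    rewrite /sqn; under eq_Rintegral do rewrite expr1n.
    by rewrite Rint_cst ?(ltW h0)// mul1r subr0.
  have -> : q x = h^-1 * ip `]0, h[ (fun r => f (x + r) - f x) (cst 1).
    rewrite /ip; under eq_Rintegral do rewrite mulr1.
    rewrite RintegralB//; last 2 first.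
    - by apply: integrable_shift; exact: locL2_integrable.
    - by apply: (@continuous_integrable_itv R (cst (f x))) => y; exact: cvg_cst.
    rewrite Rint_cst ?(ltW h0)// subr0.
    rewrite Rintegral_shift; last exact: measurable_funTS.
    rewrite addr0 -primB//; last by rewrite lerDl ltW.
    by rewrite /q; field; rewrite gt_eqF.
  have := ip_CS (mitv _) (L2r x) L1.
  rewrite -(ler_pXn2r (n := 2)) ?nnegrE ?mulr_ge0 ?sqrtr_ge0//.
  rewrite exprMn !sqr_sqrtr ?sqn_ge0// s1 real_normK ?num_real// => CS.
  rewrite /g RintegralZl//; last first.
    by apply: eq_integrable (L2_sqr (mitv _) (L2r x)) => // r _ /=; rewrite (addrC x r).
  have -> : \int[mu]_(r in `]0, h[) (f (r + x) - f x) ^+ 2 =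
            sqn `]0, h[ (fun r => f (x + r) - f x).
    by apply: eq_Rintegral => r _; rewrite (addrC x r).
  rewrite exprMn expr2 -mulrA ler_wpM2l ?invr_ge0 ?(ltW h0)//.
  by rewrite mulrC ler_pdivrMr.
have mg : measurable_fun [set: measurableTypeR R * measurableTypeR R]
    (fun z => g z.1 z.2 : R).
  apply: measurable_funM => //; apply: measurable_funX.
  apply: measurable_funB; last by apply: measurableT_comp.
  by apply: measurableT_comp => //; exact: measurable_funD.
have intg x : mu.-integrable `]0, h[ (EFin \o g x).
  apply: integrable_scale => //.
  by apply: eq_integrable (L2_sqr (mitv _) (L2r x)) => // r _ /=; rewrite (addrC x r).
(* Tonelli's theorem *)
have tot : (\int[mu]_(x in `]a, b[) (q x ^+ 2)%:E <= e%:E)%E.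
  have le1 : (\int[mu]_(x in `]a, b[) (q x ^+ 2)%:E <=
     \int[mu]_(x in `]a, b[) \int[mu]_(r in `]0%R, h[) (g x r)%:E)%E.
    apply: ge0_le_integral => //.
    - by move=> x _; rewrite lee_fin sqr_ge0.
    - by apply/measurable_EFinP; apply: measurable_funX; exact: L2_meas Lq.
    - apply: (@measurable_funTS _ _ _ _ _ (fun x => \int[mu]_(r in `]0%R, h[) (g x r)%:E)%E).
      have := @measurable_fun_fubini_tonelli_F _ _ (measurableTypeR R)
        (measurableTypeR R) R mu (fun z => (g z.1 z.2 * \1_(`]0, h[ : set (measurableTypeR R)) z.2)%:E).
      rewrite /fubini_F/=.
      rewrite (_ : (fun x => _) = (fun x => \int[mu]_(r in `]0%R, h[) (g x r)%:E)%E).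
        apply.
          apply/measurable_EFinP; apply: measurable_funM => //.
          by apply: measurableT_comp => //; exact: measurable_indic.
        by move=> z; rewrite lee_fin mulr_ge0// indicE.
      apply/funext => x; rewrite [RHS]integral_mkcond; apply: eq_integral => r _.
      rewrite /patch /= indicE; case: ifPn => //= _; first by rewrite mulr1.
      by rewrite mulr0.
    - move=> x _; apply: (@le_trans _ _ (\int[mu]_(r in `]0, h[) g x r)%:E).
        by rewrite lee_fin.
      by rewrite /Rintegral fineK//; exact: integrable_fin_num (intg x).
  apply: (le_trans le1); rewrite tonelli_set//.
  apply: (@le_trans _ _ (\int[mu]_(r in `]0%R, h[) (h^-1 * e)%:E)%E).
    apply: ge0_le_integral => //.
    - by move=> r _; apply: integral_ge0 => x _; rewrite lee_fin.
    - apply: (@measurable_funTS _ _ _ _ _ (fun r => \int[mu]_(x in `]a, b[) (g x r)%:E)%E).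
      have := @measurable_fun_fubini_tonelli_G _ _ (measurableTypeR R)
        (measurableTypeR R) R mu (fun z => (g z.1 z.2 * \1_(`]a, b[ : set (measurableTypeR R)) z.1)%:E).
      rewrite /fubini_G/=.
      rewrite (_ : (fun x => _) = (fun r => \int[mu]_(x in `]a, b[) (g x r)%:E)%E).
        apply.
          apply/measurable_EFinP; apply: measurable_funM => //.
          by apply: measurableT_comp => //; exact: measurable_indic.
        by move=> z; rewrite lee_fin mulr_ge0// indicE.
      apply/funext => r; rewrite [RHS]integral_mkcond; apply: eq_integral => x _.
      rewrite /patch /= indicE; case: ifPn => //= _; first by rewrite mulr1.
      by rewrite mulr0.
    - move=> r /=; rewrite in_itv/= => /andP[r0 rh].
      apply: (@le_trans _ _ (h^-1 * sqn `]a, b[ (fun x => f (r + x) - f x))%:E); last first.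
        by rewrite lee_fin ler_wpM2l ?invr_ge0 ?(ltW h0)// Hh.
      rewrite -RintegralZl//; last exact: L2_sqr.
      rewrite /Rintegral fineK//.
      apply: (@integrable_fin_num _ _ _ mu); first exact: mitv.
      by apply: integrable_scale => //; exact: L2_sqr.
  have -> : (\int[mu]_(r in `]0%R, h[) (h^-1 * e)%:E = (h^-1 * e)%:E * mu `]0%R, h[)%E.
    exact: (integral_cst _ (mitv `]0, h[)).
  rewrite lebesgue_measure_itv/= lte_fin h0 -EFinD -EFinM lee_fin.
  by rewrite subr0 mulrC mulrA mulfV ?mul1r// gt_eqF.
rewrite -lee_fin; apply: le_trans tot.
rewrite /sqn /Rintegral fineK//.
exact: (integrable_fin_num _ (L2_sqr (mitv _) Lq)).
Unshelve. all: by end_near. Qed.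

Lemma sqn_reflect0 g (a b : R) : L2 `]- b, - a[ g ->
  sqn `]a, b[ (fun x => g (- x)) = sqn `]- b, - a[ g.
Proof.
rewrite -(sub0r a) -(sub0r b) => Lg; rewrite -sqn_reflect//.
by apply: eq_sqn => x _; rewrite sub0r.
Qed.

Lemma locL2_quotient f (h : R) : locL2 f ->
  locL2 (fun x => h^-1 * (prim f (x + h) - prim f x) - f x).
Proof.
move=> Lf a b; apply: L2_sub => //; apply: L2_scale => //.
apply: L2_sub => //; last exact: prim_locL2.
have := locL2_shift h (prim_locL2 Lf) a b.
by apply: eq_L2 => x _; rewrite addrC.
Qed.

(** Left quotients of f are right quotients of its reflection. *)
Lemma difference_quotient_L2 f (a b : R) : locL2 f ->
  sqn `]a, b[ (fun x => h^-1 * (prim f (x + h) - prim f x) - f x)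
    @[h --> 0^'] --> (0 : R).
Proof.
move=> Lf; apply: (@cvg_at_right_left_dnbhs R R^o); first exact: difference_quotient_L2_right.
have Lf' : locL2 (fun s => f (0 - s)) by exact: locL2_reflect.
have := @difference_quotient_L2_right _ (- b) (- a) Lf'.
move=> /cvg_at_rightNP; rewrite oppr0.
apply: cvg_trans; apply: near_eq_cvg; apply: nearW => h /=.
rewrite -sqn_reflect0; last exact: locL2_quotient.
apply: eq_sqn => x _.
rewrite !prim_reflect// sub0r opprK invrN (_ : - (- x - h) = x + h) ?opprK; last by rewrite opprD !opprK.
by rewrite mulNr -mulrN opprD opprK.
Qed.

End Primitive.

(** * Functions of class H^1 on the unit interval *)

Section H1.
Context {R : realType}.
Local Notation mu := (@lebesgue_measure R).
Implicit Types (f g p q : R -> R).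

Lemma primE f (x : R) : 0 <= x -> prim f x = \int[mu]_(s in `]0, x[) f s.
Proof. by move=> x0; rewrite /prim (Rint_empty _ x0) subr0. Qed.

Lemma prim0 f : prim f 0 = 0.
Proof. by rewrite primE// Rint_empty. Qed.

Lemma L2T_loc f : L2 setT f -> locL2 f.
Proof. by move=> Lf a b; apply: L2_subset Lf => //; exact: mitv. Qed.

(** Extending the derivative by 0 makes the theory of [prim] available. *)
Lemma H1_primitive f df : H1_with_derivative f df ->
  [/\ locL2 (df \_ `]0, 1[),
      forall x, 0 < x < 1 -> (df \_ `]0, 1[) x = df x &
      forall x, 0 <= x <= 1 -> f x = f 0 + prim (df \_ `]0, 1[) x].
Proof.
move=> [Ldf fE]; have pE (x : R) : 0 < x < 1 -> (df \_ `]0, 1[) x = df x.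
  by move=> x01; rewrite patchE mem_set//= in_itv.
split => //; first by apply: L2T_loc; apply/(L2_patch _ (mitv _)).
move=> x /andP[x0 x1]; rewrite fE ?x0//; congr (_ + _).
rewrite primE//; apply: eq_Rintegral => s; rewrite inE/= in_itv/= => /andP[s0 sx].
by rewrite pE// s0 (lt_le_trans sx).
Qed.

Lemma L2_continuous g (a b : R) : continuous g -> L2 `]a, b[ g.
Proof.
move=> cg; apply/(L2P _ (mitv _)); split.
  by apply: measurable_funTS; exact: continuous_measurable_fun.
by apply: continuous_integrable_itv => x; exact: (cvgM (cg x) (cg x)).
Qed.

Lemma H1_L2 f df : H1_with_derivative f df -> L2 `]0, 1[ f.
Proof.
move=> /H1_primitive[Ld _ fE].
apply: (@eq_L2 _ _ (fun x => f 0 + prim (df \_ `]0, 1[) x)).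
  by move=> x /=; rewrite in_itv/= => /andP[x0 x1]; rewrite [RHS]fE // (ltW x0) (ltW x1).
by apply: L2_continuous => x; apply: cvgD; [exact: cvg_cst|exact: prim_continuous].
Qed.

Lemma H1_sqr_le f df (x : R) : H1_with_derivative f df -> f 0 = 0 ->
  0 <= x <= 1 -> f x ^+ 2 <= sqn `]0, 1[ df.
Proof.
move=> /H1_primitive[Ld dE fE] f0 /andP[x0 x1].
rewrite fE ?x0// f0 add0r -[X in X ^+ 2]subr0 -[X in _ - X](prim0 (df \_ `]0, 1[)).
rewrite (le_trans (prim_lipschitz_sqr Ld (lexx 0) x0 x1))// subr0.
rewrite (@eq_sqn _ `]0, 1[ (df \_ `]0, 1[) df); last first.
  by move=> y /=; rewrite in_itv; exact: dE.
by rewrite ler_piMl// sqn_ge0.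
Qed.

Lemma H1_sqn_le f df : H1_with_derivative f df -> f 0 = 0 ->
  sqn `]0, 1[ f <= sqn `]0, 1[ df.
Proof.
move=> Hf f0; have Lf := H1_L2 Hf.
have := le_Rint (mitv _) (L2_sqr (mitv _) Lf)
  (@continuous_integrable_itv R (cst (sqn `]0, 1[ df)) 0 1 (fun x => @cvg_cst _ _ _ _ _)).
rewrite Rint_cst// subr0 mulr1; apply.
by move=> x; rewrite /= in_itv/= => /andP[x0 x1]; apply: H1_sqr_le => //; rewrite (ltW x0) (ltW x1).
Qed.

(** The first pairing is the integral of p(x) q(r) over the triangle r < x of
    the unit square; Fubini's theorem turns it into the pairing of q with
    prim p 1 - prim p. *)
Lemma integration_by_parts_prim p q (c : R) : locL2 p -> locL2 q ->
  ip `]0, 1[ p (prim q) + ip `]0, 1[ (fun x => c + prim p x) q =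
  (c + prim p 1) * prim q 1.
Proof.
move=> Lp Lq.
have mp := locL2_measurable Lp; have mq := locL2_measurable Lq.
have ip1 : mu.-integrable `]0, 1[ (EFin \o p) by exact: locL2_integrable.
have iq1 : mu.-integrable `]0, 1[ (EFin \o q) by exact: locL2_integrable.
pose tri (x r : R) : R := if r < x then 1 else 0.
pose g (x r : R) := p x * q r * tri x r.
have mtri : measurable_fun [set: measurableTypeR R * measurableTypeR R]
    (fun z => tri z.1 z.2 : R).
  by apply: measurable_fun_ifT => //; exact: measurable_fun_ltr.
have mg : measurable_fun [set: measurableTypeR R * measurableTypeR R]
    (fun z => g z.1 z.2 : R).
  by apply: measurable_funM => //; apply: measurable_funM => //; exact: measurableT_comp.
have tri_le x r : `|tri x r| <= 1 by rewrite /tri; case: ifP; rewrite ?normr1 ?normr0.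
have ig1 x : mu.-integrable `]0, 1[ (EFin \o g x).
  have := integrable_scale (p x) (mitv _) iq1; apply: le_integrable; first exact: mitv.
    by apply/measurable_EFinP/measurable_funTS; exact: (measurable_fun_pair2 x mg).
  move=> r _ /=; rewrite lee_fin /g normrM ler_piMr//.
have ig2 r : mu.-integrable `]0, 1[ (EFin \o g^~ r).
  have := integrable_scale (q r) (mitv _) ip1; apply: le_integrable; first exact: mitv.
    by apply/measurable_EFinP/measurable_funTS; exact: (measurable_fun_pair1 r mg).
  by move=> x _ /=; rewrite lee_fin /g normrM (mulrC (q r)) ler_piMr.
have ib := integrable_scale (\int[mu]_(r in `]0, 1[) `|q r|) (mitv _)
  (integrable_abs ip1).
have := @Rfubini_set R `]0, 1[ `]0, 1[ g (mitv _) (mitv _) mg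
  (fun x => \int[mu]_(r in `]0, 1[) `|q r| * `|p x|)
  (fun x _ => ig1 x) (fun r _ => ig2 r) ib.
have H x : `]0%R, 1%R[%classic x -> \int[mu]_(r in `]0, 1[) `|g x r| <=
     \int[mu]_(r in `]0, 1[) `|q r| * `|p x|.
  move=> _; rewrite mulrC -RintegralZl//; last exact: (integrable_abs iq1).
  apply: le_Rint; first exact: mitv.
  - exact: (integrable_abs (ig1 x)).
  - exact: (integrable_scale _ (mitv _) (integrable_abs iq1)).
  - by move=> r _; rewrite /g !normrM ler_piMr ?mulr_ge0.
move=> /(_ H) {H}.
have -> : \int[mu]_(x in `]0, 1[) \int[mu]_(r in `]0, 1[) g x r =
          ip `]0, 1[ p (prim q).
  apply: eq_Rintegral => x; rewrite inE/= in_itv/= => /andP[x0 x1].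
  rewrite primE ?ltW// -RintegralZl//; last exact: locL2_integrable.
  rewrite (Rint_split (ltW x0) (ltW x1))//.
  rewrite [X in _ + X](_ : _ = 0) ?addr0; last first.
    under eq_Rintegral => r.
      rewrite inE/= in_itv/= => /andP[xr _]; rewrite /g /tri ltNge ltW//= mulr0; over.
    by rewrite Rint_cst ?ltW// mul0r.
  apply: eq_Rintegral => r; rewrite inE/= in_itv/= => /andP[_ rx].
  by rewrite /g /tri rx mulr1.
have -> : \int[mu]_(r in `]0, 1[) \int[mu]_(x in `]0, 1[) g x r =
          \int[mu]_(r in `]0, 1[) (q r * (prim p 1 - prim p r)).
  apply: eq_Rintegral => r; rewrite inE/= in_itv/= => /andP[r0 r1].
  rewrite primB ?ltW// -RintegralZl//; last exact: locL2_integrable.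
  rewrite (Rint_split (ltW r0) (ltW r1))//.
  rewrite [X in X + _](_ : _ = 0) ?add0r; last first.
    under eq_Rintegral => x.
      rewrite inE/= in_itv/= => /andP[_ xr]; rewrite /g /tri ltNge ltW//= mulr0; over.
    by rewrite Rint_cst ?ltW// mul0r.
  apply: eq_Rintegral => x; rewrite inE/= in_itv/= => /andP[rx _].
  by rewrite /g /tri rx mulr1 mulrC.
move=> ->.
have LP : L2 `]0, 1[ (prim p) by exact: prim_locL2.
have Lc k : L2 `]0, 1[ (fun=> k : R) by exact: L2_cst.
change (ip `]0, 1[ q (fun r => prim p 1 - prim p r) +
  ip `]0, 1[ (fun x => c + prim p x) q = (c + prim p 1) * prim q 1).
rewrite ipBr; [|exact: mitv|exact: Lc|exact: LP|exact: Lq].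
rewrite ipDl; [|exact: mitv|exact: Lc|exact: LP|exact: Lq].
have E k : ip `]0, 1[ (fun=> k) q = k * prim q 1.
  by rewrite /ip RintegralZl// primE.
by rewrite (ipC _ q) E (ipC _ q (prim p)) E; ring.
Qed.

Lemma H1_integration_by_parts f df g dg :
  H1_with_derivative f df -> H1_with_derivative g dg -> g 0 = 0 ->
  ip `]0, 1[ df g + ip `]0, 1[ f dg = f 1 * g 1.
Proof.
move=> /H1_primitive[Lp pE fE] /H1_primitive[Lq qE gE] g0.
rewrite fE ?lexx ?ler01// gE ?lexx ?ler01// g0 add0r.
rewrite -integration_by_parts_prim//; congr (_ + _); apply: eq_ip => x /=;
  rewrite in_itv/= => /andP[x0 x1].
- by rewrite pE// x0.
- by rewrite gE ?ltW// g0 add0r.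
- by rewrite fE ?ltW//.
- by rewrite qE// x0.
Qed.

End H1.

(** * D'Alembert's formula *)

Section DAlembert.
Context {R : realType}.
Local Notation mu := (@lebesgue_measure R).
Implicit Types (f g p q : R -> R).

(** With F a primitive of f, F(t + x) - F(t - x) and its derivatives in x and
    t. *)
Definition wave f (t x : R) : R := prim f (t + x) - prim f (t - x).
Definition wave_x f (t x : R) : R := f (t + x) + f (t - x).
Definition wave_t f (t x : R) : R := f (t + x) - f (t - x).

Lemma L2_wave_x f (t a b : R) : locL2 f -> L2 `]a, b[ (wave_x f t).
Proof.
by move=> Lf; apply: L2_add; [exact: mitv|exact: locL2_shift|exact: locL2_reflect].
Qed.

Lemma L2_wave_t f (t a b : R) : locL2 f -> L2 `]a, b[ (wave_t f t).
Proof.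
by move=> Lf; apply: L2_sub; [exact: mitv|exact: locL2_shift|exact: locL2_reflect].
Qed.

Lemma prim_shift f (t x : R) : locL2 f -> 0 <= x ->
  prim f (t + x) = prim f t + \int[mu]_(s in `]0, x[) f (t + s).
Proof.
move=> Lf x0; rewrite Rintegral_shift; last by apply: measurable_funTS; exact: locL2_measurable.
by rewrite addr0 -primB ?lerDl// subrKC.
Qed.

Lemma prim_unshift f (t x : R) : locL2 f -> 0 <= x ->
  prim f (t - x) = prim f t - \int[mu]_(s in `]0, x[) f (t - s).
Proof.
move=> Lf x0; rewrite Rintegral_reflect; last by apply: measurable_funTS; exact: locL2_measurable.
by rewrite subr0 -primB ?gerBl// subKr.
Qed.

Lemma waveE f (t x : R) : locL2 f -> 0 <= x ->
  wave f t x = \int[mu]_(s in `]0, x[) wave_x f t s.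
Proof.
move=> Lf x0; rewrite /wave prim_shift// prim_unshift// RintegralD//; first by ring.
- exact: locL2_integrable (locL2_shift _ Lf).
- exact: locL2_integrable (locL2_reflect _ Lf).
Qed.

Lemma wave_at0 f (t : R) : wave f t 0 = 0.
Proof. by rewrite /wave addr0 subr0 subrr. Qed.

Lemma wave_H1 f (t : R) : locL2 f -> H1_with_derivative (wave f t) (wave_x f t).
Proof.
move=> Lf; split; first exact: L2_wave_x.
by move=> x /andP[x0 _]; rewrite wave_at0 add0r waveE.
Qed.

Lemma cvg_squeeze0 (T : Type) (F : set_system T) {FF : Filter F} (a b c : T -> R) :
  (forall s, 0 <= a s <= 2 * b s + 2 * c s) ->
  b s @[s --> F] --> (0 : R) -> c s @[s --> F] --> (0 : R) ->
  a s @[s --> F] --> (0 : R).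
Proof.
move=> abc b0 c0; apply: (@squeeze_cvgr _ F _ _ (cst 0) (fun s => 2 * b s + 2 * c s)).
- exact: nearW.
- exact: cvg_cst.
- rewrite -[X in _ --> X](addr0 (0 : R)) -[X in _ --> X + _](mulr0 2).
  rewrite -[X in _ --> _ + X](mulr0 2).
  by apply: cvgD; apply: cvgM => //; exact: cvg_cst.
Qed.

Lemma translation_L2_at f (a b t : R) : locL2 f ->
  sqn `]a, b[ (fun x => f (s + x) - f (t + x)) @[s --> t] --> (0 : R).
Proof.
move=> Lf.
have H := @translation_L2 _ _ a b (locL2_shift t Lf).
have st : s - t @[s --> t] --> (0 : R).
  by rewrite -(subrr t); apply: cvgB; [exact: cvg_id|exact: cvg_cst].
have := cvg_comp _ _ st H; apply: cvg_trans; apply: near_eq_cvg; apply: nearW => s /=.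
by apply: eq_sqn => x _; rewrite addrA subrKC.
Qed.

Lemma reflection_L2_at f (a b t : R) : locL2 f ->
  sqn `]a, b[ (fun x => f (s - x) - f (t - x)) @[s --> t] --> (0 : R).
Proof.
move=> Lf.
have H := @translation_L2_at _ a b (- t) (locL2_reflect 0 Lf).
have st : - s @[s --> t] --> - t by apply: cvgN; exact: cvg_id.
have := cvg_comp _ _ st H; apply: cvg_trans; apply: near_eq_cvg; apply: nearW => s /=.
by apply: eq_sqn => x _; rewrite !sub0r !opprD !opprK.
Qed.

Lemma ip_cvg (T : Type) (F : set_system T) {FF : Filter F}
    (D : set (measurableTypeR R)) (a b : T -> R -> R) (a0 b0 : R -> R) :
  measurable D -> (\forall s \near F, L2 D (a s)) ->
  (\forall s \near F, L2 D (b s)) -> L2 D a0 -> L2 D b0 ->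
  sqn D (a s \- a0) @[s --> F] --> (0 : R) ->
  sqn D (b s \- b0) @[s --> F] --> (0 : R) ->
  ip D (a s) (b s) @[s --> F] --> ip D a0 b0.
Proof.
move=> mD La Lb La0 Lb0 ca cb.
have sq (c : T -> R) : c s @[s --> F] --> (0 : R) ->
    Num.sqrt (c s) @[s --> F] --> (0 : R).
  move=> c0; rewrite -[X in _ --> X]sqrtr0.
  by apply: (continuous_cvg _ _ c0); exact: sqrt_continuous.
have sa := sq _ ca; have sb := sq _ cb.
have bound : Num.sqrt (sqn D (a s \- a0)) * Num.sqrt (sqn D (b s \- b0)) +
    Num.sqrt (sqn D (a s \- a0)) * Num.sqrt (sqn D b0) +
    Num.sqrt (sqn D a0) * Num.sqrt (sqn D (b s \- b0)) @[s --> F] --> (0 : R).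
  rewrite -[X in _ --> X](addr0 (0 : R)) -[X in _ --> X + _](addr0 (0 : R)).
  apply: cvgD; first apply: cvgD.
  - by rewrite -[X in _ --> X](mulr0 (0 : R)); apply: cvgM.
  - rewrite -[X in _ --> X](mul0r (Num.sqrt (sqn D b0))).
    by apply: cvgM => //; exact: cvg_cst.
  - rewrite -[X in _ --> X](mulr0 (Num.sqrt (sqn D a0))).
    by apply: cvgM => //; exact: cvg_cst.
apply/subr_cvg0; apply: norm_cvg0.
apply: (@squeeze_cvgr _ F _ _ (cst 0) _ _ _ _ _ bound); last exact: cvg_cst.
near=> s; rewrite normr_ge0/=.
have Ls : L2 D (a s) by near: s.
have Ms : L2 D (b s) by near: s.
have Lsa : L2 D (a s \- a0) by exact: L2_sub.
have Lsb : L2 D (b s \- b0) by exact: L2_sub.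
have E : ip D (a s) (b s) - ip D a0 b0 = ip D (a s \- a0) (b s \- b0) +
    ip D (a s \- a0) b0 + ip D a0 (b s \- b0).
  by rewrite !ipBl// !ipBr//; ring.
rewrite /= E.
rewrite (le_trans (ler_normD _ _))// lerD ?ip_CS//.
by rewrite (le_trans (ler_normD _ _))// lerD ?ip_CS.
Unshelve. all: by end_near. Qed.

Lemma wave_x_continuous f (t : R) : locL2 f ->
  sqn `]0, 1[ (wave_x f s \- wave_x f t) @[s --> t] --> (0 : R).
Proof.
move=> Lf; apply: (cvg_squeeze0 _ (translation_L2_at 0 1 t Lf) (reflection_L2_at 0 1 t Lf)).
move=> s; rewrite sqn_ge0 /=.
rewrite (@eq_sqn _ _ _ (fun x => (f (s + x) - f (t + x)) + (f (s - x) - f (t - x)))); last first.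
  by move=> x _; rewrite /= /wave_x; ring.
apply: sqn_add_le; first exact: mitv.
- by apply: L2_sub; [exact: mitv|exact: locL2_shift|exact: locL2_shift].
- by apply: L2_sub; [exact: mitv|exact: locL2_reflect|exact: locL2_reflect].
Qed.

Lemma wave_t_continuous f (t : R) : locL2 f ->
  sqn `]0, 1[ (wave_t f s \- wave_t f t) @[s --> t] --> (0 : R).
Proof.
move=> Lf; apply: (cvg_squeeze0 _ (translation_L2_at 0 1 t Lf) (reflection_L2_at 0 1 t Lf)).
move=> s; rewrite sqn_ge0 /=.
rewrite (@eq_sqn _ _ _ (fun x => (f (s + x) - f (t + x)) - (f (s - x) - f (t - x)))); last first.
  by move=> x _; rewrite /= /wave_t; ring.
apply: sqn_sub_le; first exact: mitv.
- by apply: L2_sub; [exact: mitv|exact: locL2_shift|exact: locL2_shift].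
- by apply: L2_sub; [exact: mitv|exact: locL2_reflect|exact: locL2_reflect].
Qed.

Lemma H1_sub f df g dg : H1_with_derivative f df -> H1_with_derivative g dg ->
  H1_with_derivative (f \- g) (df \- dg).
Proof.
move=> [Lf fE] [Lg gE]; split; first by apply: L2_sub => //; exact: mitv.
move=> x x01; have x1 : 0 <= x <= 1 by []; case/andP: x1 => x0 x1.
have sub : `]0, x[%classic `<=` (`]0, 1[%classic : set R).
  by apply: subset_itvW.
have I h : L2 `]0, 1[ h -> mu.-integrable `]0, x[ (EFin \o h).
  move=> Lh; apply: L2_integrable; [exact: mitv|exact: bounded_itv_lty|].
  by apply: L2_subset sub Lh; exact: mitv.
rewrite /= fE// gE// RintegralB//; [by ring|exact: I|exact: I].
Qed.

Lemma wave_continuous f (t : R) : locL2 f ->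
  sqn `]0, 1[ (wave f s \- wave f t) @[s --> t] --> (0 : R).
Proof.
move=> Lf; apply: (@squeeze_cvgr _ (nbhs t) _ _ (cst 0)
  (fun s => sqn `]0, 1[ (wave_x f s \- wave_x f t))).
- apply: nearW => s; rewrite sqn_ge0/=; apply: H1_sqn_le.
    by apply: H1_sub; exact: wave_H1.
  by rewrite /= !wave_at0 subrr.
- exact: cvg_cst.
- exact: wave_x_continuous.
Qed.

Lemma dnbhs_subr (t : R) : s - t @[s --> t^'] --> 0^'.
Proof.
move=> P /nbhs_normP[d /= d0 Pd]; apply/nbhs_normP; exists d => //= s /= ts st.
by apply: Pd; [rewrite /= sub0r normrN distrC|rewrite subr_eq0].
Qed.

Lemma wave_derivative_t f (t : R) : locL2 f ->
  sqn `]0, 1[ (fun x => (wave f s x - wave f t x) / (s - t) - wave_t f t x)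
    @[s --> t^'] --> (0 : R).
Proof.
move=> Lf; pose Q h x := h^-1 * (prim f (x + h) - prim f x) - f x.
have LQ h : locL2 (Q h) by exact: locL2_quotient.
have H1 := cvg_comp _ _ (@dnbhs_subr t) (@difference_quotient_L2 _ f t (t + 1) Lf).
have H2 := cvg_comp _ _ (@dnbhs_subr t) (@difference_quotient_L2 _ f (t - 1) t Lf).
apply: (cvg_squeeze0 _ H1 H2) => s; rewrite sqn_ge0 /=.
have E1 h : sqn `]t, t + 1[ (Q h) = sqn `]0, 1[ (fun x => Q h (t + x)).
  by rewrite sqn_shift; [rewrite addr0|exact: LQ].
have E2 h : sqn `]t - 1, t[ (Q h) = sqn `]0, 1[ (fun x => Q h (t - x)).
  by rewrite sqn_reflect; [rewrite subr0|exact: LQ].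
rewrite (E1 (s - t)) (E2 (s - t)).
rewrite (@eq_sqn _ _ _ (fun x => Q (s - t) (t + x) - Q (s - t) (t - x))); last first.
  move=> x _; rewrite /wave /wave_t /Q.
  have -> : t + x + (s - t) = s + x by ring.
  have -> : t - x + (s - t) = s - x by ring.
  by ring.
apply: sqn_sub_le; first exact: mitv.
- exact: (locL2_shift t (LQ _)).
- exact: (locL2_reflect t (LQ _)).
Qed.

(** The integral of wave_x over [0, t] is an H^1 function of x whose derivative
    is the increment of wave_t between 0 and t; the identity is an integration
    by parts in x against phi. *)
Lemma wave_variational f (phi dphi : R -> R) (t : R) : locL2 f -> 0 <= t ->
  H1_with_derivative phi dphi -> phi 0 = 0 ->
  ip `]0, 1[ (wave_t f t) phi = ip `]0, 1[ (wave_t f 0) phi +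
    \int[mu]_(s in `]0, t[)
      ((f (s + 1) + f (s - 1)) * phi 1 -
       \int[mu]_(x in `]0, 1[) (wave_x f s x * dphi x)).
Proof.
move=> Lf t0 Hphi phi0; have Lphi := H1_L2 Hphi; have Ldphi := Hphi.1.
have mf := locL2_measurable Lf.
pose Y x := \int[mu]_(s in `]0, t[) wave_x f s x.
have Iw x : mu.-integrable `]0, t[ (EFin \o (wave_x f)^~ x).
  apply: integrable_add; first exact: mitv.
    apply: eq_integrable (locL2_integrable 0 t (locL2_shift x Lf)).
      exact: mitv.
    by move=> s _ /=; rewrite (addrC s x).
  apply: eq_integrable (locL2_integrable 0 t (locL2_shift (- x) Lf)).
    exact: mitv.
  by move=> s _ /=; rewrite (addrC s (- x)).
have YE x : Y x = (prim f (t + x) - prim f x) + (prim f (t - x) - prim f (- x)).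
  have I1 : mu.-integrable `]0, t[ (EFin \o (fun s => f (x + s))).
    exact: locL2_integrable (locL2_shift x Lf).
  have I2 : mu.-integrable `]0, t[ (EFin \o (fun s => f (- x + s))).
    exact: locL2_integrable (locL2_shift (- x) Lf).
  have -> : Y x = \int[mu]_(s in `]0, t[) (f (x + s) + f (- x + s)).
    by apply: eq_Rintegral => s _; rewrite /wave_x (addrC s x) (addrC s (- x)).
  rewrite RintegralD; [|exact: mitv|exact: I1|exact: I2].
  rewrite (addrC t x) (addrC t (- x)) !prim_shift//; ring.
pose m x := wave_t f t x - wave_t f 0 x.
have Lm : L2 `]0, 1[ m.
  by apply: L2_sub; [exact: mitv|exact: L2_wave_t|exact: L2_wave_t].
have HY : H1_with_derivative Y m.
  split => // x /andP[x0 _].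
  have I g (a b : R) : locL2 g -> mu.-integrable `]0, x[ (EFin \o g).
    by move=> Lg; exact: locL2_integrable.
  have L1 : locL2 (fun s => f (t + s)) by exact: locL2_shift.
  have L2' : locL2 (fun s => f (t - s)) by exact: locL2_reflect.
  have L3 : locL2 (fun s => f (0 + s)) by exact: locL2_shift.
  have L4 : locL2 (fun s => f (0 - s)) by exact: locL2_reflect.
  have i1 := locL2_integrable 0 x L1.
  have i2 := locL2_integrable 0 x L2'.
  have i3 := locL2_integrable 0 x L3.
  have i4 := locL2_integrable 0 x L4.
  have e3 := prim_shift 0 Lf x0; have e4 := prim_unshift 0 Lf x0.
  rewrite add0r in e3; rewrite sub0r in e4.
  rewrite !YE addr0 subr0 oppr0 e3 e4 (prim_shift t Lf x0) (prim_unshift t Lf x0).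
  rewrite /m /wave_t RintegralB; [|exact: mitv|exact: integrable_sub|exact: integrable_sub].
  rewrite RintegralB; [|exact: mitv|by []|by []].
  rewrite RintegralB; [|exact: mitv|by []|by []].
  by ring.
have LY := H1_L2 HY.
have IBP := H1_integration_by_parts HY Hphi phi0.
have Y1 : Y 1 = \int[mu]_(s in `]0, t[) (f (s + 1) + f (s - 1)) by [].
have FY : \int[mu]_(s in `]0, t[) \int[mu]_(x in `]0, 1[) (wave_x f s x * dphi x) =
          ip `]0, 1[ Y dphi.
  have [Ld dE _] := H1_primitive Hphi.
  set d := (dphi \_ `]0, 1[) in Ld dE.
  have md := locL2_measurable Ld.
  have dE' x : `]0, 1[%classic x -> d x = dphi x.
    by rewrite /= in_itv/=; exact: dE.
  pose g s x := wave_x f s x * d x.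
  have Lg s : L2 `]0, 1[ (wave_x f s) by exact: L2_wave_x.
  have Ig s : mu.-integrable `]0, 1[ (EFin \o g s).
    by apply: L2_mul; [exact: mitv|exact: Lg|exact: Ld].
  have Ig' x : mu.-integrable `]0, t[ (EFin \o g^~ x).
    apply: eq_integrable (integrable_scale (d x) (mitv _) (Iw x)).
      exact: mitv.
    by move=> s _ /=; rewrite mulrC.
  have mg : measurable_fun [set: measurableTypeR R * measurableTypeR R]
      (fun z => g z.1 z.2 : R).
    apply: measurable_funM; last exact: measurableT_comp.
    apply: measurable_funD; apply: measurableT_comp => //.
      exact: measurable_funD.
    exact: measurable_funB.
  (* For s in [0, t] and x in [0, 1], s + x and s - x lie in [-1, t + 1]. *)
  pose C := 4 * sqn `]-1, t + 1[ f + sqn `]0, 1[ d.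
  have gC s : `]0, t[%classic s -> \int[mu]_(x in `]0, 1[) `|g s x| <= C.
    rewrite /= in_itv/= => /andP[s0 st].
    have sub (a b : R) : -1 <= a -> b <= t + 1 -> sqn `]a, b[ f <= sqn `]-1, t + 1[ f.
      move=> a1 bt; apply: ge0_subset_Rintegral; [exact: mitv|exact: mitv| | |].
      - exact: subset_itvW.
      - by apply: L2_sqr; [exact: mitv|exact: Lf].
      - by move=> x; exact: sqr_ge0.
    have w1 : sqn `]0, 1[ (fun x => f (s + x)) <= sqn `]-1, t + 1[ f.
      by rewrite sqn_shift; [apply: sub; lra|exact: Lf].
    have w2 : sqn `]0, 1[ (fun x => f (s - x)) <= sqn `]-1, t + 1[ f.
      by rewrite sqn_reflect; [apply: sub; lra|exact: Lf].
    have := @sqn_add_le _ `]0, 1[ _ _ (mitv _) (locL2_shift s Lf 0 1) (locL2_reflect s Lf 0 1).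
    rewrite -[X in X <= _]/(sqn `]0, 1[ (wave_x f s)) => w3.
    apply: (@le_trans _ _ (sqn `]0, 1[ (wave_x f s) + sqn `]0, 1[ d)); last first.
      by rewrite /C lerD2r; lra.
    rewrite /sqn -RintegralD; [|exact: mitv|exact: L2_sqr (mitv _) (Lg s)|
      exact: L2_sqr (mitv _) (Ld 0 1)].
    apply: le_Rint; [exact: mitv|exact: (integrable_abs (Ig s))| |].
      by apply: integrable_add; [exact: mitv|exact: L2_sqr (mitv _) (Lg s)|
        exact: L2_sqr (mitv _) (Ld 0 1)].
    move=> x _; rewrite /g normrM.
    rewrite -[X in _ <= X + _]real_normK ?num_real//.
    rewrite -[X in _ <= _ + X]real_normK ?num_real//.
    have := sqr_ge0 (`|wave_x f s x| - `|d x|).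
    by have := sqr_ge0 `|wave_x f s x|; have := sqr_ge0 `|d x|; nra.
  have IC : mu.-integrable `]0, t[ (EFin \o cst C).
    by apply: (@continuous_integrable_itv R (cst C)) => x; exact: cvg_cst.
  have := @Rfubini_set R `]0, t[ `]0, 1[ g (mitv _) (mitv _) mg (cst C)
    (fun s _ => Ig s) (fun x _ => Ig' x) IC gC.
  have -> : \int[mu]_(s in `]0, t[) \int[mu]_(x in `]0, 1[) g s x =
      \int[mu]_(s in `]0, t[) \int[mu]_(x in `]0, 1[) (wave_x f s x * dphi x).
    apply: eq_Rintegral => s _; apply: eq_Rintegral => x /set_mem x01.
    by rewrite /g dE'.
  move=> ->; apply: eq_Rintegral => x /set_mem x01.
  rewrite /g RintegralZr; [|exact: mitv|exact: (Iw x)].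
  by rewrite dE'.
have Iin : mu.-integrable `]0, t[
    (EFin \o (fun s => \int[mu]_(x in `]0, 1[) (wave_x f s x * dphi x))).
  apply: continuous_integrable_itv => s.
  apply: (@ip_cvg _ (nbhs s) _ `]0, 1[ (wave_x f) (fun _ => dphi)).
  - exact: mitv.
  - by apply: nearW => r; exact: L2_wave_x.
  - exact: nearW.
  - exact: L2_wave_x.
  - by [].
  - exact: wave_x_continuous.
  - rewrite (_ : (fun _ => sqn _ _) = cst 0); first exact: cvg_cst.
    apply/funext => r; rewrite (@eq_sqn _ _ _ (fun=> 0)).
      by rewrite /sqn; under eq_Rintegral do rewrite expr0n; rewrite Rint_cst// mul0r.
    by move=> x _ /=; rewrite subrr.
rewrite RintegralB; [|exact: mitv| |exact: Iin]; last first.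
  apply: eq_integrable (integrable_scale (phi 1) (mitv _) (Iw 1)).
    exact: mitv.
  by move=> s _ /=; rewrite mulrC.
rewrite FY RintegralZr; [|exact: mitv|exact: (Iw 1)].
rewrite -Y1 -IBP /m ipBl; [by ring|exact: mitv|exact: L2_wave_t|exact: L2_wave_t|by []].
Qed.

End DAlembert.

Section Solution.
Context {R : realType}.
Local Notation mu := (@lebesgue_measure R).
Implicit Types (f g p q : R -> R).

Lemma wave_solution f (T : R) (y0 y1 u : R -> R) : locL2 f ->
  (forall x, 0 <= x <= 1 -> y0 x = wave f 0 x) ->
  (forall x, 0 < x < 1 -> y1 x = wave_t f 0 x) ->
  (forall t, 0 < t < T -> u t = f (t + 1) + f (t - 1)) ->
  finite_energy_solution T y0 y1 u (wave f) (wave_x f) (wave_t f).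
Proof.
move=> Lf y0E y1E uE.
have Lw t : L2 `]0, 1[ (wave f t) by exact: H1_L2 (wave_H1 t Lf).
split.
- by move=> t _; exact: wave_H1.
- by move=> t _; exact: L2_wave_t.
- move=> t _; apply: cvg_within_filter; apply/sqn_cvg0; last exact: wave_continuous.
    exact: mitv.
  by apply: nearW => s; apply: L2_sub; [exact: mitv|exact: Lw|exact: Lw].
- move=> t _; apply: cvg_within_filter; apply/sqn_cvg0; last exact: wave_x_continuous.
    exact: mitv.
  by apply: nearW => s; apply: L2_sub; [exact: mitv|exact: L2_wave_x|exact: L2_wave_x].
- move=> t _; apply: cvg_within_filter; apply/sqn_cvg0; last exact: wave_derivative_t.
    exact: mitv.
  apply: nearW => s; apply: L2_sub; [exact: mitv| |exact: L2_wave_t].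
  have := L2_scale (s - t)^-1 (mitv _) (L2_sub (mitv _) (Lw s) (Lw t)).
  by apply: eq_L2 => x _; rewrite mulrC.
- move=> t _; apply: cvg_within_filter; apply/sqn_cvg0; last exact: wave_t_continuous.
    exact: mitv.
  by apply: nearW => s; apply: L2_sub; [exact: mitv|exact: L2_wave_t|exact: L2_wave_t].
- by move=> t _; exact: wave_at0.
- by move=> x x01; rewrite y0E.
- by apply: aeW => x /=; rewrite in_itv/= => x01; rewrite y1E.
- move=> phi dphi Hphi phi0 t /andP[t0 tT].
  rewrite -[LHS]/(ip `]0, 1[ (wave_t f t) phi) (wave_variational Lf t0 Hphi phi0).
  congr (_ + _).
    by apply: eq_ip => // x; rewrite /= in_itv/= => x01; rewrite y1E.
  apply: eq_Rintegral => s; rewrite inE/= in_itv/= => /andP[s0 st].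
  by rewrite uE// s0 (lt_le_trans st).
Qed.

(** The quotient at 0 is the sum of a right and a left difference quotient of
    the primitive of f. *)
Lemma wave_boundary f (T : R) : locL2 f ->
  boundary_derivative0 T (wave f) (fun t => 2 * f t).
Proof.
move=> Lf; split; first by apply: L2_scale; [exact: mitv|exact: Lf].
pose Q h x := h^-1 * (prim f (x + h) - prim f x) - f x.
have LQ h : locL2 (Q h) by exact: locL2_quotient.
have QE t e : (wave f t e - wave f t 0) / e - 2 * f t = Q e t + Q (- e) t.
  by rewrite /Q wave_at0 /wave invrN; ring.
apply/sqn_cvg0; first exact: mitv.
  apply: nearW => e; apply: (@eq_L2 _ _ (fun t => Q e t + Q (- e) t)).
    by move=> t _; rewrite QE.
  by apply: L2_add; [exact: mitv|exact: LQ|exact: LQ].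
have H1 := @difference_quotient_L2_right _ f 0 T Lf.
have H2 := @difference_quotient_L2 _ f 0 T Lf.
have H3 : sqn `]0, T[ (Q (- e)) @[e --> 0^'+] --> (0 : R).
  have N : - e @[e --> 0^'+] --> (0 : R)^'.
    move=> P /nbhs_normP[d /= d0 Pd]; apply/nbhs_normP; exists d => //= s /= ds s0.
    by apply: Pd; [rewrite /= opprK add0r; rewrite sub0r normrN in ds|rewrite oppr_eq0 gt_eqF].
  exact: cvg_comp N H2.
apply: (cvg_squeeze0 _ H1 H3) => e; rewrite sqn_ge0/=.
rewrite (@eq_sqn _ _ _ (fun t => Q e t + Q (- e) t)); last by move=> t _; rewrite QE.
by apply: sqn_add_le; [exact: mitv|exact: LQ|exact: LQ].
Qed.

End Solution.

(** * Functions given by blocks of length two *)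

Section Blocks.
Context {R : realType}.
Implicit Types (phi : nat -> R -> R).

(** On [2 k - 1, 2 k + 1[ this is the translate of [phi k] by 2 k; below -1 it
    is [phi 0], since [Num.truncn] vanishes on negative numbers. *)
Definition glue phi (t : R) : R :=
  let k := Num.truncn ((t + 1) / 2) in phi k (t - (2 * k)%:R).

Lemma glueE phi k (s : R) : -1 <= s < 1 -> glue phi ((2 * k)%:R + s) = phi k s.
Proof.
move=> /andP[s1 s2]; rewrite /glue.
have -> : Num.truncn (((2 * k)%:R + s + 1) / 2) = k.
  apply: truncn_def; rewrite natrM -(natr1 k); apply/andP; split; lra.
by rewrite addrAC subrr add0r.
Qed.

Lemma glue0 phi (t : R) : t < 1 -> glue phi t = phi 0%N t.
Proof.
move=> t1; rewrite /glue.
have -> : Num.truncn ((t + 1) / 2) = 0%N.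
  by apply/eqP; rewrite -leqn0 leqNgt truncn_gt0 -ltNge; lra.
by rewrite muln0 subr0.
Qed.

Lemma glue_locL2 phi : (forall k, L2 setT (phi k)) -> locL2 (glue phi).
Proof.
move=> Lphi a b.
suff H N : L2 `]a, (2 * N)%:R + 1[ (glue phi).
  have := H (Num.bound `|b|); apply: L2_subset; [exact: mitv|exact: mitv|].
  apply: subset_itvl; rewrite bnd_simp.
  have := archi_boundP (normr_ge0 b); have := ler_norm b.
  by rewrite natrM; have := normr_ge0 b; lra.
elim: N => [|N IH].
  apply: (@eq_L2 _ _ (phi 0%N)).
    by move=> x; rewrite /= in_itv/= muln0 add0r => /andP[_ x1]; rewrite glue0.
  by apply: L2_subset (Lphi _) => //; exact: mitv.
apply: (@L2_subset _ _ (`]a, (2 * N)%:R + 1[ `|` `[(2 * N)%:R + 1, (2 * N.+1)%:R + 1[)).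
- exact: mitv.
- by apply: measurableU; exact: mitv.
- move=> x /=; rewrite !in_itv/= => /andP[ax xN].
  by have [xN'|xN'] := ltP x ((2 * N)%:R + 1); [left; rewrite ax|right; rewrite xN].
apply: L2_setU => //; try exact: mitv.
apply: (@eq_L2 _ _ (fun x => phi N.+1 (- (2 * N.+1)%:R + x))); last first.
  by apply: L2_subset (L2T_shift _ (Lphi _)) => //; exact: mitv.
move=> x; rewrite /= in_itv/= => /andP[x1 x2].
rewrite -(@glueE phi N.+1) ?addNKr//.
by move: x1 x2; rewrite !natrM -(natr1 N) => ? ?; lra.
Qed.

End Blocks.

(** * Uniqueness of finite-energy solutions *)

Section Uniqueness.
Context {R : realType}.
Local Notation mu := (@lebesgue_measure R).
Implicit Types (f g p q : R -> R).

Lemma near_within (T : Type) (F : set_system T) {FF : Filter F} (A : set T) :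
  \forall s \near within A F, A s.
Proof. by apply: filterS (@filterT _ _ FF) => s. Qed.

Lemma cvg_unwithin (T : Type) (U : Type) (F : set_system T) {FF : Filter F}
    (A : set T) (f : T -> U) (G : set_system U) :
  F A -> f s @[s --> within A F] --> G -> f s @[s --> F] --> G.
Proof.
move=> FA fG P GP; have := fG P GP; rewrite /within/=.
by apply: filterS2 FA => s As /(_ As).
Qed.

Lemma L2norm_sub_cvg (T : Type) (F : set_system T) {FF : Filter F}
    (D : set (measurableTypeR R)) (a b c : T -> R -> R) :
  measurable D -> (\forall s \near F, L2 D (a s)) ->
  (\forall s \near F, L2 D (b s)) ->
  (\forall s \near F, forall x, D x -> c s x = a s x - b s x) ->
  L2norm D (a s) @[s --> F] --> 0%E -> L2norm D (b s) @[s --> F] --> 0%E ->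
  L2norm D (c s) @[s --> F] --> 0%E.
Proof.
move=> mD La Lb cE /(sqn_cvg0 _ mD La) ca /(sqn_cvg0 _ mD Lb) cb.
have Lc : \forall s \near F, L2 D (c s).
  near=> s; apply: (@eq_L2 _ _ (fun x => a s x - b s x)).
    by move=> x Dx; rewrite (near cE s)//.
  by apply: L2_sub => //; near: s.
apply/(sqn_cvg0 _ mD Lc).
apply: (@squeeze_cvgr _ F _ _ (cst 0) (fun s => 2 * sqn D (a s) + 2 * sqn D (b s))).
- near=> s; rewrite sqn_ge0/= (@eq_sqn _ _ (c s) (fun x => a s x - b s x)).
    by apply: sqn_sub_le => //; near: s.
  by move=> x Dx; rewrite (near cE s)//.
- exact: cvg_cst.
- rewrite -[X in _ --> X](addr0 (0 : R)) -[X in _ --> X + _](mulr0 2).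
  rewrite -[X in _ --> _ + X](mulr0 2).
  by apply: cvgD; apply: cvgM => //; exact: cvg_cst.
Unshelve. all: by end_near. Qed.

Lemma mem_itv_cc (T s : R) : `[0%R, T]%classic s -> 0 <= s <= T.
Proof. by rewrite /= in_itv. Qed.

Lemma fes_ip_continuous (T : R) y0 y1 u y yx yt (psi : R -> R) :
  finite_energy_solution T y0 y1 u y yx yt -> L2 `]0, 1[ psi ->
  {within `[0, T], continuous (fun t => ip `]0, 1[ (yx t) psi)}.
Proof.
move=> S Lpsi; apply/subspace_continuousP => t /mem_itv_cc tT.
have Lx s : `[0%R, T]%classic s -> L2 `]0, 1[ (yx s).
  by move=> /mem_itv_cc sT; exact: (fes_H1 S sT).1.
have near_L : \forall s \near within `[0, T] (nbhs t), L2 `]0, 1[ (yx s).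
  by apply: filterS (@near_within _ (nbhs t) _ `[0, T]) => s; exact: Lx.
have Lt : L2 `]0, 1[ (yx t) by apply: Lx; rewrite /= in_itv.
have near_L' : \forall s \near within `[0, T] (nbhs t), L2 `]0, 1[ (yx s \- yx t).
  by apply: filterS near_L => s Ls; apply: L2_sub => //; exact: mitv.
apply: (@ip_cvg R _ _ _ _ _ (fun _ => psi)) => //.
- exact: nearW.
- apply/(sqn_cvg0 _ (mitv `]0, 1[)) => //; exact: (fes_continuous_x S tT).
- rewrite (_ : (fun _ => sqn _ _) = cst 0); first exact: cvg_cst.
  apply/funext => r; rewrite (@eq_sqn _ _ _ (fun=> 0)).
    by rewrite /sqn; under eq_Rintegral do rewrite expr0n; rewrite Rint_cst// mul0r.
  by move=> x _ /=; rewrite subrr.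
Qed.

Lemma fes_ip_integrable (T : R) y0 y1 u y yx yt (psi : R -> R) (a b : R) :
  finite_energy_solution T y0 y1 u y yx yt -> L2 `]0, 1[ psi ->
  0 <= a -> b <= T ->
  mu.-integrable `]a, b[ (EFin \o (fun t => ip `]0, 1[ (yx t) psi)).
Proof.
move=> S Lpsi a0 bT; have := fes_ip_continuous S Lpsi.
move/(continuous_compact_integrable (@segment_compact _ _ _)).
apply: integrableS; [exact: mitv|exact: mitv|].
by move=> x /=; rewrite !in_itv/= => /andP[? ?]; apply/andP; split; lra.
Qed.

Lemma fes_sub (T : R) y0 y1 u y yx yt y' yx' yt' :
  finite_energy_solution T y0 y1 u y yx yt ->
  finite_energy_solution T y0 y1 u y' yx' yt' ->
  L2 `]0, T[ u -> L2 `]0, 1[ y1 ->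
  finite_energy_solution T (cst 0) (cst 0) (cst 0)
    (fun t => y t \- y' t) (fun t => yx t \- yx' t) (fun t => yt t \- yt' t).
Proof.
move=> S S' Lu Ly1.
have m01 : measurable (`]0, 1[%classic : set (measurableTypeR R)) by exact: mitv.
have nearL (F : set_system R) (FF : Filter F) (z : R -> R -> R) :
    (forall s, 0 <= s <= T -> L2 `]0, 1[ (z s)) ->
    \forall s \near within `[0, T] F, L2 `]0, 1[ (z s).
  by move=> Lz; apply: filterS (@near_within _ F _ `[0, T]) => s /mem_itv_cc; exact: Lz.
have nearB (F : set_system R) (FF : Filter F) (z : R -> R -> R) (t : R) :
    (forall s, 0 <= s <= T -> L2 `]0, 1[ (z s)) -> 0 <= t <= T ->
    \forall s \near within `[0, T] F, L2 `]0, 1[ (z s \- z t).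
  move=> Lz tT; apply: filterS (nearL F FF z Lz) => s Ls.
  by apply: L2_sub => //; exact: Lz.
have Ly t : 0 <= t <= T -> L2 `]0, 1[ (y t) by move=> /(fes_H1 S)/H1_L2.
have Ly' t : 0 <= t <= T -> L2 `]0, 1[ (y' t) by move=> /(fes_H1 S')/H1_L2.
have Lx t : 0 <= t <= T -> L2 `]0, 1[ (yx t) by move=> /(fes_H1 S)[].
have Lx' t : 0 <= t <= T -> L2 `]0, 1[ (yx' t) by move=> /(fes_H1 S')[].
have Lt := fes_L2 S; have Lt' := fes_L2 S'.
split.
- by move=> t tT; apply: H1_sub; [exact: (fes_H1 S)|exact: (fes_H1 S')].
- by move=> t tT; apply: L2_sub => //; [exact: Lt|exact: Lt'].
- move=> t tT; apply: L2norm_sub_cvg (fes_continuous S tT) (fes_continuous S' tT) => //.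
  + exact: nearB.
  + exact: nearB.
  + by apply: nearW => s x _ /=; ring.
- move=> t tT; apply: L2norm_sub_cvg (fes_continuous_x S tT) (fes_continuous_x S' tT) => //.
  + exact: nearB.
  + exact: nearB.
  + by apply: nearW => s x _ /=; ring.
- move=> t tT.
  have Q (z zt : R -> R -> R) : (forall s, 0 <= s <= T -> L2 `]0, 1[ (z s)) ->
      (forall s, 0 <= s <= T -> L2 `]0, 1[ (zt s)) ->
      \forall s \near within `[0, T] t^',
        L2 `]0, 1[ (fun x => (z s x - z t x) / (s - t) - zt t x).
    move=> Lz Lzt; apply: filterS (nearB t^' _ z t Lz tT) => s Ls.
    apply: L2_sub => //; last exact: Lzt.
    by apply: eq_L2 (L2_scale (s - t)^-1 m01 Ls) => x _; rewrite mulrC.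
  apply: L2norm_sub_cvg (fes_derivative_t S tT) (fes_derivative_t S' tT) => //.
  + exact: Q.
  + exact: Q.
  + by apply: nearW => s x _ /=; ring.
- move=> t tT; apply: L2norm_sub_cvg (fes_continuous_t S tT) (fes_continuous_t S' tT) => //.
  + exact: nearB.
  + exact: nearB.
  + by apply: nearW => s x _ /=; ring.
- by move=> t tT /=; rewrite (fes_dirichlet S tT) (fes_dirichlet S' tT) subrr.
- by move=> x x01 /=; rewrite (fes_initial_state S x01) (fes_initial_state S' x01) subrr.
- apply: aeS2 (fes_initial_speed S) (fes_initial_speed S') => x H H' x01 /=.
  by rewrite H// H'// subrr.
- move=> phi dphi Hphi phi0 t tT; have [t0 tT'] := andP tT.
  have Lphi := H1_L2 Hphi; have Ldphi := Hphi.1.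
  have W := fes_wave S Hphi phi0 tT; have W' := fes_wave S' Hphi phi0 tT.
  have Iu : mu.-integrable `]0, t[ (EFin \o (fun s => u s * phi 1)).
    have I0 : mu.-integrable `]0, t[ (EFin \o u).
      apply: L2_integrable; [exact: mitv|exact: bounded_itv_lty|].
      by apply: L2_subset Lu; [exact: mitv|exact: mitv|exact: subset_itvl].
    by apply: eq_integrable (integrable_scale (phi 1) (mitv _) I0) => // s _ /=;
      rewrite mulrC.
  have Ic := fes_ip_integrable S Ldphi (lexx 0) tT'.
  have Ic' := fes_ip_integrable S' Ldphi (lexx 0) tT'.
  rewrite -[LHS]/(ip `]0, 1[ (yt t \- yt' t) phi) ipBl//; [|exact: Lt|exact: Lt'].
  rewrite [ip _ (yt t) phi]W [ip _ (yt' t) phi]W'.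
  have Z : \int[mu]_(x in `]0, 1[) ((cst 0 : R -> R) x * phi x) = 0.
    by under eq_Rintegral do rewrite mul0r; rewrite Rint_cst// mul0r.
  rewrite Z add0r.
  rewrite RintegralB; [|exact: mitv|exact: Iu|exact: Ic].
  rewrite RintegralB; [|exact: mitv|exact: Iu|exact: Ic'].
  transitivity (\int[mu]_(s in `]0, t[) (ip `]0, 1[ (yx' s) dphi -
      ip `]0, 1[ (yx s) dphi)).
    rewrite RintegralB; [|exact: mitv|exact: Ic'|exact: Ic].
    by rewrite /ip; ring.
  apply: eq_Rintegral => s; rewrite inE/= in_itv/= => /andP[s0 st].
  have sT : 0 <= s <= T by rewrite ltW//= (le_trans (ltW st)).
  rewrite mul0r sub0r -[X in _ = - X]/(ip `]0, 1[ (yx s \- yx' s) dphi) ipBl//.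
  - by rewrite opprB.
  - exact: Lx.
  - exact: Lx'.
Qed.

End Uniqueness.

Section Duality.
Context {R : realType}.
Local Notation mu := (@lebesgue_measure R).
Implicit Types (f g p q : R -> R).

Lemma nbhs_itv_cc (T t : R) : 0 < t < T -> nbhs t (`[0, T]%classic : set R).
Proof.
move=> tT; have : t \in `]0, T[ by rewrite in_itv.
by move/near_in_itvoo; apply: filterS => s; exact: subset_itv_oo_cc.
Qed.

Lemma dnbhs_itv_cc (T t : R) : 0 < t < T -> t^' (`[0, T]%classic : set R).
Proof. by move=> tT; apply: nbhs_dnbhs; exact: nbhs_itv_cc. Qed.

Lemma dnbhs_addr (t : R) : h + t @[h --> 0^'] --> t^'.
Proof.
move=> P /nbhs_normP[d /= d0 Pd]; apply/nbhs_normP; exists d => //= h /= th h0.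
apply: Pd; first by rewrite /= opprD addrCA subrr addr0 -sub0r.
by rewrite -subr_eq0 addrK.
Qed.

Lemma quotient_derivable (F : R -> R) (t c : R) : derivable F t 1 ->
  derive1 F t = c -> (s - t)^-1 * (F s - F t) @[s --> t^'] --> c.
Proof.
move=> dF <-; rewrite derive1E /derive.
have := cvg_comp _ _ (@dnbhs_subr R t) dF.
apply: cvg_trans; apply: near_eq_cvg; apply: nearW => s /=.
by rewrite -[_ *: 1]/(_ * 1) mulr1 subrK.
Qed.

Lemma is_derive_quotient (F : R -> R) (t c : R) :
  (s - t)^-1 * (F s - F t) @[s --> t^'] --> c -> is_derive t 1 F c.
Proof.
move=> H.
have {}H : h^-1 *: (F (h *: 1 + t) - F t) @[h --> 0^'] --> c.
  have := cvg_comp _ _ (@dnbhs_addr t) H.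
  apply: cvg_trans; apply: near_eq_cvg; apply: nearW => h /=.
  by rewrite -[_ *: 1]/(_ * 1) mulr1 addrK.
by apply: DeriveDef; [exact: cvgP H|exact: cvg_lim H].
Qed.

Section FreeSolution.
Variables (T : R) (w0 w1 : R -> R) (w wx wt : R -> R -> R).
Hypothesis S : finite_energy_solution T w0 w1 (cst 0) w wx wt.

Lemma fes_weak_derivative (phi dphi : R -> R) (t : R) : 0 < t < T ->
  H1_with_derivative phi dphi -> phi 0 = 0 ->
  (s - t)^-1 * (ip `]0, 1[ (wt s) phi - ip `]0, 1[ (wt t) phi)
    @[s --> t^'] --> - ip `]0, 1[ (wx t) dphi.
Proof.
move=> tT Hphi phi0; have [t0 tT'] := andP tT.
have cc := fes_ip_continuous S Hphi.1.
pose c s := ip `]0, 1[ (wx s) dphi.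
have ccT : mu.-integrable `[0, T] (EFin \o c).
  exact: continuous_compact_integrable (@segment_compact _ _ _) cc.
have ic : mu.-integrable [set` Interval (BRight 0) (BRight T)] (EFin \o c).
  apply: integrableS ccT; [exact: mitv|exact: mitv|].
  by apply: subset_itvr; rewrite bnd_simp.
have ct : {for t, continuous c}.
  move/subspace_continuousP : cc => /(_ t) H.
  apply: (cvg_unwithin (nbhs_itv_cc tT)); apply: H.
  by rewrite /= in_itv/= (ltW t0) (ltW tT').
have bt : (BRight (0 : R) < BRight t)%O by rewrite bnd_simp.
have [dF F'] := continuous_FTC1 tT' ic bt ct.
have Q := quotient_derivable dF F'.
have E s : 0 <= s <= T -> ip `]0, 1[ (wt s) phi =
    ip `]0, 1[ w1 phi - \int[mu]_(r in [set` Interval (BRight 0) (BRight s)]) c r.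
  move=> sT; have [s0 sT'] := andP sT.
  rewrite [LHS](fes_wave S Hphi phi0 sT) -Rintegral_itv_bndo_bndc; last first.
    exact: fes_ip_integrable S Hphi.1 (lexx 0) sT'.
  congr (_ + _).
  rewrite -[RHS]mulN1r -RintegralZl; [|exact: mitv|
    exact: fes_ip_integrable S Hphi.1 (lexx 0) sT'].
  by apply: eq_Rintegral => r _; rewrite mul0r sub0r mulN1r.
have {}Q := cvgN Q; apply: (cvg_trans _ (Q _)); apply: near_eq_cvg.
apply: filterS (dnbhs_itv_cc tT) => s /mem_itv_cc sT.
have tT0 : 0 <= t <= T by rewrite (ltW t0) (ltW tT').
by rewrite (E s sT) (E t tT0) opprfctE; ring.
Qed.

(** A product rule although wt is only weakly differentiable in time: z is
    differentiable with values in L^2, and each z t is a test function for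
    [fes_weak_derivative]. *)
Lemma pairing_derivative (z0 z1 v : R -> R) (z zx zt : R -> R -> R) (t : R) :
  finite_energy_solution T z0 z1 v z zx zt -> 0 < t < T ->
  (s - t)^-1 * (ip `]0, 1[ (wt s) (z s) - ip `]0, 1[ (wt t) (z t))
    @[s --> t^'] --> ip `]0, 1[ (wt t) (zt t) - ip `]0, 1[ (wx t) (zx t).
Proof.
move=> Z tT; have [t0 tT'] := andP tT.
have tT0 : 0 <= t <= T by rewrite (ltW t0) (ltW tT').
have m01 : measurable (`]0, 1[%classic : set (measurableTypeR R)) by exact: mitv.
have nT := dnbhs_itv_cc tT.
have Lw s : 0 <= s <= T -> L2 `]0, 1[ (wt s) by exact: fes_L2 S _.
have Lz s : 0 <= s <= T -> L2 `]0, 1[ (z s) by move=> /(fes_H1 Z)/H1_L2.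
have Lzt s : 0 <= s <= T -> L2 `]0, 1[ (zt s) by exact: fes_L2 Z _.
have D := fes_weak_derivative tT (fes_H1 Z tT0) (fes_dirichlet Z tT0).
pose b s x := (z s x - z t x) / (s - t).
have Lb s : 0 <= s <= T -> L2 `]0, 1[ (b s).
  move=> sT; have := L2_scale (s - t)^-1 m01 (L2_sub m01 (Lz s sT) (Lz t tT0)).
  by apply: eq_L2 => x _; rewrite mulrC.
have cb : ip `]0, 1[ (wt s) (b s) @[s --> t^'] --> ip `]0, 1[ (wt t) (zt t).
  have near_w : \forall s \near t^', L2 `]0, 1[ (wt s).
    by apply: filterS nT => s /mem_itv_cc; exact: Lw.
  have near_b : \forall s \near t^', L2 `]0, 1[ (b s).
    by apply: filterS nT => s /mem_itv_cc; exact: Lb.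
  have near_w' : \forall s \near t^', L2 `]0, 1[ (wt s \- wt t).
    by apply: filterS near_w => s Ls; apply: L2_sub => //; exact: Lw.
  have near_b' : \forall s \near t^', L2 `]0, 1[ (b s \- zt t).
    by apply: filterS near_b => s Ls; apply: L2_sub => //; exact: Lzt.
  apply: ip_cvg => //.
  - exact: Lw.
  - exact: Lzt.
  - apply/(sqn_cvg0 _ m01) => //.
    apply: (@cvg_within_filter _ _ _ (nbhs t) _ _ (fun s => s != t)).
    exact: (cvg_unwithin (nbhs_itv_cc tT) (fes_continuous_t S tT0)).
  - apply/(sqn_cvg0 _ m01) => //.
    exact: (cvg_unwithin nT (fes_derivative_t Z tT0)).
have {}D := cvgD cb D; apply: (cvg_trans _ (D _)); apply: near_eq_cvg.
apply: filterS nT => s /mem_itv_cc sT; rewrite addrfctE.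
rewrite (_ : ip _ _ (b s) = (s - t)^-1 * ip `]0, 1[ (wt s) (z s \- z t)); last first.
  rewrite -ipZr; [|exact: mitv|by apply: L2_sub => //; exact: Lz|exact: Lw].
  by apply: eq_ip => // x _; rewrite mulrC.
rewrite ipBr//; [by ring|exact: Lz|exact: Lz|exact: Lw].
Qed.

End FreeSolution.

Lemma pairing_continuous (T : R) w0 w1 v w wx wt z0 z1 v' z zx zt :
  finite_energy_solution T w0 w1 v w wx wt ->
  finite_energy_solution T z0 z1 v' z zx zt ->
  {within `[0, T], continuous (fun t => ip `]0, 1[ (wt t) (z t))}.
Proof.
move=> S Z; apply/subspace_continuousP => t /mem_itv_cc tT.
have m01 : measurable (`]0, 1[%classic : set (measurableTypeR R)) by exact: mitv.
have Lw s : 0 <= s <= T -> L2 `]0, 1[ (wt s) by exact: fes_L2 S _.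
have Lz s : 0 <= s <= T -> L2 `]0, 1[ (z s) by move=> /(fes_H1 Z)/H1_L2.
have near_w : \forall s \near within `[0, T] (nbhs t), L2 `]0, 1[ (wt s).
  by apply: filterS (@near_within _ (nbhs t) _ `[0, T]) => s /mem_itv_cc; exact: Lw.
have near_z : \forall s \near within `[0, T] (nbhs t), L2 `]0, 1[ (z s).
  by apply: filterS (@near_within _ (nbhs t) _ `[0, T]) => s /mem_itv_cc; exact: Lz.
have near_w' : \forall s \near within `[0, T] (nbhs t), L2 `]0, 1[ (wt s \- wt t).
  by apply: filterS near_w => s Ls; apply: L2_sub => //; exact: Lw.
have near_z' : \forall s \near within `[0, T] (nbhs t), L2 `]0, 1[ (z s \- z t).
  by apply: filterS near_z => s Ls; apply: L2_sub => //; exact: Lz.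
apply: (@ip_cvg R _ _ _ `]0, 1[ wt z) => //.
- exact: Lw.
- exact: Lz.
- by apply/(sqn_cvg0 _ m01) => //; exact: (fes_continuous_t S tT).
- by apply/(sqn_cvg0 _ m01) => //; exact: (fes_continuous Z tT).
Qed.

(** The derivative in time vanishes because each half of the pairing has the
    derivative <wt, zt> - <wx, zx>, which is symmetric in w and z. *)
Lemma green_identity (T t : R) w0 w1 w wx wt z0 z1 z zx zt :
  finite_energy_solution T w0 w1 (cst 0) w wx wt ->
  finite_energy_solution T z0 z1 (cst 0) z zx zt -> 0 < t <= T ->
  ip `]0, 1[ (wt t) (z t) - ip `]0, 1[ (zt t) (w t) =
  ip `]0, 1[ (wt 0) (z 0) - ip `]0, 1[ (zt 0) (w 0).
Proof.
move=> S Z /andP[t0 tT].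
pose P s := ip `]0, 1[ (wt s) (z s) - ip `]0, 1[ (zt s) (w s).
have dP s : s \in `]0, t[ -> is_derive s 1 P (cst 0 s).
  rewrite in_itv/= => /andP[s0 st]; apply: is_derive_quotient.
  have sT : 0 < s < T by rewrite s0 (lt_le_trans st).
  have H1 := pairing_derivative S Z sT.
  have H2 := pairing_derivative Z S sT.
  have H := cvgB H1 H2.
  rewrite [X in _ --> X](_ : _ =
      ip `]0, 1[ (wt s) (zt s) - ip `]0, 1[ (wx s) (zx s) -
      (ip `]0, 1[ (zt s) (wt s) - ip `]0, 1[ (zx s) (wx s))); last first.
    by rewrite (ipC _ (zt s)) (ipC _ (zx s)) subrr.
  apply: (cvg_trans _ (H _)); apply: near_eq_cvg; apply: nearW => r.
  rewrite /P addrfctE opprfctE; ring.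
have cP : {within `[0, t], continuous P}.
  apply: (@continuous_subspaceW _ _ _ `[0, T]); first exact: subset_itvl.
  have c1 := pairing_continuous S Z; have c2 := pairing_continuous Z S.
  by move=> s; apply: cvgB; [exact: c1|exact: c2].
have [c _] := MVT t0 dP cP.
by rewrite mul0r => /eqP; rewrite subr_eq0 => /eqP.
Qed.

Lemma glue_period (phi : nat -> R -> R) (a : R) : -1 <= a ->
  glue phi (a + 2) = glue (fun k => phi k.+1) a.
Proof.
move=> a1; pose k := Num.truncn ((a + 1) / 2).
have /andP[k1 k2] : k%:R <= (a + 1) / 2 < k.+1%:R by apply: truncn_itv; lra.
have s1 : -1 <= a - (2 * k)%:R < 1.
  by move: k2; rewrite -(natr1 k) natrM; lra.
have -> : a + 2 = (2 * k.+1)%:R + (a - (2 * k)%:R).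
  by rewrite !natrM -(natr1 k); ring.
have E : a = (2 * k)%:R + (a - (2 * k)%:R) by rewrite subrKC.
by rewrite [in RHS]E !glueE.
Qed.

(** Take the profile h odd around t, so that the state vanishes at time t, with
    h(t + x) = omega(x) / 2, and continue it antiperiodically with period 2, so
    that the control h(s + 1) + h(s - 1) is zero. *)
Lemma free_solution_at (T t : R) (omega : R -> R) : 0 <= t ->
  L2 `]0, 1[ omega -> exists z0 z1 z zx zt,
  [/\ finite_energy_solution T z0 z1 (cst 0) z zx zt,
      forall x, 0 <= x <= 1 -> z t x = 0 &
      forall x, 0 < x < 1 -> zt t x = omega x].
Proof.
move=> t0 Lo; pose o := omega \_ `]0, 1[.
have Lo' : L2 setT o by apply/(L2_patch _ (mitv _)).
pose r s := 2^-1 * (o s - o (0 - s)).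
have Lr : L2 setT r.
  by apply: L2_scale => //; apply: L2_sub => //; exact: L2T_reflect.
pose phi k s := (-1) ^+ k * r s.
have Lphi k : L2 setT (phi k) by exact: L2_scale.
pose N := Num.bound t.
have tN : t < N%:R by exact: archi_boundP.
have N0 : (0 : R) <= N%:R by exact: ler0n.
(* The argument of glue is at least -1 whenever s >= -1, and the shift by an
   even number of blocks preserves the sign of the profile around t. *)
pose h s := glue phi ((2 * (2 * N))%:R - t + s).
have Lh : locL2 h by apply: locL2_shift; exact: glue_locL2.
have hN s : 0 < s -> h (s + 1) + h (s - 1) = 0.
  move=> s0; rewrite /h; set c := _ - t.
  have -> : c + (s + 1) = c + (s - 1) + 2 by ring.
  have c1 : -1 <= c + (s - 1) by rewrite /c !natrM; lra.
  rewrite glue_period// (_ : (fun k => phi k.+1) = (fun k s => -1 * phi k s)); last first.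
    by apply/funext => k; apply/funext => x; rewrite /phi exprS mulrA.
  by rewrite /glue; ring.
have ht x : -1 < x < 1 -> h (t + x) = r x.
  move=> /andP[x1 x2]; rewrite /h addrA subrK glueE ?(ltW x1)//.
  by rewrite /phi mulnC exprM sqrr_sign mul1r.
have rN x : r (- x) = - r x by rewrite /r !sub0r opprK; ring.
have oE x : 0 < x < 1 -> r x = 2^-1 * omega x.
  move=> /andP[x0 x1].
  have h1 : x \in (`]0, 1[%classic : set R) by rewrite inE/= in_itv/= x0.
  have h2 : (0 - x \in (`]0, 1[%classic : set R)) = false.
    by apply/negP; rewrite inE/= in_itv/= => /andP[]; lra.
  by rewrite /r /o !patchE h1 h2 subr0.
exists (wave h 0), (wave_t h 0), (wave h), (wave_x h), (wave_t h); split.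
- by apply: wave_solution => // s /andP[s0 _]; rewrite hN.
- move=> x /andP[x0 x1]; rewrite waveE//.
  rewrite (_ : \int[mu]_(s in `]0, x[) wave_x h t s =
    \int[mu]_(s in `]0, x[) 0); first by rewrite Rint_cst// mul0r.
  apply: eq_Rintegral => s; rewrite inE/= in_itv/= => /andP[s0 sx].
  by rewrite /wave_x !ht ?rN ?subrr//; lra.
- move=> x /andP[x0 x1]; rewrite /wave_t !ht ?rN; [|lra|lra].
  by rewrite oE ?x0//; field.
Qed.

Lemma sqn0 (D : set (measurableTypeR R)) : measurable D -> sqn D (fun=> 0 : R) = 0.
Proof.
move=> mD; apply: sqn_ae0 => //; first exact: L2_0.
by apply: aeW.
Qed.

Lemma ip_eq0 (D : set (measurableTypeR R)) f g : measurable D ->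
  L2 D f -> L2 D g -> sqn D f = 0 -> ip D f g = 0.
Proof.
move=> mD Lf Lg f0; have := ip_CS mD Lf Lg.
by rewrite f0 sqrtr0 mul0r normr_le0 => /eqP.
Qed.

(** If f x <> 0, then f^2 is bounded away from 0 on an interval ending at x. *)
Lemma H1_eq0 f df : H1_with_derivative f df -> f 0 = 0 ->
  sqn `]0, 1[ f = 0 -> forall x, 0 <= x <= 1 -> f x = 0.
Proof.
move=> /H1_primitive[Ld _ fE] f0 sf x /andP[x0 x1].
set d := (df \_ `]0, 1[) in Ld fE.
have {}fE y : 0 <= y <= 1 -> f y = prim d y by move=> y01; rewrite fE// f0 add0r.
move: x0; rewrite le_eqVlt => /predU1P[<-//|x0].
apply: contrapT => /eqP fx0.
have c0 : 0 < `|f x| / 2 by rewrite divr_gt0// normr_gt0.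
have fxE : f x = prim d x by rewrite fE// ltW.
have cx : {for x, continuous (prim d)} by exact: prim_continuous.
have /cvgrPdist_lt /(_ _ c0) /nbhs_normP[e /= e0 He] := cx.
pose a := Num.max 0 (x - e).
have ax : a < x by rewrite /a gt_max x0/=; lra.
have a0 : 0 <= a by rewrite le_max lexx.
have ae : x - e <= a by rewrite le_max lexx orbT.
have Lf (b c : R) : L2 `]b, c[ (prim d) by exact: prim_locL2.
have : (`|f x| / 2) ^+ 2 * (x - a) <= sqn `]0, 1[ f.
  rewrite -(Rint_cst _ (ltW ax)).
  apply: (@le_trans _ _ (sqn `]a, x[ (prim d))).
    apply: le_Rint; first exact: mitv.
    - by apply: (@continuous_integrable_itv R (cst _)) => y; exact: cvg_cst.
    - by apply: L2_sqr; [exact: mitv|exact: Lf].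
    - move=> y; rewrite /= in_itv/= => /andP[ay yx].
      have : `|prim d x - prim d y| < `|f x| / 2.
        by apply: He; rewrite /= ger0_norm; lra.
      rewrite -fxE => H.
      have : `|f x| / 2 <= `|prim d y|.
        have := lerB_dist (f x) (f x - prim d y); rewrite subKr; lra.
      by move=> H2; rewrite -[leRHS]real_normK ?num_real// ler_pXn2r ?nnegrE ?normr_ge0 ?(ltW c0).
  rewrite (@eq_sqn _ `]0, 1[ f (prim d)); last first.
    by move=> y; rewrite /= in_itv/= => /andP[y0 y1]; rewrite fE// (ltW y0) (ltW y1).
  apply: ge0_subset_Rintegral; [exact: mitv|exact: mitv| | |].
  - by apply: subset_itvW.
  - by apply: L2_sqr; [exact: mitv|exact: Lf].
  - by move=> y; exact: sqr_ge0.
rewrite sf leNgt => /negP; apply.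
by rewrite mulr_gt0 ?exprn_gt0// subr_gt0.
Qed.

Lemma within_dnbhs_neq0 (T t : R) : 0 < T -> 0 <= t <= T ->
  ~ (\forall s \near within `[0, T] t^', False).
Proof.
move=> T0 /andP[t0 tT] /nbhs_normP[d /= d0 H].
have [tT'|Tt] := ltP t T.
  have m0 : 0 < Num.min (d / 2) (T - t) by rewrite lt_min divr_gt0//= subr_gt0.
  have m1 : Num.min (d / 2) (T - t) <= d / 2 by rewrite ge_min lexx.
  have m2 : Num.min (d / 2) (T - t) <= T - t by rewrite ge_min lexx orbT.
  apply: (H (t + Num.min (d / 2) (T - t))).
  - by rewrite /= opprD addrA subrr sub0r normrN gtr0_norm//; lra.
  - by rewrite -subr_eq0 addrAC subrr add0r gt_eqF.
  - by rewrite /= in_itv/=; apply/andP; split; lra.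
have t0' : 0 < t by exact: lt_le_trans Tt.
have m0 : 0 < Num.min (d / 2) t by rewrite lt_min divr_gt0.
have m1 : Num.min (d / 2) t <= d / 2 by rewrite ge_min lexx.
have m2 : Num.min (d / 2) t <= t by rewrite ge_min lexx orbT.
apply: (H (t - Num.min (d / 2) t)).
- by rewrite /= subKr gtr0_norm//; lra.
- by rewrite -subr_eq0 addrAC subrr add0r oppr_eq0 gt_eqF.
- by rewrite /= in_itv/=; apply/andP; split; lra.
Qed.

(** Duality: at time t, pair the difference w of the two solutions with a free
    solution that vanishes at time t, with velocity w t. The conserved pairing
    is zero at time 0 and - |w t|^2 at time t. *)
Theorem fes_unique (T : R) y0 y1 u y yx yt y' yx' yt' : 0 < T ->
  finite_energy_solution T y0 y1 u y yx yt ->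
  finite_energy_solution T y0 y1 u y' yx' yt' ->
  L2 `]0, T[ u -> L2 `]0, 1[ y1 -> forall t, 0 <= t <= T ->
  (forall x, 0 <= x <= 1 -> y t x = y' t x) /\ ae_eq_on `]0, 1[ (yt t) (yt' t).
Proof.
move=> T0 S S' Lu Ly1; have W := fes_sub S S' Lu Ly1.
have m01 : measurable (`]0, 1[%classic : set (measurableTypeR R)) by exact: mitv.
have T00 : 0 <= (0 : R) <= T by apply/andP; split; [exact: lexx|exact: ltW].
have LW t : 0 <= t <= T -> L2 `]0, 1[ (y t \- y' t) by move=> /(fes_H1 W)/H1_L2.
have W0 t x : 0 <= t <= T -> 0 <= x <= 1 -> (y t \- y' t) x = 0.
  move=> tT x01; have := tT => /andP[]; rewrite le_eqVlt => /predU1P[<- _|t0 tT'].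
    exact: (fes_initial_state W).
  have [z0 [z1 [z [zx [zt [Z zt0 ztE]]]]]] := free_solution_at T (ltW t0) (LW t tT).
  have t0T : 0 < t <= T by rewrite t0.
  have := green_identity W Z t0T.
  rewrite [ip _ _ (z t)](_ : _ = 0); last first.
    rewrite ipC; rewrite (@eq_ip _ _ _ _ (fun=> 0) (yt t \- yt' t)) //.
      by rewrite /ip; under eq_Rintegral do rewrite mul0r; rewrite Rint_cst// mul0r.
    by move=> r; rewrite /= in_itv/= => /andP[r0 r1]; rewrite zt0// (ltW r0) (ltW r1).
  rewrite [ip _ (yt 0 \- yt' 0) _](_ : _ = 0); last first.
    apply: ip_eq0 => //.
    - exact: (fes_L2 W T00).
    - exact: H1_L2 (fes_H1 Z T00).
    - apply: sqn_ae0 => //; first exact: (fes_L2 W T00).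
      exact: (fes_initial_speed W).
  rewrite [ip _ _ (y 0 \- y' 0)](_ : _ = 0); last first.
    rewrite ipC (@eq_ip _ _ _ _ (fun=> 0) (zt 0))//.
      by rewrite /ip; under eq_Rintegral do rewrite mul0r; rewrite Rint_cst// mul0r.
    by move=> r; rewrite /= in_itv/= => /andP[r0 r1];
      apply: (fes_initial_state W); rewrite (ltW r0) (ltW r1).
  rewrite subrr sub0r => /eqP; rewrite oppr_eq0 => /eqP.
  have -> : ip `]0, 1[ (zt t) (y t \- y' t) = sqn `]0, 1[ (y t \- y' t).
    by apply: eq_ip => // r; rewrite /= in_itv/= => r01; rewrite ztE.
  move=> s0; exact: (H1_eq0 (fes_H1 W tT) (fes_dirichlet W tT) s0).
move=> t tT; split.
  by move=> x x01; apply/eqP; rewrite -subr_eq0; apply/eqP; exact: W0.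
have Lt := fes_L2 W tT.
(* The difference quotients in time of the zero state are zero. *)
suff s0 : sqn `]0, 1[ (yt t \- yt' t) = 0.
  by apply: aeS (sqn_eq0_ae m01 Lt s0) => x H x01; apply/eqP; rewrite -subr_eq0;
    apply/eqP; exact: H.
apply: contrapT => /eqP s0.
apply: (within_dnbhs_neq0 T0 tT).
pose Q s x := ((y s \- y' s) x - (y t \- y' t) x) / (s - t) - (yt t \- yt' t) x.
have LQ : \forall s \near within `[0, T] t^', L2 `]0, 1[ (Q s).
  apply: filterS (@near_within _ t^' _ `[0, T]) => s /mem_itv_cc sT.
  apply: L2_sub => //.
  apply: eq_L2 (L2_scale (s - t)^-1 m01 (L2_sub m01 (LW s sT) (LW t tT))) => x _.
  by rewrite mulrC.
have /(sqn_cvg0 _ m01 LQ)/cvgr0_norm_lt := fes_derivative_t W tT.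
have s0' : 0 < sqn `]0, 1[ (yt t \- yt' t).
  by rewrite lt_neqAle eq_sym s0 sqn_ge0.
move=> /(_ _ s0') H.
apply: filterS2 (@near_within _ t^' _ `[0, T]) H => s /mem_itv_cc sT.
rewrite ger0_norm ?sqn_ge0// (@eq_sqn _ _ (Q s) (fun x => -1 * (yt t \- yt' t) x)).
  by rewrite sqnZ// sqrrN expr1n mul1r ltxx.
move=> x; rewrite /= in_itv/= => /andP[x0 x1].
have x01 : 0 <= x <= 1 by rewrite (ltW x0) (ltW x1).
by rewrite /Q (W0 s)// (W0 t)// subrr mul0r sub0r mulN1r.
Qed.

End Duality.

(** * Admissible controls in terms of blocks *)

Section Admissible.
Context {R : realType}.
Local Notation mu := (@lebesgue_measure R).
Implicit Types (f g p q : R -> R) (phi : nat -> R -> R).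

Lemma L2norm_cvg_unique (T : Type) (F : set_system T) {FF : ProperFilter F}
    (D : set (measurableTypeR R)) (a b : T -> R -> R) g g' :
  measurable D ->
  (\forall s \near F, L2 D (fun x => a s x - g x)) ->
  (\forall s \near F, L2 D (fun x => b s x - g' x)) ->
  (\forall s \near F, forall x, D x -> a s x = b s x) ->
  L2 D g -> L2 D g' ->
  L2norm D (fun x => a s x - g x) @[s --> F] --> 0%E ->
  L2norm D (fun x => b s x - g' x) @[s --> F] --> 0%E ->
  ae_eq_on D g g'.
Proof.
move=> mD La Lb ab Lg Lg' /(sqn_cvg0 _ mD La) ca /(sqn_cvg0 _ mD Lb) cb.
suff s0 : sqn D (fun x => g x - g' x) = 0.
  have := sqn_eq0_ae mD (L2_sub mD Lg Lg') s0.
  by apply: aeS => x H Dx; apply/eqP; rewrite -subr_eq0; apply/eqP; exact: H.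
have H : (cst (sqn D (fun x => g x - g' x)) : T -> R) s @[s --> F] --> (0 : R).
  apply: (@squeeze_cvgr _ F _ _ (cst 0)
    (fun s => 2 * sqn D (fun x => b s x - g' x) + 2 * sqn D (fun x => a s x - g x))).
  - near=> s; rewrite sqn_ge0/=.
    rewrite (@eq_sqn _ _ (fun x => g x - g' x)
      (fun x => (b s x - g' x) - (a s x - g x))).
      by apply: sqn_sub_le => //; near: s.
    by move=> x Dx; rewrite (near ab s)//; ring.
  - exact: cvg_cst.
  - rewrite -[X in _ --> X](addr0 (0 : R)) -[X in _ --> X + _](mulr0 2).
    rewrite -[X in _ --> _ + X](mulr0 2).
    by apply: cvgD; apply: cvgM => //; exact: cvg_cst.
exact: (cvg_unique _ (cvg_cst _) H).
Unshelve. all: by end_near. Qed.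

(** Extended by 0 outside of ]0, 1[, the derivative has a primitive that
    vanishes on [0, +oo[; the right difference quotients of this primitive on
    ]0, 1[ are zero, and converge to the derivative. *)
Lemma H1_derivative_eq0 f df : H1_with_derivative f df ->
  (forall x, 0 <= x <= 1 -> f x = 0) -> sqn `]0, 1[ df = 0.
Proof.
move=> /H1_primitive[Ld dE fE] f0.
set d := (df \_ `]0, 1[) in Ld dE fE.
have p01 x : 0 <= x <= 1 -> prim d x = 0.
  by move=> x01; have := fE x x01; rewrite !f0 ?lexx ?ler01// add0r.
have p1 x : 0 <= x -> prim d x = 0.
  move=> x0; have [x1|/ltW x1] := leP x 1; first by rewrite p01// x0.
  have := primB Ld x1; rewrite (p01 1) ?ler01 ?lexx// subr0 => ->.
  rewrite (_ : \int[mu]_(s in `]1, x[) d s = \int[mu]_(s in `]1, x[) 0).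
    by rewrite Rint_cst// mul0r.
  apply: eq_Rintegral => s; rewrite inE/= in_itv/= => /andP[s1 _].
  have h : (s \in (`]0, 1[%classic : set R)) = false.
    by apply/negP; rewrite inE/= in_itv/= => /andP[]; lra.
  by rewrite /d patchE h.
rewrite (@eq_sqn _ `]0, 1[ df d); last first.
  by move=> x; rewrite /= in_itv/= => x01; rewrite dE.
have H := @difference_quotient_L2_right _ d 0 1 Ld.
have H' : (cst (sqn `]0, 1[ d) : R -> R) h @[h --> (0 : R)^'+] --> (0 : R).
  apply: cvg_trans H; apply: near_eq_cvg; near=> h.
  have h0 : 0 < h by near: h; exact: nbhs_right_gt.
  rewrite /= (@eq_sqn _ `]0, 1[ _ (fun x => -1 * d x)).
    by rewrite sqnZ ?sqrrN ?expr1n ?mul1r//; exact: mitv.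
  move=> x; rewrite /= in_itv/= => /andP[x0 x1].
  by rewrite !p1 ?subrr ?mulr0 ?sub0r ?mulN1r// ?addr_ge0 ?ltW.
exact: (cvg_unique _ (cvg_cst _) H').
Unshelve. all: by end_near. Qed.

Section Data.
Variables (y0 dy0 y1 : R -> R).
Hypotheses (hy0 : H1_with_derivative y0 dy0) (hy00 : y0 0 = 0).
Hypothesis hy1 : L2 `]0, 1[ y1.

(** The profile on ]-1, 1[ determined by the initial data through
    f(x) + f(-x) = y0'(x) and f(x) - f(-x) = y1(x). *)
Definition init (s : R) : R :=
  2^-1 * ((dy0 \_ `]0, 1[) s + (y1 \_ `]0, 1[) s +
    ((dy0 \_ `]0, 1[) (0 - s) - (y1 \_ `]0, 1[) (0 - s))).

Lemma L2_init : L2 setT init.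
Proof.
have L0 : L2 setT (dy0 \_ `]0, 1[) by apply/(L2_patch _ (mitv _)); exact: hy0.1.
have L1 : L2 setT (y1 \_ `]0, 1[) by apply/(L2_patch _ (mitv _)).
apply: L2_scale => //; apply: L2_add => //; first exact: L2_add.
by apply: L2_sub => //; exact: L2T_reflect.
Qed.

Lemma init_pm (x : R) : 0 < x < 1 ->
  init x = 2^-1 * (dy0 x + y1 x) /\ init (- x) = 2^-1 * (dy0 x - y1 x).
Proof.
move=> /andP[x0 x1].
have h1 : x \in (`]0, 1[%classic : set R) by rewrite inE/= in_itv/= x0.
have h2 : (- x \in (`]0, 1[%classic : set R)) = false.
  by apply/negP; rewrite inE/= in_itv/= => /andP[]; lra.
rewrite /init !sub0r opprK !patchE h1 h2 (_ : point = 0 :> R)//; split; ring.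
Qed.

Lemma sqn_init : sqn `]-1, 1[ init =
  2^-1 * (sqn `]0, 1[ dy0 + sqn `]0, 1[ y1).
Proof.
have Li : L2 `]-1, 1[ init by apply: L2T_loc; exact: L2_init.
rewrite /sqn (@Rint_split _ _ (-1) 0 1); [|lra|lra|exact: L2_sqr (mitv _) Li].
have -> : \int[mu]_(x in `](-1), 0[) init x ^+ 2 =
    \int[mu]_(x in `]0, 1[) init (0 - x) ^+ 2.
  have := @sqn_reflect R 0 0 1 init; rewrite sub0r subr0 => E.
  by apply/esym/E; apply: L2T_loc; exact: L2_init.
have m01 : measurable (`]0, 1[%classic : set (measurableTypeR R)) by exact: mitv.
have L0 : L2 `]0, 1[ dy0 := hy0.1.
rewrite -[RHS]/(2^-1 * (sqn `]0, 1[ dy0 + sqn `]0, 1[ y1)).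
have -> : \int[mu]_(x in `]0, 1[) init (0 - x) ^+ 2 =
    sqn `]0, 1[ (fun x => 2^-1 * dy0 x + (- 2^-1) * y1 x).
  apply: eq_sqn => x; rewrite /= in_itv/= => x01.
  by rewrite sub0r (init_pm x01).2; ring.
have -> : \int[mu]_(x in `]0, 1[) init x ^+ 2 =
    sqn `]0, 1[ (fun x => 2^-1 * dy0 x + 2^-1 * y1 x).
  apply: eq_sqn => x; rewrite /= in_itv/= => x01.
  by rewrite (init_pm x01).1; ring.
by rewrite !sqn_lin//; field.
Qed.

Lemma glue_init phi : phi 0%N = init -> (forall k, L2 setT (phi k)) ->
  (forall x, 0 <= x <= 1 -> y0 x = wave (glue phi) 0 x) /\
  (forall x, 0 < x < 1 -> y1 x = wave_t (glue phi) 0 x).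
Proof.
move=> phi0 Lphi; have Lf := glue_locL2 Lphi; split.
  move=> x /andP[x0 x1]; rewrite waveE// hy0.2 ?x0// hy00 add0r.
  apply: eq_Rintegral => s; rewrite inE/= in_itv/= => /andP[s0 sx].
  have s01 : 0 < s < 1 by rewrite s0 (lt_le_trans sx).
  rewrite /wave_x add0r sub0r !glue0 ?phi0; [|lra|lra].
  by rewrite (init_pm s01).1 (init_pm s01).2; field.
move=> x x01; rewrite /wave_t add0r sub0r !glue0 ?phi0; [|lra|lra].
by rewrite (init_pm x01).1 (init_pm x01).2; field.
Qed.

(** The blocks of the solution f of f(t + 1) + f(t - 1) = u(t), t >= 0, whose
    initial block is the one of the data. *)
Fixpoint profile (u : R -> R) (k : nat) (s : R) : R :=
  if k is j.+1 then u ((2 * j)%:R + 1 + s) - profile u j s else init s.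

Lemma L2_profile u k : L2 setT u -> L2 setT (profile u k).
Proof.
move=> Lu; elim: k => [|k IH]; first exact: L2_init.
by apply: L2_sub => //; exact: L2T_shift.
Qed.

Lemma glue_profile u (t : R) : 0 <= t ->
  u t = glue (profile u) (t + 1) + glue (profile u) (t - 1).
Proof.
move=> t0; have -> : t + 1 = t - 1 + 2 by ring.
rewrite glue_period /glue /=; last lra.
set k := Num.truncn _; rewrite subrK.
by congr u; ring.
Qed.

Lemma glue_admissible_state phi (T : R) : phi 0%N = init ->
  (forall k, L2 setT (phi k)) ->
  let f := glue phi in
  finite_energy_solution T y0 y1 (fun t => f (t + 1) + f (t - 1))
    (wave f) (wave_x f) (wave_t f) /\
  boundary_derivative0 T (wave f) (fun t => 2 * f t).
Proof.
move=> phi0 Lphi f; have Lf := glue_locL2 Lphi.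
have [H0 H1] := glue_init phi0 Lphi.
by split; [exact: wave_solution|exact: wave_boundary].
Qed.

Lemma L2_control f (a b : R) : locL2 f ->
  L2 `]a, b[ (fun t => f (t + 1) + f (t - 1)).
Proof.
move=> Lf; apply: L2_add; first exact: mitv.
- by apply: eq_L2 (locL2_shift 1 Lf a b) => t _; rewrite addrC.
- by apply: eq_L2 (locL2_shift (-1) Lf a b) => t _; rewrite addrC.
Qed.

Lemma glue_admissible phi n : phi 0%N = init -> (forall k, L2 setT (phi k)) ->
  (forall s, phi n s = 0) ->
  admissible (2 * n)%:R y0 y1
    (fun t => glue phi (t + 1) + glue phi (t - 1)) (fun t => 2 * glue phi t).
Proof.
move=> phi0 Lphi phin; have Lf := glue_locL2 Lphi.
have [H1 H2] := glue_admissible_state (2 * n)%:R phi0 Lphi.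
split; first exact: L2_control.
exists (wave (glue phi)), (wave_x (glue phi)), (wave_t (glue phi)); split => //.
- move=> x /andP[x0 x1]; rewrite waveE//.
  rewrite (_ : \int[mu]_(s in `]0, x[) wave_x (glue phi) (2 * n)%:R s =
    \int[mu]_(s in `]0, x[) 0); first by rewrite Rint_cst// mul0r.
  apply: eq_Rintegral => s; rewrite inE/= in_itv/= => /andP[s0 sx].
  by rewrite /wave_x !glueE ?phin ?addr0//; apply/andP; split; lra.
- apply: aeW => x; rewrite /= in_itv/= => /andP[x0 x1].
  by rewrite /wave_t !glueE ?phin ?subr0//; apply/andP; split; lra.
Qed.

(** Uniqueness identifies every state with the d'Alembert wave of its
    profile; this yields its boundary derivative and its final profile. *)
Lemma solution_profile (T : R) u y yx yt f g : 0 < T -> L2 `]0, T[ u ->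
  finite_energy_solution T y0 y1 u y yx yt -> boundary_derivative0 T y g ->
  finite_energy_solution T y0 y1 u (wave f) (wave_x f) (wave_t f) ->
  locL2 f ->
  ae_eq_on `]0, T[ g (fun t => 2 * f t) /\
  ((forall x, 0 <= x <= 1 -> y T x = 0) -> ae_eq_on `]0, 1[ (yt T) (cst 0) ->
   sqn `]-1, 1[ (fun s => f (T + s)) = 0).
Proof.
move=> T0 Lu S [Lg bg] W Lf.
have U := fes_unique T0 S W Lu hy1.
have m01 : measurable (`]0, 1[%classic : set (measurableTypeR R)) by exact: mitv.
split.
  have [Lf2 bf] := wave_boundary T Lf.
  have Lq e : L2 `]0, T[ (fun t => (wave f t e - wave f t 0) / e).
    have L1 := L2_sub (mitv _) (locL2_shift e (prim_locL2 Lf) 0 T)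
      (locL2_shift (- e) (prim_locL2 Lf) 0 T).
    apply: eq_L2 (L2_scale e^-1 (mitv _) L1) => t _.
    by rewrite wave_at0 subr0 /wave (addrC e) (addrC (- e)) mulrC.
  apply: (L2norm_cvg_unique _ _ _ _ Lg Lf2 bg bf).
  - exact: mitv.
  - near=> e; apply: (@eq_L2 _ _ (fun t => (wave f t e - wave f t 0) / e - g t)).
      move=> t; rewrite /= in_itv/= => /andP[t0 tT].
      have tT' : 0 <= t <= T by rewrite (ltW t0) (ltW tT).
      have [E _] := U t tT'; rewrite !E// ?lexx ?ler01//.
      by apply/andP; split; near: e; [exact: nbhs_right_ge|exact: nbhs_right_le].
    by apply: L2_sub => //; exact: mitv.
  - by apply: nearW => e; apply: L2_sub => //; exact: mitv.
  - near=> e => t; rewrite /= in_itv/= => /andP[t0 tT].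
    have tT' : 0 <= t <= T by rewrite (ltW t0) (ltW tT).
    have [E _] := U t tT'; rewrite !E// ?lexx ?ler01//.
    by apply/andP; split; near: e; [exact: nbhs_right_ge|exact: nbhs_right_le].
move=> yT ytT.
have TT : 0 <= T <= T by rewrite lexx ltW.
have [E E'] := U T TT.
have x0 : sqn `]0, 1[ (wave_x f T) = 0.
  apply: H1_derivative_eq0 (wave_H1 T Lf) _ => x x01.
  by rewrite -E// yT.
have t0 : sqn `]0, 1[ (wave_t f T) = 0.
  apply: sqn_ae0 => //; first exact: L2_wave_t.
  by apply: aeS2 E' ytT => x H H' x01; rewrite -H// H'.
have Lx : L2 `]0, 1[ (wave_x f T) by exact: L2_wave_x.
have Lt : L2 `]0, 1[ (wave_t f T) by exact: L2_wave_t.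
have LT (a b : R) : L2 `]a, b[ (fun s => f (T + s)) by exact: locL2_shift.
have i0 : ip `]0, 1[ (wave_x f T) (wave_t f T) = 0 by exact: ip_eq0.
rewrite /sqn (@Rint_split _ _ (-1) 0 1); [|lra|lra|exact: L2_sqr (mitv _) (LT _ _)].
have -> : \int[mu]_(x in `](-1), 0[) f (T + x) ^+ 2 =
    \int[mu]_(x in `]0, 1[) f (T + (0 - x)) ^+ 2.
  have := @sqn_reflect R 0 0 1 (fun s => f (T + s)); rewrite sub0r subr0 => H.
  by apply/esym/H; exact: LT.
have -> : \int[mu]_(x in `]0, 1[) f (T + (0 - x)) ^+ 2 =
    sqn `]0, 1[ (fun x => 2^-1 * wave_x f T x + (- 2^-1) * wave_t f T x).
  by apply: eq_sqn => x _; rewrite sub0r /wave_x /wave_t; field.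
have -> : \int[mu]_(x in `]0, 1[) f (T + x) ^+ 2 =
    sqn `]0, 1[ (fun x => 2^-1 * wave_x f T x + 2^-1 * wave_t f T x).
  by apply: eq_sqn => x _; rewrite /wave_x /wave_t; field.
by rewrite !sqn_lin// x0 t0 i0 !mulr0 !addr0.
Unshelve. all: by end_near. Qed.

End Data.
End Admissible.

(** * The two optimal controls *)

Section Optimal.
Context {R : realType}.
Local Notation mu := (@lebesgue_measure R).
Implicit Types (f g p q u : R -> R) (phi : nat -> R -> R).

Lemma sqn_split f (a b c : R) : locL2 f -> a <= b -> b <= c ->
  sqn `]a, c[ f = sqn `]a, b[ f + sqn `]b, c[ f.
Proof.
by move=> Lf ab bc; rewrite /sqn (Rint_split ab bc)//; exact: L2_sqr (mitv _) (Lf _ _).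
Qed.

Lemma sqn_subset f (a b c d : R) : locL2 f -> c <= a -> b <= d ->
  sqn `]a, b[ f <= sqn `]c, d[ f.
Proof.
move=> Lf ca bd; apply: ge0_subset_Rintegral; [exact: mitv|exact: mitv| | |].
- exact: subset_itvW.
- exact: L2_sqr (mitv _) (Lf _ _).
- by move=> x; exact: sqr_ge0.
Qed.

Lemma sqn_blocks f (c : R) N : locL2 f ->
  sqn `]c, c + (2 * N)%:R[ f =
  \sum_(k < N) sqn `]-1, 1[ (fun s => f (c + (2 * k)%:R + 1 + s)).
Proof.
move=> Lf; elim: N => [|N IH].
  by rewrite muln0 addr0 big_ord0 /sqn Rint_empty.
have N0 : (0 : R) <= N%:R by exact: ler0n.
have E : c + (2 * N.+1)%:R = c + (2 * N)%:R + 2 by rewrite !natrM -(natr1 N); ring.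
rewrite big_ord_recr/= -IH (@sqn_split _ _ (c + (2 * N)%:R))//.
- have e1 : c + (2 * N)%:R + 1 + -1 = c + (2 * N)%:R by ring.
  have e2 : c + (2 * N)%:R + 1 + 1 = c + (2 * N.+1)%:R by rewrite E; ring.
  by congr (_ + _); rewrite sqn_shift ?e1 ?e2//; exact: Lf.
- by rewrite natrM; lra.
- by rewrite E; lra.
Qed.

Lemma glue_control phi k (s : R) : -1 <= s < 1 ->
  glue phi ((2 * k)%:R + 1 + s + 1) + glue phi ((2 * k)%:R + 1 + s - 1) =
  phi k.+1 s + phi k s.
Proof.
move=> s1; have -> : (2 * k)%:R + 1 + s + 1 = (2 * k.+1)%:R + s.
  by rewrite !natrM -(natr1 k); ring.
have -> : (2 * k)%:R + 1 + s - 1 = (2 * k)%:R + s by ring.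
by rewrite !glueE.
Qed.

Lemma locL2_control f : locL2 f -> locL2 (fun t => f (t + 1) + f (t - 1)).
Proof. by move=> Lf a b; exact: L2_control. Qed.

Lemma sqn_glue_control phi N : (forall k, L2 setT (phi k)) ->
  sqn `]0, (2 * N)%:R[ (fun t => glue phi (t + 1) + glue phi (t - 1)) =
  \sum_(k < N) sqn `]-1, 1[ (fun s => phi k.+1 s + phi k s).
Proof.
move=> Lphi; have := sqn_blocks 0 N (locL2_control (glue_locL2 Lphi)).
rewrite add0r => ->; apply: eq_bigr => k _; apply: eq_sqn => s.
rewrite /= in_itv/= => /andP[s1 s2].
by rewrite add0r glue_control// s2 ltW.
Qed.

Lemma sqn_glue phi N : (forall k, L2 setT (phi k)) ->
  sqn `]0, (2 * N)%:R + 1[ (glue phi) = sqn `]0, 1[ (phi 0%N) +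
  \sum_(k < N) sqn `]-1, 1[ (phi k.+1).
Proof.
move=> Lphi; have N0 : (0 : R) <= N%:R by exact: ler0n.
have Lf := glue_locL2 Lphi.
rewrite (@sqn_split _ _ 1)//; last by rewrite natrM; lra.
congr (_ + _).
  by apply: eq_sqn => s; rewrite /= in_itv/= => /andP[_ s1]; rewrite glue0.
rewrite (addrC _ 1) sqn_blocks//; apply: eq_bigr => k _; apply: eq_sqn => s.
rewrite /= in_itv/= => /andP[s1 s2].
rewrite (_ : 1 + _ + 1 + s = (2 * k.+1)%:R + s); last first.
  by rewrite !natrM -(natr1 k); ring.
by rewrite glueE// s2 ltW.
Qed.

Lemma cost_sqn (l a b : R) u g : L2 `]a, b[ u -> L2 `]a, b[ g ->
  cost l `]a, b[ u g = ((1 - l) * sqn `]a, b[ g + l * sqn `]a, b[ u)%:E.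
Proof.
move=> Lu Lg; have Iu := L2_sqr (mitv _) Lu; have Ig := L2_sqr (mitv _) Lg.
have I1 := integrable_scale (1 - l) (mitv _) Ig.
have I2 := integrable_scale l (mitv _) Iu.
have -> : (1 - l) * sqn `]a, b[ g + l * sqn `]a, b[ u =
    \int[mu]_(x in `]a, b[) ((1 - l) * g x ^+ 2 + l * u x ^+ 2).
  rewrite RintegralD; [|exact: mitv|exact: I1|exact: I2].
  rewrite RintegralZl; [|exact: mitv|exact: Iu].
  by rewrite RintegralZl; [|exact: mitv|exact: Ig].
rewrite /Rintegral fineK//.
exact: (integrable_fin_num (mitv _) (integrable_add (mitv _) I1 I2)).
Qed.

Section Data.
Variables (y0 dy0 y1 : R -> R).
Hypotheses (hy0 : H1_with_derivative y0 dy0) (hy00 : y0 0 = 0).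
Hypothesis hy1 : L2 `]0, 1[ y1.
Local Notation a := (init dy0 y1).
Local Notation m := (`]-1, 1[%classic : set (measurableTypeR R)).

Let La : L2 setT a. Proof. exact: (L2_init hy0 hy1). Qed.
Let Lam : L2 m a. Proof. by apply: L2T_loc. Qed.
Let mm : measurable m. Proof. exact: mitv. Qed.

(** The numbers (-1)^k <phi_k, a> go from |a|^2 to 0 with decrements
    (-1)^k <u_k, a>, which therefore add up to |a|^2. Expanding the squares,
    the sum of |u_k - (-1)^k a / n|^2 is the cost of u minus |a|^2 / n, and
    |a|^2 / n is the cost of an admissible control. *)
Lemma finite_optimal n u : (0 < n)%N ->
  optimal_control 1 (2 * n)%:R y0 y1 u -> forall k, (k < n)%N ->
  sqn m (fun s => u ((2 * k)%:R + 1 + s) - (-1) ^+ k * n%:R^-1 * a s) = 0.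
Proof.
move=> n0 [g [[Lu [y [yx [yt [S bg yT ytT]]]]] opt]].
have n0R : (0 : R) < n%:R by rewrite ltr0n.
pose T : R := (2 * n)%:R; have T0 : 0 < T by rewrite /T ltr0n muln_gt0.
pose v := u \_ `]0, T[.
have Lv : L2 setT v by apply/(L2_patch _ (mitv _)).
have vE t : 0 < t < T -> v t = u t.
  by move=> tT; rewrite /v patchE mem_set//= in_itv.
pose phi := profile dy0 y1 v.
have Lphi k : L2 setT (phi k) by exact: (L2_profile hy0 hy1).
have Lf := glue_locL2 Lphi.
have uE t : 0 < t < T -> u t = glue phi (t + 1) + glue phi (t - 1).
  by move=> tT; rewrite -vE// /phi -glue_profile//; case/andP: tT => /ltW.
have [w0 w1] := glue_init hy0 hy00 (erefl (phi 0%N)) Lphi.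
have W := wave_solution Lf w0 w1 uE.
have [_ /(_ yT ytT)] := solution_profile hy1 T0 Lu S bg W Lf.
pose U k s := phi k.+1 s + phi k s.
rewrite (@eq_sqn _ _ _ (phi n)); last first.
  by move=> s; rewrite /= in_itv/= => /andP[s1 s2]; rewrite glueE// s2 ltW.
move=> phin.
have Lphim k : L2 m (phi k) by apply: L2T_loc.
have LU k : L2 m (U k) by exact: L2_add.
have sU : sqn `]0, T[ u = \sum_(k < n) sqn m (U k).
  rewrite -(sqn_glue_control n Lphi); apply: eq_sqn => t.
  by rewrite /= in_itv/=; exact: uE.
(* the optimal blocks, which vanish for k = n *)
pose psi k s := (-1) ^+ k * (1 - k%:R / n%:R) * a s.
have Lpsi k : L2 setT (psi k) by exact: L2_scale.
have psi0 : psi 0%N = a.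
  by apply/funext => s; rewrite /psi expr0 mul0r subr0 !mul1r.
have psin s : psi n s = 0 by rewrite /psi divff ?gt_eqF// subrr mulr0 mul0r.
have adm := glue_admissible hy0 hy00 psi0 Lpsi psin.
have := opt _ _ adm.
have Lc := L2_control 0 T (glue_locL2 Lpsi).
have Lg2 : L2 `]0, T[ (fun t => 2 * glue psi t).
  by apply: L2_scale; [exact: mitv|exact: glue_locL2].
rewrite (cost_sqn 1 Lu bg.1) (cost_sqn 1 Lc Lg2) lee_fin !subrr !mul0r !add0r !mul1r.
rewrite sU (sqn_glue_control n Lpsi) => le1.
have sp : \sum_(k < n) sqn m (fun s => psi k.+1 s + psi k s) = n%:R^-1 * sqn m a.
  transitivity (\sum_(k < n) n%:R^-1 ^+ 2 * sqn m a).
    apply: eq_bigr => k _.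
    rewrite (@eq_sqn _ _ _ (fun s => ((-1) ^+ k * n%:R^-1) * a s)).
      by rewrite sqnZ// exprMn -exprM mulnC exprM sqrrN expr1n expr1n mul1r.
    move=> s _; rewrite /psi exprS -(natr1 k); field.
    by rewrite gt_eqF.
  by rewrite sumr_const card_ord -mulr_natl; field; rewrite gt_eqF.
rewrite sp in le1.
have telescope N : (-1) ^+ N * ip m (phi N) a =
    sqn m a - \sum_(k < N) (-1) ^+ k * ip m (U k) a.
  elim: N => [|N IH]; first by rewrite big_ord0 subr0 mul1r.
  rewrite big_ord_recr/= opprD addrA -IH /U ipDl// exprS; ring.
have sumU : \sum_(k < n) (-1) ^+ k * ip m (U k) a = sqn m a.
  have := telescope n; rewrite (ip_eq0 _ _ _ phin)// mulr0 => /esym/eqP.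
  by rewrite subr_eq0 => /eqP.
have tot : \sum_(k < n) sqn m (fun s => U k s - (-1) ^+ k * n%:R^-1 * a s) <= 0.
  have -> : \sum_(k < n) sqn m (fun s => U k s - (-1) ^+ k * n%:R^-1 * a s) =
      \sum_(k < n) (sqn m (U k) - 2 * n%:R^-1 * ((-1) ^+ k * ip m (U k) a) +
        n%:R^-1 ^+ 2 * sqn m a).
    apply: eq_bigr => k _.
    rewrite (@eq_sqn _ _ _ (fun s => 1 * U k s + (- ((-1) ^+ k * n%:R^-1)) * a s)).
      rewrite sqn_lin// sqrrN exprMn -exprM mulnC exprM sqrrN !expr1n.
      by ring.
    by move=> s _; ring.
  rewrite big_split big_split/= sumrN -mulr_sumr sumU sumr_const card_ord.
  have -> : n%:R^-1 ^+ 2 * sqn m a *+ n = n%:R^-1 * sqn m a.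
    by rewrite -mulr_natl; field; rewrite gt_eqF.
  by lra.
have all0 (k : 'I_n) : sqn m (fun s => U k s - (-1) ^+ k * n%:R^-1 * a s) = 0.
  apply: (@psumr_eq0P R 'I_n xpredT
    (fun k => sqn m (fun s => U k s - (-1) ^+ k * n%:R^-1 * a s))) => //.
    by move=> i _; exact: sqn_ge0.
  by apply/eqP; rewrite eq_le tot sumr_ge0// => i _; exact: sqn_ge0.
move=> k kn; rewrite -(all0 (Ordinal kn)); apply: eq_sqn => s.
rewrite /= in_itv/= => /andP[s1 s2]; congr (_ - _).
have kn' : (k%:R : R) + 1 <= n%:R by rewrite natr1 ler_nat.
have k0 : (0 : R) <= k%:R by exact: ler0n.
rewrite uE; first by rewrite glue_control// s2 ltW.
by rewrite /T !natrM; apply/andP; split; lra.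
Qed.

(** Dynamic programming, with f = phi_k and g = phi_(k+1): up to the factor
    4 / (1 - z)^2, the running cost of one block equals the decrease of the
    value function - z (1 + z) |f|^2 plus the square of the deviation from the
    feedback g = z f. *)
Lemma block_cost (z : R) f g : L2 m f -> L2 m g ->
  - z * sqn m (fun s => g s + f s) + (1 + z) ^+ 2 * sqn m g =
  - z * (1 + z) * (sqn m f - sqn m g) + sqn m (fun s => g s - z * f s).
Proof.
move=> Lf Lg.
rewrite (@eq_sqn _ m (fun s => g s + f s) (fun s => 1 * g s + 1 * f s)); last first.
  by move=> s _; ring.
rewrite (@eq_sqn _ m (fun s => g s - z * f s) (fun s => 1 * g s + (- z) * f s)); last first.
  by move=> s _; ring.
by rewrite !sqn_lin//; ring.
Qed.

Lemma total_cost (z : R) phi N : (forall k, L2 m (phi k)) ->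
  - z * \sum_(k < N) sqn m (fun s => phi k.+1 s + phi k s) +
  (1 + z) ^+ 2 * \sum_(k < N) sqn m (phi k.+1) =
  - z * (1 + z) * (sqn m (phi 0%N) - sqn m (phi N)) +
  \sum_(k < N) sqn m (fun s => phi k.+1 s - z * phi k s).
Proof.
move=> Lphi; elim: N => [|N IH]; first by rewrite !big_ord0; ring.
have := block_cost z (Lphi N) (Lphi N.+1).
rewrite !big_ord_recr/= !mulrDr.
set S1 := \sum_(k < N) _ in IH *; set S2 := \sum_(k < N) _ in IH *.
set S3 := \sum_(k < N) _ in IH *; lra.
Qed.

(** Each d k is at most K times every later s N; adding N such inequalities
    gives N d k <= K B for all N. *)
Lemma summable_deviation_eq0 (d s : R ^nat) (B K : R) :
  (forall k, 0 <= d k) -> (forall k, 0 <= s k) -> 0 <= K ->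
  (forall N, \sum_(k < N) s k <= B) ->
  (forall N, \sum_(k < N.+1) d k <= K * s N) -> forall k, d k = 0.
Proof.
move=> d0 s0 K0 sB dK k; apply/eqP; rewrite eq_le d0 andbT leNgt; apply/negP => dk.
have le N : N%:R * d k <= K * B.
  apply: (@le_trans _ _ (K * \sum_(k < k + N) s k)); last by rewrite ler_wpM2l.
  rewrite big_split_ord/= mulrDr -[leLHS]add0r lerD//.
    by rewrite mulr_ge0// sumr_ge0.
  rewrite mulr_sumr -[N in N%:R]card_ord mulr_natl -sumr_const ler_sum// => i _.
  apply: le_trans (dK _).
  have ki : (k < (k + i).+1)%N by rewrite ltnS leq_addr.
  by rewrite (bigD1 (Ordinal ki))//= lerDl sumr_ge0.
have B0 : 0 <= B by have := sB 0%N; rewrite big_ord0.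
have := archi_boundP (divr_ge0 (mulr_ge0 K0 B0) (ltW dk)).
by rewrite ltr_pdivrMr// ltNge le.
Qed.

End Data.
End Optimal.

Section OptimalInfinite.
Context {R : realType}.
Local Notation mu := (@lebesgue_measure R).
Implicit Types (f g p q u : R -> R) (phi : nat -> R -> R).

Lemma itv_bigcup : (`]0%R, +oo[%classic : set R) =
  \bigcup_N `]0%R, (2 * N)%:R[%classic.
Proof.
apply/seteqP; split => [x|x [N _]] /=; rewrite !in_itv/= ?andbT.
  move=> x0; exists (Num.bound x) => //=; rewrite in_itv/= x0/=.
  have := archi_boundP (ltW x0); rewrite natrM; lra.
by case/andP.
Qed.

Lemma measurable_fun_pos (h : R -> R) :
  (forall T : R, 0 < T -> measurable_fun (`]0, T[ : set (measurableTypeR R)) h) ->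
  measurable_fun (`]0%R, +oo[%classic : set (measurableTypeR R)) h.
Proof.
move=> mh; rewrite itv_bigcup; apply/measurable_fun_bigcup => N.
  exact: mitv.
have [->|N0] := posnP N; last by apply: mh; rewrite ltr0n muln_gt0.
rewrite muln0 (_ : `]0%R, 0%R[%classic = set0); first exact: measurable_fun_set0.
by rewrite set_itv_ge// bnd_simp ltxx.
Qed.

Lemma integral_pos_le (F : R -> \bar R) (C : \bar R) :
  measurable_fun (`]0%R, +oo[%classic : set (measurableTypeR R)) F ->
  (forall x, 0 <= F x)%E ->
  (forall N, \int[mu]_(x in `]0%R, (2 * N)%:R[) F x <= C)%E ->
  (\int[mu]_(x in `]0%R, +oo[) F x <= C)%E.
Proof.
move=> mF F0 FC; rewrite itv_bigcup.
have nd : {homo (fun N => `]0%R, (2 * N)%:R[%classic : set (measurableTypeR R)) :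
    n m0 / (n <= m0)%N >-> (n <= m0)%O}.
  move=> i j ij; rewrite subsetEset; apply: subset_itvl; rewrite bnd_simp.
  by rewrite ler_nat leq_mul2l ij orbT.
have mFN i : measurable_fun (`]0%R, (2 * i)%:R[%classic : set (measurableTypeR R)) F.
  apply: measurable_funS mF; first exact: mitv.
  by apply: subset_itvl.
have := ge0_nondecreasing_set_cvg_integral nd (fun i => mitv _) mFN
  (mu := mu) (fun i x _ => F0 x).
move=> H; rewrite -(cvg_lim _ H)//; apply: lime_le.
  by apply/cvg_ex; eexists; exact: H.
exact: nearW.
Qed.

Section Data.
Variables (y0 dy0 y1 : R -> R).
Hypotheses (hy0 : H1_with_derivative y0 dy0) (hy00 : y0 0 = 0).
Hypothesis hy1 : L2 `]0, 1[ y1.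
Local Notation a := (init dy0 y1).
Local Notation m := (`]-1, 1[%classic : set (measurableTypeR R)).

Let La : L2 setT a. Proof. exact: (L2_init hy0 hy1). Qed.
Let Lam : L2 m a. Proof. by apply: L2T_loc. Qed.
Let mm : measurable m. Proof. exact: mitv. Qed.

Section Feedback.
Variable z : R.
Hypothesis z01 : -1 < z <= 0.
Let lambda : R := - 4 * z / (1 - z) ^+ 2.
Let kappa : R := 4 / (1 - z) ^+ 2.

Let kappa0 : 0 < kappa.
Proof. by rewrite divr_gt0// exprn_gt0//; move/andP: z01 => []; lra. Qed.

Let lambdaE : lambda = kappa * - z.
Proof. by rewrite /lambda /kappa; ring. Qed.

Let mu_lambdaE : 4 * (1 - lambda) = kappa * (1 + z) ^+ 2.
Proof.
rewrite /lambda /kappa; field.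
by move/andP: z01 => [] ? ?; rewrite gt_eqF//; lra.
Qed.

Let lambda0 : 0 <= lambda.
Proof. by rewrite lambdaE mulr_ge0 ?(ltW kappa0)//; move/andP: z01 => []; lra. Qed.

Let lambda1 : 0 <= 1 - lambda.
Proof.
suff : 0 <= 4 * (1 - lambda) by lra.
by rewrite mu_lambdaE mulr_ge0 ?(ltW kappa0)// sqr_ge0.
Qed.

Let split_cost (X Y : R) :
  kappa * (- z * X + (1 + z) ^+ 2 * Y) = lambda * X + 4 * (1 - lambda) * Y.
Proof. by rewrite mu_lambdaE lambdaE; ring. Qed.

(* the blocks produced by the feedback *)
Let psi k (s : R) : R := z ^+ k * a s.

Let Lpsi k : L2 setT (psi k).
Proof. exact: L2_scale. Qed.

Let psi0 : psi 0%N = a.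
Proof. by apply/funext => s; rewrite /psi expr0 mul1r. Qed.

(* the value of the infinite horizon problem, up to the factor kappa and the
   constant c0 below *)
Let V : R := - z * (1 + z) * sqn m a.

Let w0 : 0 <= - z * (1 + z).
Proof. by move/andP: z01 => [? ?]; rewrite mulr_ge0; lra. Qed.

Let total_cost_psi N :
  - z * \sum_(k < N) sqn m (fun s => psi k.+1 s + psi k s) +
  (1 + z) ^+ 2 * \sum_(k < N) sqn m (psi k.+1) <= V.
Proof.
have Lm k : L2 m (psi k) by apply: L2T_loc.
rewrite total_cost// [X in _ + X]big1 ?addr0; last first.
  move=> k _; rewrite (@eq_sqn _ _ _ (fun=> 0)); first exact: sqn0.
  by move=> s _; rewrite /psi exprS; ring.
by rewrite psi0 /V mulrBr gerBl; apply: mulr_ge0; [exact: w0|exact: sqn_ge0].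
Qed.

Let sum_psi : exists B, forall N, \sum_(k < N) sqn m (psi k.+1) <= B.
Proof.
exists (V / (1 + z) ^+ 2) => N.
have z1 : 0 < 1 + z by move/andP: z01 => []; lra.
rewrite ler_pdivlMr ?exprn_gt0// mulrC; apply: le_trans (total_cost_psi N).
rewrite lerDr mulr_ge0//; first by move/andP: z01 => []; lra.
by rewrite sumr_ge0// => k _; exact: sqn_ge0.
Qed.

Let v t := glue psi (t + 1) + glue psi (t - 1).

Let Lv : L2 `]0%R, +oo[ v.
Proof.
have Lf := glue_locL2 Lpsi.
have Lc := locL2_control Lf.
have mv := locL2_measurable Lc.
apply/(L2P _ (mitv _)); split; first exact: measurable_funTS.
have [B HB] := sum_psi.
have mv2 : measurable_fun (`]0%R, +oo[%classic : set (measurableTypeR R))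
    (EFin \o (fun x => v x ^+ 2)).
  by apply/measurable_EFinP/measurable_funTS/measurable_funX.
apply/integrableP; split => //.
apply: (@le_lt_trans _ _ (4 * B + 2 * sqn m a)%:E); last exact: ltry.
apply: integral_pos_le => //; first exact: measurableT_comp.
move=> N; under eq_integral do rewrite /= ger0_norm ?sqr_ge0//.
have I := L2_sqr (mitv _) (Lc 0 (2 * N)%:R).
rewrite -[X in (X <= _)%E](fineK (integrable_fin_num (mitv _) I)) lee_fin.
rewrite -[X in X <= _]/(sqn `]0, (2 * N)%:R[ v) (sqn_glue_control N Lpsi).
have Lm k : L2 m (psi k) by apply: L2T_loc.
apply: (@le_trans _ _ (\sum_(k < N) (2 * sqn m (psi k.+1) + 2 * sqn m (psi k)))).
  by apply: ler_sum => k _; exact: sqn_add_le.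
rewrite big_split/= -!mulr_sumr.
have S0 : \sum_(k < N) sqn m (psi k) <= sqn m (psi 0%N) + B.
  apply: (@le_trans _ _ (\sum_(k < N.+1) sqn m (psi k))).
    by rewrite big_ord_recr/= lerDl sqn_ge0.
  by rewrite big_ord_recl lerD2l; exact: HB.
by have := HB N; move: S0; rewrite psi0; lra.
Qed.

Let adm : admissible_infinite y0 y1 v (fun t => 2 * glue psi t).
Proof.
split; first exact: Lv.
exists (wave (glue psi)), (wave_x (glue psi)), (wave_t (glue psi)) => T T0.
by have [] := glue_admissible_state hy0 hy00 T psi0 Lpsi; split.
Qed.

Let cost_meas (D : set (measurableTypeR R)) (u g : R -> R) :
  measurable_fun D u -> measurable_fun D g ->
  measurable_fun D (fun t => ((1 - lambda) * g t ^+ 2 + lambda * u t ^+ 2)%:E).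
Proof.
move=> mu' mg; apply/measurable_EFinP; apply: measurable_funD;
  apply: measurable_funM => //; exact: measurable_funX.
Qed.

Let cost_ge0 (u g : R -> R) (t : R) :
  (0 <= ((1 - lambda) * g t ^+ 2 + lambda * u t ^+ 2)%:E)%E.
Proof. by rewrite lee_fin addr_ge0// mulr_ge0// sqr_ge0. Qed.

(* the cost of the boundary derivative on ]0, 1[, which depends on the data
   only *)
Let c0 : R := (1 - lambda) * (4 * sqn `]0, 1[ a).

Let cost_psi : (cost lambda `]0%R, +oo[ v (fun t => 2 * glue psi t)%R <=
  (kappa * V + c0)%:E)%E.
Proof.
have Lf := glue_locL2 Lpsi; have mf := locL2_measurable Lf.
have mv := L2_meas (mitv _) Lv.
have mg : measurable_fun setT (fun t => 2 * glue psi t).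
  by apply: measurable_funM => //; exact: measurable_cst.
rewrite /cost; apply: integral_pos_le.
- exact: (cost_meas mv (measurable_funTS mg)).
- by move=> t; exact: (cost_ge0 v (fun t => 2 * glue psi t)).
move=> N; have Lc := L2_control 0 (2 * N)%:R Lf.
have Lg : L2 `]0, (2 * N)%:R[ (fun t => 2 * glue psi t).
  by apply: L2_scale => //; exact: mitv.
have Lg0 : L2 `]0, (2 * N)%:R + 1[ (glue psi) by [].
rewrite -/(cost lambda `]0%R, (2 * N)%:R[ v (fun t => 2 * glue psi t)%R).
rewrite (cost_sqn _ Lc Lg) lee_fin sqnZ; [|exact: mitv|exact: Lf].
have S1 : sqn `]0, (2 * N)%:R[ (glue psi) <= sqn `]0, (2 * N)%:R + 1[ (glue psi).
  by apply: sqn_subset => //; lra.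
rewrite (sqn_glue N Lpsi) psi0 in S1.
rewrite (sqn_glue_control N Lpsi).
have := total_cost_psi N.
set X := \sum_(k < N) _; set Y := \sum_(k < N) _ in S1 *.
move=> tot; have k0 := kappa0.
have S2 : (1 - lambda) * (2 ^+ 2 * sqn `]0, (2 * N)%:R[ (glue psi)) <=
    (1 - lambda) * (4 * (sqn `]0, 1[ a + Y)).
  by rewrite ler_wpM2l//; lra.
apply: (@le_trans _ _ (kappa * (- z * X + (1 + z) ^+ 2 * Y) + c0)).
  by rewrite split_cost /c0; lra.
by rewrite lerD2r ler_pM2l.
Qed.

(** The competitor shows that the optimal cost is at most kappa V + c0. By
    [total_cost], this bounds the sum of the |phi_k|^2, and bounds the sum of
    the first squared deviations by - z (1 + z) |phi_N|^2 for every N, so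
    that [summable_deviation_eq0] applies. *)
Lemma infinite_optimal u : optimal_control_infinite lambda y0 y1 u ->
  forall k, sqn m (fun s => u ((2 * k)%:R + 1 + s) - (1 + z) * z ^+ k * a s) = 0.
Proof.
move=> [g [[Lu [y [yx [yt S]]]] opt]].
pose w := u \_ `]0%R, +oo[.
have Lw : L2 setT w by apply/(L2_patch _ (mitv _)).
have wE t : 0 < t -> w t = u t.
  by move=> t0; rewrite /w patchE mem_set//= in_itv/= t0.
pose phi := profile dy0 y1 w.
have Lphi k : L2 setT (phi k) by exact: (L2_profile hy0 hy1).
have Lphim k : L2 m (phi k) by apply: L2T_loc.
have Lf := glue_locL2 Lphi.
have uE t : 0 < t -> u t = glue phi (t + 1) + glue phi (t - 1).
  by move=> t0; rewrite -wE// /phi -glue_profile// ltW.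
have [d0 d1] := glue_init hy0 hy00 (erefl (phi 0%N)) Lphi.
have LuT (T : R) : L2 `]0, T[ u.
  by apply: L2_subset Lu; [exact: mitv|exact: mitv|exact: subset_itvl].
have gE (T : R) : 0 < T -> ae_eq_on `]0, T[ g (fun t => 2 * glue phi t).
  move=> T0; have [ST bT] := S T T0.
  have W : finite_energy_solution T y0 y1 u (wave (glue phi)) (wave_x (glue phi))
      (wave_t (glue phi)).
    by apply: wave_solution => // t /andP[t0 _]; exact: uE.
  by have [] := solution_profile hy1 T0 (LuT T) ST bT W Lf.
have LgT (T : R) : 0 < T -> L2 `]0, T[ g by move=> T0; have [_ []] := S T T0.
have mg : measurable_fun (`]0%R, +oo[%classic : set (measurableTypeR R)) g.
  by apply: measurable_fun_pos => T T0; exact: L2_meas (mitv _) (LgT T T0).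
have mu' := L2_meas (mitv _) Lu.
have lower N : ((kappa * (- z * \sum_(k < N) sqn m (fun s => phi k.+1 s + phi k s) +
    (1 + z) ^+ 2 * \sum_(k < N) sqn m (phi k.+1)) + c0)%R%:E <=
    cost lambda `]0%R, +oo[ u g)%E.
  pose T : R := (2 * N)%:R + 1.
  have N0 : (0 : R) <= (2 * N)%:R by exact: ler0n.
  have T0 : 0 < T by rewrite /T; lra.
  apply: (@le_trans _ _ (cost lambda `]0%R, T[ u g)); last first.
    apply: ge0_subset_integral; [exact: mitv|exact: mitv| | |exact: subset_itvl].
      exact: cost_meas.
    by move=> t _; exact: cost_ge0.
  rewrite (cost_sqn _ (LuT T) (LgT T T0)) lee_fin.
  rewrite (sqn_ae (mitv _) (LgT T T0) _ (gE T T0)); last first.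
    by apply: L2_scale; [exact: mitv|exact: Lf].
  rewrite sqnZ; [|exact: mitv|exact: Lf].
  rewrite (sqn_glue N Lphi).
  have U1 : sqn `]0, (2 * N)%:R[ u <= sqn `]0, T[ u.
    apply: ge0_subset_Rintegral; [exact: mitv|exact: mitv| | |].
    - by apply: subset_itvW => //; rewrite /T; lra.
    - exact: L2_sqr (mitv _) (LuT T).
    - by move=> x; exact: sqr_ge0.
  have U2 : sqn `]0, (2 * N)%:R[ u = \sum_(k < N) sqn m (fun s => phi k.+1 s + phi k s).
    rewrite -(sqn_glue_control N Lphi); apply: eq_sqn => t.
    by rewrite /= in_itv/= => /andP[t0 _]; exact: uE.
  rewrite split_cost -U2 /c0.
  have U3 : lambda * sqn `]0, (2 * N)%:R[ u <= lambda * sqn `]0, T[ u by rewrite ler_wpM2l.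
  by rewrite -/a; lra.
have k0 := kappa0.
have value N : - z * \sum_(k < N) sqn m (fun s => phi k.+1 s + phi k s) +
    (1 + z) ^+ 2 * \sum_(k < N) sqn m (phi k.+1) <= V.
  have := le_trans (lower N) (le_trans (opt _ _ adm) cost_psi).
  by rewrite lee_fin lerD2r ler_pM2l.
have z1 : 0 < 1 + z by move/andP: z01 => []; lra.
have dev0 k : sqn m (fun s => phi k.+1 s - z * phi k s) = 0.
  apply: (@summable_deviation_eq0 R
    (fun k => sqn m (fun s => phi k.+1 s - z * phi k s))
    (fun k => sqn m (phi k.+1)) (V / (1 + z) ^+ 2) (- z * (1 + z))) => //.
  - by move=> j; exact: sqn_ge0.
  - by move=> j; exact: sqn_ge0.
  - move=> N; rewrite ler_pdivlMr ?exprn_gt0// mulrC; apply: le_trans (value N).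
    rewrite lerDr mulr_ge0//; first by move/andP: z01 => []; lra.
    by rewrite sumr_ge0// => j _; exact: sqn_ge0.
  - move=> N; have := value N.+1; rewrite total_cost// /V.
    by rewrite -[phi 0%N]/a mulrBr; lra.
have phi_psi k : sqn m (fun s => phi k s - z ^+ k * a s) = 0.
  elim: k => [|k IH].
    rewrite (@eq_sqn _ _ _ (fun=> 0)); first exact: sqn0.
    by move=> s _; rewrite expr0 mul1r -[phi 0%N s]/(a s) subrr.
  have L1 : L2 m (fun s => phi k.+1 s - z * phi k s).
    by apply: L2_sub => //; exact: L2_scale.
  have L2' : L2 m (fun s => phi k s - z ^+ k * a s).
    by apply: L2_sub => //; exact: L2_scale.
  have := sqn_lin 1 z mm L1 L2'; rewrite dev0 IH (ip_eq0 _ L1 L2' (dev0 k))//.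
  rewrite !mulr0 !addr0 => <-; apply: eq_sqn => s _; rewrite exprS; ring.
move=> k.
have L1 j : L2 m (fun s => phi j s - z ^+ j * a s).
  by apply: L2_sub => //; exact: L2_scale.
have := sqn_lin 1 1 mm (L1 k.+1) (L1 k).
rewrite !phi_psi (ip_eq0 _ (L1 k.+1) (L1 k) (phi_psi k.+1))// !mulr0 !addr0 => <-.
apply: eq_sqn => s; rewrite /= in_itv/= => /andP[s1 s2].
have kk : (0 : R) <= (2 * k)%:R by exact: ler0n.
rewrite uE; last lra.
by rewrite glue_control ?s2 ?(ltW s1)// exprS; ring.
Qed.

End Feedback.
End Data.
End OptimalInfinite.

(** * Comparison of the two controls *)

Section Comparison.
Context {R : realType}.

Lemma zlam_inverse (z : R) : -1 < z <= 0 ->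
  let lambda := - 4 * z / (1 - z) ^+ 2 in
  0 <= lambda < 1 /\ zlam lambda = z.
Proof.
move=> /andP[z1 z0] lambda.
have z2 : 1 - z != 0 by rewrite gt_eqF//; lra.
have E : 1 - lambda = ((1 + z) / (1 - z)) ^+ 2 by rewrite /lambda; field.
have q0 : 0 < (1 + z) / (1 - z) by rewrite divr_gt0//; lra.
split.
  apply/andP; split; last by have := exprn_gt0 2 q0; rewrite -E; lra.
  by rewrite /lambda divr_ge0 ?sqr_ge0//; lra.
rewrite /zlam E sqrtr_sqr gtr0_norm// /lambda; field.
by rewrite z2/= gt_eqF//; lra.
Qed.

Lemma sqn_control_difference (z : R) (u1 ulam g : R -> R) n k :
  L2 `](2 * k)%:R, (2 * k + 2)%:R[ u1 -> L2 `](2 * k)%:R, (2 * k + 2)%:R[ ulam ->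
  L2 `]-1, 1[ g -> 1 + z = n%:R^-1 -> z <= 0 ->
  sqn `]-1, 1[ (fun s => u1 ((2 * k)%:R + 1 + s) - (-1) ^+ k * n%:R^-1 * g s) = 0 ->
  sqn `]-1, 1[ (fun s => ulam ((2 * k)%:R + 1 + s) - (1 + z) * z ^+ k * g s) = 0 ->
  sqn `](2 * k)%:R, (2 * k + 2)%:R[ (u1 \- ulam) =
  ((1 - `|z| ^+ k) * (1 + z)) ^+ 2 * sqn `]-1, 1[ g.
Proof.
move=> L1 L2' Lg nz z0 s1 s2.
have mm : measurable (`]-1, 1[%classic : set (measurableTypeR R)) by exact: mitv.
have e1 : (2 * k)%:R + 1 + -1 = (2 * k)%:R :> R by ring.
have e2 : (2 * k)%:R + 1 + 1 = (2 * k + 2)%:R :> R by rewrite natrD; ring.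
rewrite -e1 -e2 in L1 L2' *.
have L1s := L2_shift L1; have L2s := L2_shift L2'.
have Ls := L2_sub (mitv _) L1 L2'.
rewrite -(@sqn_shift _ _ _ _ (u1 \- ulam) Ls).
set X := (fun s => u1 _ - _) in s1; set Y := (fun s => ulam _ - _) in s2.
have LX : L2 `]-1, 1[ X by apply: L2_sub => //; exact: L2_scale.
have LY : L2 `]-1, 1[ Y by apply: L2_sub => //; exact: L2_scale.
have LXY : L2 `]-1, 1[ (fun s => 1 * X s + -1 * Y s) by exact: L2_lin.
have sXY : sqn `]-1, 1[ (fun s => 1 * X s + -1 * Y s) = 0.
  by rewrite sqn_lin// s1 s2 (ip_eq0 mm LX LY s1); ring.
have zk : z ^+ k = (-1) ^+ k * `|z| ^+ k.
  by rewrite ler0_norm// -exprMn mulN1r opprK.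
rewrite (@eq_sqn _ _ _ (fun s => 1 * (1 * X s + -1 * Y s) +
    ((-1) ^+ k * ((1 - `|z| ^+ k) * (1 + z))) * g s)); last first.
  by move=> s _; rewrite /X /Y /= zk -nz; ring.
rewrite sqn_lin// sXY (ip_eq0 mm LXY Lg sXY) exprMn -exprM mulnC exprM sqrrN.
by rewrite !expr1n; ring.
Qed.

Lemma sqrt_half_sum_le (S0 S1 : R) : 0 <= S0 -> 0 <= S1 ->
  Num.sqrt (2^-1 * (S0 + S1)) <= Num.sqrt S0 + Num.sqrt S1.
Proof.
move=> h0 h1; rewrite -[leRHS]ger0_norm ?addr_ge0 ?sqrtr_ge0//.
rewrite -sqrtr_sqr ler_wsqrtr// sqrrD !sqr_sqrtr//.
have := mulr_ge0 (sqrtr_ge0 S0) (sqrtr_ge0 S1).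
by set p := Num.sqrt S0 * _ => p0; lra.
Qed.

End Comparison.

Theorem theorem2 (R : realType) (y0 dy0 y1 : R -> R)
    (hy0 : H1_with_derivative y0 dy0) (hy00 : y0 0 = 0)
    (hy1 : L2 `]0, 1[ y1)
    (T : nat) (hT : (0 < T)%N) (hTeven : ~~ odd T) :
  exists lambda : R,
    [/\ 0 <= lambda < 1,
        zlam lambda = 2 / T%:R - 1
      & forall u1 ulam : R -> R,
          optimal_control 1 T%:R y0 y1 u1 ->
          optimal_control_infinite lambda y0 y1 ulam ->
          ae_eq_on `]0, 2[ u1 ulam /\
          forall k : nat, (k <= (T - 2)./2)%N ->
            (L2norm `](2 * k)%:R%R, (2 * k + 2)%:R%R[ (u1 \- ulam)%R
             <= (`|1 - `|zlam lambda| ^+ k| * (2 / T%:R))%R%:E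
                * (L2norm `]0%R, 1%R[ dy0 + L2norm `]0%R, 1%R[ y1))%E].
Proof.
pose n := T./2; have Tn : T = (2 * n)%N by rewrite /n mul2n even_halfK.
have n0 : (0 < n)%N by move: hT; rewrite Tn muln_gt0.
have n0R : (0 : R) < n%:R by rewrite ltr0n.
have n1R : (1 : R) <= n%:R by rewrite ler1n.
pose z : R := 2 / T%:R - 1.
have nz : 1 + z = n%:R^-1.
  by rewrite /z Tn natrM; field; rewrite gt_eqF.
have z01 : -1 < z <= 0.
  have : 0 < n%:R^-1 :> R by rewrite invr_gt0.
  have : n%:R^-1 <= 1 :> R by rewrite invf_le1.
  by move=> ? ?; apply/andP; split; lra.
have z0 : z <= 0 by case/andP: z01.
have [l01 lz] := zlam_inverse z01.
exists (- 4 * z / (1 - z) ^+ 2); split => // u1 ulam opt1 optl.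
rewrite Tn in opt1.
have [g1 [[Lu1 _] _]] := opt1; have [g2 [[Lul _] _]] := optl.
have F := finite_optimal hy0 hy00 hy1 n0 opt1.
have G := infinite_optimal hy0 hy00 hy1 z01 optl.
have La : L2 `]-1, 1[ (init dy0 y1) by apply: L2T_loc; exact: (L2_init hy0 hy1).
have L1 k : (k < n)%N -> L2 `](2 * k)%:R, (2 * k + 2)%:R[ u1.
  move=> kn; apply: L2_subset Lu1; [exact: mitv|exact: mitv|].
  apply: subset_itvW; first exact: ler0n.
  by rewrite ler_nat -mulnSr leq_mul2l kn orbT.
have L2' k : L2 `](2 * k)%:R, (2 * k + 2)%:R[ ulam.
  apply: L2_subset Lul; [exact: mitv|exact: mitv|].
  move=> x /=; rewrite !in_itv/= => /andP[kx _]; rewrite andbT.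
  exact: le_lt_trans (ler0n _ _) kx.
have C k (kn : (k < n)%N) := sqn_control_difference (L1 k kn) (L2' k) La nz z0 (F k kn) (G k).
have LD k (kn : (k < n)%N) := L2_sub (mitv _) (L1 k kn) (L2' k).
split.
  have := C 0%N n0; rewrite expr0 subrr mul0r expr0n mul0r muln0 add0n => s0.
  have L0 := LD 0%N n0; rewrite muln0 add0n in L0.
  apply: aeS (sqn_eq0_ae (mitv _) L0 s0) => x H x02.
  by apply/eqP; rewrite -subr_eq0; apply/eqP; exact: H.
move=> k kT.
have kn : (k < n)%N.
  by move: kT; rewrite Tn mul2n -[2%N]/(1.*2)%N -doubleB doubleK subn1 -ltnS prednK.
rewrite (L2normE (mitv _) (LD k kn)) (C k kn) (L2normE (mitv _) hy0.1)
  (L2normE (mitv _) hy1) -EFinD -EFinM lee_fin (sqn_init hy0 hy1).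
rewrite sqrtrM ?sqr_ge0// sqrtr_sqr normrM.
have -> : 2 / T%:R = 1 + z by rewrite /z; ring.
rewrite lz (ger0_norm (_ : 0 <= 1 + z)); last by rewrite nz invr_ge0 ltW.
by rewrite ler_wpM2l ?mulr_ge0 ?nz ?invr_ge0 ?(ltW n0R)// sqrt_half_sum_le// sqn_ge0.
Qed.
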